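(* Let $\left((X_{t})_{t\geq 0},(\mathbb{P}_{x})_{x>0}\right)$ be a $1/\alpha$-positive self-similar Markov process ($\alpha>0$), absorbed at $0$, and let $\xi$ be the Lévy process associated to it via Lamperti's transformation, with lifetime $\zeta$. Assume that $X$ hits zero in a finite time a.s. For every $\gamma>0$ such that $\mathbb{E}(\exp\{\gamma\xi_{1}\},1<\zeta)<1$, there is a constant $c_{\gamma}\in(0,\infty)$ such that $$c_{\gamma}\int_{(0,\infty)}\frac{dx}{x^{1+\gamma}}\,\mathbb{E}_{x}\left(f(X_{s}), s<T_{0}\right)=s^{-\gamma/\alpha}\,\widehat{\mathbb{E}}^{(\gamma)}\left(f\left(\left(\frac{s}{I}\right)^{1/\alpha}\right)I^{\frac{\gamma}{\alpha}-1}\right),\qquad s>0,$$ for any measurable $f:(0,\infty)\to[0,\infty)$.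
   Context: A $1/\alpha$-positive self-similar Markov process ($1/\alpha$-pssMp), $\alpha>0$, is a $[0,\infty)$-valued càdlàg strong Markov process $X$ with laws $(\mathbb{P}_x)$ such that for every $c>0$ and $x\ge 0$ the law of $(cX_{tc^{-\alpha}},t\geq0)$ under $\mathbb{P}_x$ is $\mathbb{P}_{cx}$. The point $0$ is a cemetery state, and $T_0=\inf\{t>0:X_t=0\}$. ''$X$ hits zero in a finite time a.s.'' means $T_0<\infty$, $\mathbb{P}_x$-a.s. for $x>0$. Lamperti's transformation: a Lévy process $\xi$ with values in $\mathbb{R}\cup\{-\infty\}$ is a real Lévy process sent to the absorbing state $-\infty$ at an independent exponential time $\zeta$ of parameter $q\ge0$ ($q=0$ means $\zeta=\infty$ a.s.). Every $1/\alpha$-pssMp started from $x>0$ can be written $X_t=x\exp(\xi_{\tau(tx^{-\alpha})})$ if $\tau(tx^{-\alpha})<\zeta$, and $X_t=0$ otherwise, where $\tau(t)=\inf\{s>0:\int_0^s e^{\alpha\xi_u}du>t\}$ ($\inf\emptyset=\infty$) and $\xi$ is such a Lévy process, started from $0$ under the reference measure $\mathbb{P}$ (with expectation $\mathbb{E}$), whose law does not depend on $x$. This $\xi$ is the Lévy process associated to $X$. Exponential functional: $I:=\int_0^{\zeta}\exp(\alpha\xi_s)\,ds$, viewed as a functional of the canonical Lévy path. Change of measure: for $\theta\ge 0$ with $\mathbb{E}(e^{\theta\xi_1},1<\zeta)\le1$, $\mathbb{P}^{(\theta)}$ is the unique probability measure on path space with $\mathbb{P}^{(\theta)}(A\cap\{t<\zeta\})=\mathbb{E}(e^{\theta\xi_t}1_{A\cap\{t<\zeta\}})$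 for all $t\ge0$, $A\in\mathcal{F}_t$, where $(\mathcal{F}_t)$ is the natural filtration of $\xi$; under it $\xi$ is again a (possibly killed) Lévy process. $\widehat{\mathbb{P}}^{(\theta)}$, with expectation $\widehat{\mathbb{E}}^{(\theta)}$, is the law of the dual process $-\xi$ (with the same lifetime) under $\mathbb{P}^{(\theta)}$. Thus, under $\widehat{\mathbb{P}}^{(\theta)}$, $I$ has the law of $\int_0^\zeta e^{-\alpha\xi_s}ds$ under $\mathbb{P}^{(\theta)}$. *)

(* Defs.v *)
From HB Require Import structures.
From mathcomp Require Import all_boot all_order all_algebra.
From mathcomp Require Import all_classical all_reals all_analysis.
From mathcomp Require Import measurable_realfun.

Set Implicit Arguments.
Unset Strict Implicit.
Unset Printing Implicit Defensive.

Import Order.TTheory GRing.Theory Num.Theory.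
Import numFieldNormedType.Exports.

Local Open Scope classical_set_scope.
Local Open Scope ring_scope.

(* Time is indexed by R; only the values of paths and processes at nonnegative
   times are meaningful: every definition below looks at those only. *)

Section generated_sigma_algebras.
Context (R : realType) (d : measure_display) (S : measurableType d) (T : Type).

Definition cylinders (Y : R -> T -> S) (J : set R) : set_system T :=
  [set A | exists t B, [/\ J t, measurable B & A = Y t @^-1` B]].

(* sigma(Y_t, t in J) *)
Definition sigma_of (Y : R -> T -> S) (J : set R) : set_system T :=
  <<s cylinders Y J >>.

End generated_sigma_algebras.

Definition indep_sigma (R : realType) (d : measure_display)
    (T : measurableType d) (m : probability T R) (F G : set_system T) :=
  forall A B, F A -> G B -> (m (A `&` B) = m A * m B)%E.

Section affine_time_change.
Context (R : realType).

Lemma cvg_affine_right (k b s : R) : 0 < k ->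
  k * u + b @[u --> s^'+] --> (k * s + b)^'+.
Proof.
move=> k0 P [e /= e0 He]; exists (e / k); first by rewrite /= divr_gt0.
move=> u /= us su; apply: He => /=; last by rewrite ltrD2r ltr_pM2l.
rewrite opprD addrACA subrr addr0 -mulrBr normrM gtr0_norm//.
by rewrite mulrC -ltr_pdivlMr.
Qed.

Lemma cvg_affine_left (k b s : R) : 0 < k ->
  k * u + b @[u --> s^'-] --> (k * s + b)^'-.
Proof.
move=> k0 P [e /= e0 He]; exists (e / k); first by rewrite /= divr_gt0.
move=> u /= us su; apply: He => /=; last by rewrite ltrD2r ltr_pM2l.
rewrite opprD addrACA subrr addr0 -mulrBr normrM gtr0_norm//.
by rewrite mulrC -ltr_pdivlMr.
Qed.

End affine_time_change.

Definition cadlag (R : realType) (f : R -> R) :=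
  (forall t : R, 0 <= t -> f u @[u --> t^'+] --> f t) /\
  (forall t : R, 0 < t -> exists l : R, f u @[u --> t^'-] --> l).

Section positive_paths.
Context (R : realType).

Definition is_xpath (f : R -> R) := [/\ cadlag f,
  forall t : R, 0 <= t -> 0 <= f t &
  forall s t : R, 0 <= s <= t -> f s = 0 -> f t = 0].

Record xpath := XPath { xpath_fun :> R -> R ; xpathP : is_xpath xpath_fun }.

Lemma is_xpath0 : is_xpath (fun=> 0).
Proof.
split=> //; split=> t _; first exact: cvg_cst.
by exists 0; exact: cvg_cst.
Qed.

HB.instance Definition _ := gen_eqMixin xpath.
HB.instance Definition _ := gen_choiceMixin xpath.
HB.instance Definition _ := isPointed.Build xpath (XPath is_xpath0).

Definition xcoord (t : R) (w : xpath) : R := w t.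

HB.instance Definition _ := @isMeasurable.Build
  (sigma_display (cylinders xcoord `[0, +oo[)) xpath
  (sigma_of xcoord `[0, +oo[)
  (@sigma_algebra0 _ setT _) (@sigma_algebraC _ _)
  (@sigma_algebra_bigcup _ setT _).

Lemma is_xpath_affine (w : xpath) (c k b : R) : 0 <= c -> 0 < k -> 0 <= b ->
  is_xpath (fun u => c * w (k * u + b)).
Proof.
case: w => f /= [[fr fl] f0 fa] c0 k0 b0.
have kb t : 0 <= t -> 0 <= k * t + b.
  by move=> t0; rewrite addr_ge0// mulr_ge0// ltW.
split; first split.
- move=> t t0; apply: (cvgM (cvg_cst _)).
  exact: (cvg_comp _ _ (cvg_affine_right (b := b) (s := t) k0) (fr _ (kb _ t0))).
- move=> t t0; have [|l fl'] := fl (k * t + b).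
    by rewrite ltr_wpDr// mulr_gt0.
  exists (c * l); apply: (cvgM (cvg_cst _)).
  exact: (cvg_comp _ _ (cvg_affine_left (b := b) (s := t) k0) fl').
- by move=> t t0; rewrite mulr_ge0// f0// kb.
- move=> s t /andP[s0 st] /eqP; rewrite mulf_eq0 => /orP[/eqP->|/eqP fs0].
    by rewrite mul0r.
  by rewrite (fa _ _ _ fs0) ?mulr0// kb//= lerD2r ler_pM2l.
Qed.

Lemma is_xpath_shift (a : {nonneg R}) (w : xpath) :
  is_xpath (fun u => w (a%:num + u)).
Proof.
have -> : (fun u => w (a%:num + u)) = (fun u => 1 * w (1 * u + a%:num)).
  by apply/funext => u; rewrite !mul1r addrC.
exact: is_xpath_affine.
Qed.

Definition xshift (a : {nonneg R}) (w : xpath) := XPath (is_xpath_shift a w).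

Lemma is_xpath_scale (alpha : R) (c : {posnum R}) (w : xpath) :
  is_xpath (fun t => c%:num * w (t * c%:num `^ (- alpha))).
Proof.
have -> : (fun t => c%:num * w (t * c%:num `^ (- alpha))) =
          (fun t => c%:num * w (c%:num `^ (- alpha) * t + 0)).
  by apply/funext => t; rewrite addr0 (mulrC t).
by apply: is_xpath_affine => //; rewrite powR_gt0.
Qed.

Definition xscale (alpha : R) (c : {posnum R}) (w : xpath) :=
  XPath (is_xpath_scale alpha c w).

Definition hitting_zero (w : xpath) : \bar R :=
  ereal_inf [set t%:E | t in [set t : R | 0 < t /\ w t = 0]].

End positive_paths.

Section pssMp.
Context (R : realType).
Local Open Scope ereal_scope.

Definition stopping_time (tau : xpath R -> \bar R) :=
  (forall w, 0 <= tau w) /\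
  (forall t : R, (0 <= t)%R ->
    sigma_of (@xcoord R) `[0%R, t] [set w | tau w <= t%:E]).

Definition sigma_stopped (tau : xpath R -> \bar R) : set_system (xpath R) :=
  [set A | measurable A /\ forall t : R, (0 <= t)%R ->
    sigma_of (@xcoord R) `[0%R, t] (A `&` [set w | tau w <= t%:E])].

Definition strong_markov (PX : R -> probability (xpath R) R) :=
  forall (x : R) (tau : xpath R -> \bar R) (A B : set (xpath R)),
    (0 <= x)%R -> stopping_time tau -> sigma_stopped tau A -> measurable B ->
  PX x (A `&` [set w | exists2 a : {nonneg R},
                         tau w = a%:num%:E & B (xshift a w)]) =
  \int[PX x]_(w in A `&` [set w | tau w < +oo]) PX (w (fine (tau w))) B.

(* PX x is the law of the process started from x; the laws PX x for x < 0
   play no role. Nonnegativity, the cadlag property and absorption at 0 are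
   built into the path space. *)
Definition pssMp (alpha : R) (PX : R -> probability (xpath R) R) := [/\
  forall A : set (xpath R), measurable A ->
    measurable_fun (`[0%R, +oo[ : set R) (fun x => PX x A),
  forall x : R, (0 <= x)%R -> PX x [set w : xpath R | w 0%R = x] = 1,
  strong_markov PX &
  forall (c : {posnum R}) (x : R) (A : set (xpath R)),
    (0 <= x)%R -> measurable A ->
    PX x (xscale alpha c @^-1` A) = PX (c%:num * x)%R A].

End pssMp.

Section killed_paths.
Context (R : realType).

(* Cadlag paths in R U {-oo}, -oo being an isolated absorbing state: in
   particular the left limit at the lifetime is real. *)
Definition is_lpath (f : R -> \bar R) := [/\
  forall t : R, 0 <= t -> f t != +oo%E,
  forall s t : R, 0 <= s <= t -> f s = -oo%E -> f t = -oo%E,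
  forall t : R, 0 <= t -> f t \is a fin_num -> f u @[u --> t^'+] --> f t &
  forall t : R, 0 < t -> (forall u : R, 0 <= u < t -> f u \is a fin_num) ->
    exists l : R, f u @[u --> t^'-] --> l%:E].

Record lpath := LPath {
  lpath_fun :> R -> \bar R ; lpathP : is_lpath lpath_fun }.

Lemma is_lpath0 : is_lpath (fun=> 0%E).
Proof.
split=> // [t _ _|t _ _]; first exact: cvg_cst.
by exists 0; exact: cvg_cst.
Qed.

HB.instance Definition _ := gen_eqMixin lpath.
HB.instance Definition _ := gen_choiceMixin lpath.
HB.instance Definition _ := isPointed.Build lpath (LPath is_lpath0).

Definition lcoord (t : R) (w : lpath) : \bar R := w t.

HB.instance Definition _ := @isMeasurable.Build
  (sigma_display (cylinders lcoord `[0, +oo[)) lpath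
  (sigma_of lcoord `[0, +oo[)
  (@sigma_algebra0 _ setT _) (@sigma_algebraC _ _)
  (@sigma_algebra_bigcup _ setT _).

Definition lifetime (w : lpath) : \bar R :=
  ereal_inf [set t%:E | t in [set t : R | 0 <= t /\ w t = -oo%E]].

(* y |-> - y on R, fixing the cemetery state -oo *)
Definition oppk (y : \bar R) : \bar R := if y is r%:E then (- r)%:E else -oo%E.

Lemma oppkE y : y \is a fin_num -> oppk y = (- y)%E.
Proof. by case: y. Qed.

Lemma cvg_oppk (F : set_system R) {FF : Filter F} (f : R -> \bar R) (l : R) :
  f u @[u --> F] --> l%:E -> oppk (f u) @[u --> F] --> (- l)%:E.
Proof.
move=> fl; have /fine_cvgP[ffin _] := fl.
rewrite EFinN; apply: cvg_trans (cvgeN fl); apply: near_eq_cvg.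
by near=> u; rewrite oppkE//; near: u.
Unshelve. all: by end_near. Qed.

Lemma is_lpath_opp (w : lpath) : is_lpath (fun t => oppk (w t)).
Proof.
case: w => f /= [fy fa fr fl].
have fin t : oppk (f t) \is a fin_num -> f t \is a fin_num by case: (f t).
split.
- by move=> t t0; case: (f t).
- move=> s t /[dup] st /andP[s0 _]; move: (fy _ s0) (fa s t st).
  by case: (f s) => // _ /(_ erefl) ->.
- move=> t t0 /fin ftfin; have := fr _ t0 ftfin.
  by rewrite -(fineK ftfin); exact: cvg_oppk.
- move=> t t0 ft; have [|l fl'] := fl t t0; first by move=> u /ft /fin.
  by exists (- l); exact: cvg_oppk.
Qed.

Definition lpath_opp (w : lpath) : lpath := LPath (is_lpath_opp w).

Lemma measurable_oppk : measurable_fun [set: \bar R] oppk.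
Proof.
have -> : oppk = (fun y => if y == +oo%E then -oo%E else if y == -oo%E then -oo%E else (- y)%E).
  by apply/funext; case.
apply: measurable_fun_ifT => //.
  apply: (measurable_fun_bool true).
  by rewrite setTI (_ : _ @^-1` _ = [set +oo%E])//; apply/seteqP; split => y /= /eqP.
apply: measurable_fun_ifT => //.
  apply: (measurable_fun_bool true).
  by rewrite setTI (_ : _ @^-1` _ = [set -oo%E])//; apply/seteqP; split => y /= /eqP.
Qed.

Lemma measurable_lpath_opp : measurable_fun [set: lpath] lpath_opp.
Proof.
apply: (@measurability _ _ _ _ _ _ (cylinders lcoord `[0, +oo[)) => //.
move=> _ [_ [t [B [t0 mB ->]]] <-]; rewrite setTI; apply: sub_sigma_algebra.
exists t, (oppk @^-1` B); split => //.
by rewrite -[X in measurable X]setTI; exact: measurable_oppk.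
Qed.

HB.instance Definition _ :=
  isMeasurableFun.Build _ _ lpath lpath lpath_opp measurable_lpath_opp.

Definition dual_law (Q : probability lpath R) : probability lpath R :=
  distribution Q lpath_opp.

End killed_paths.

Section levy_processes.
Context (R : realType).

Definition real_levy (d : measure_display) (Omega : measurableType d)
    (m : probability Omega R) (eta : R -> Omega -> R) := [/\
  forall t : R, 0 <= t -> measurable_fun setT (eta t),
  forall w, cadlag (eta ^~ w),
  {ae m, forall w, eta 0 w = 0},
  forall s t : R, 0 <= s -> 0 <= t ->
    indep_sigma m (sigma_of eta `[0, s])
      [set (fun w => eta (s + t) w - eta s w) @^-1` B
         | B in (measurable : set (set R))] &
  forall (s t : R) (B : set R), 0 <= s -> 0 <= t -> measurable B ->
    m ((fun w => eta (s + t) w - eta s w) @^-1` B) = m (eta t @^-1` B)].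

(* For q = 0 this says that e = +oo almost surely. *)
Definition exponential_time (d : measure_display) (Omega : measurableType d)
    (m : probability Omega R) (q : R) (e : Omega -> \bar R) :=
  measurable_fun setT e /\
  forall t : R, 0 <= t -> m [set w | (t%:E < e w)%E] = (expR (- (q * t)))%:E.

Definition killed_levy (P : probability (lpath R) R) :=
  exists (d : measure_display) (Omega : measurableType d)
    (m : probability Omega R) (eta : R -> Omega -> R) (q : R)
    (e : Omega -> \bar R) (Xi : {mfun Omega >-> lpath R}),
  [/\ real_levy m eta,
      0 <= q /\ exponential_time m q e,
      indep_sigma m (sigma_of eta `[0, +oo[)
        [set e @^-1` B | B in (measurable : set (set \bar R))],
      forall (w : Omega) (t : R), 0 <= t ->
        Xi w t = if (t%:E < e w)%E then (eta t w)%:E else -oo%E &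
      forall A, measurable A -> P A = distribution m Xi A].

End levy_processes.

Section lamperti.
Context (R : realType).
Local Open Scope ereal_scope.

(* expeR -oo = 0, so that the integrand vanishes after the lifetime *)
Definition additive_functional (alpha : R) (w : lpath R) (s : R) : \bar R :=
  \int[lebesgue_measure]_(u in `[0%R, s]) expeR (alpha%:E * w u).

Definition time_change (alpha : R) (w : lpath R) (t : R) : \bar R :=
  ereal_inf [set s%:E | s in
    [set s : R | (0 < s)%R /\ t%:E < additive_functional alpha w s]].

Definition lamperti (alpha x : R) (w : lpath R) (t : R) : R :=
  let tau := time_change alpha w (t * x `^ (- alpha)) in
  if tau < lifetime w then (x * expR (fine (w (fine tau))))%R else 0%R.

Definition exp_functional (alpha : R) (w : lpath R) : \bar R :=
  \int[lebesgue_measure]_(s in [set s : R | (0 <= s)%R /\ s%:E < lifetime w])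
    expeR (alpha%:E * w s).

(* P is the law of the Levy process associated to the process with laws PX:
   under each PX x, the coordinate process is the Lamperti transform of a
   process with law P. *)
Definition lamperti_associated (alpha : R) (PX : R -> probability (xpath R) R)
    (P : probability (lpath R) R) :=
  killed_levy P /\
  forall x : R, (0 < x)%R -> exists Xi : {mfun xpath R >-> lpath R},
    (forall A, measurable A -> P A = distribution (PX x) Xi A) /\
    {ae PX x, forall w : xpath R, forall t : R, (0 <= t)%R ->
      w t = lamperti alpha x (Xi w) t}.

(* E(exp(theta xi_t), A, t < zeta) *)
Definition exp_moment (P : probability (lpath R) R) (theta t : R)
    (A : set (lpath R)) : \bar R :=
  \int[P]_(w in A `&` [set w | t%:E < lifetime w]) expeR (theta%:E * w t).

(* Q is P^(theta): the events A `&` {t < zeta} form a generating pi-system, so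
   the identity determines Q. It is meant for 0 <= theta and
   exp_moment P theta 1 setT <= 1. *)
Definition exp_tilt (P : probability (lpath R) R) (theta : R)
    (Q : probability (lpath R) R) :=
  forall (t : R) (A : set (lpath R)), (0 <= t)%R ->
    sigma_of (@lcoord R) `[0%R, t] A ->
  Q (A `&` [set w | t%:E < lifetime w]) = exp_moment P theta t A.

End lamperti.

(* Main.v *)
(* Under P_x, substitute u = s x^(-alpha) in the Lamperti representation and
   then u = A_t, where A_t is the integral of e^(alpha xi) over [0, t]: the left
   side becomes, up to the factor s^(-gamma/alpha) / alpha, the integral over
   t > 0 of E(e^(gamma xi_t) h(e^(-alpha xi_t) A_t), t < zeta), that is of
   E^(gamma)(h(e^(-alpha xi_t) A_t), t < zeta), with
   h(y) = y^(gamma/alpha - 1) f((s/y)^(1/alpha)).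
   Reversing xi at time t turns e^(-alpha xi_t) A_t, on {t < zeta}, into the
   integral of e^(-alpha xi) over [0, t]. Since P^(gamma)(1 < zeta) < 1, zeta is
   exponential under P^(gamma) and independent of the unkilled path, so its
   potential measure dt P^(gamma)(. , t < zeta) is a constant multiple of the law
   of the path at the killing time, and the last integral is that multiple of
   E^(gamma)(h(I')), I' being the integral of e^(-alpha xi) over [0, zeta]. *)

Require Import Defs.
From HB Require Import structures.
From mathcomp Require Import all_boot all_order all_algebra.
From mathcomp Require Import all_classical all_reals all_analysis.
From mathcomp Require Import measurable_realfun ring lra.
Set Implicit Arguments.
Unset Strict Implicit.
Unset Printing Implicit Defensive.
Import Order.TTheory GRing.Theory Num.Theory.
Import numFieldNormedType.Exports.
Local Open Scope classical_set_scope.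
Local Open Scope ring_scope.
Local Open Scope ereal_scope.

(** Two steps of the outline need more than they seem to. Under the tilted law only the Markov form
    of independent increments on survival is at hand, not a splitting into an unkilled process and
    an exponential time. Reversal is therefore proved for the one functional that is needed. Sampled
    with mesh delta, the two functionals are second coordinates of chains driven by the same
    increments, and their transition operators commute; right continuity and dominated convergence
    give the limit delta -> 0. The law at the killing time comes from a limit as well. The event of
    being alive at t with a large functional and dead at t + e has probability (1 - Q(e < zeta))
    times that of the first condition. Integrated over t and divided by e, it tends to the tail of
    the exponential functional, and comparison with the trivial tail, of probability 1, identifies
    the constant as the mean lifetime. Hence c = alpha / E^(gamma)(zeta). Identities between
    integrals are checked on tails or rectangles and extended by uniqueness of measures, which is
    why finiteness of tails is a recurring obligation. *)

(** * Weighted measures and their uniqueness on a pi-system *)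

Section density_measure.
Context d (T : measurableType d) (R : realType).
Variables (mu : {measure set T -> \bar R}) (g : T -> R).
Hypotheses (mg : measurable_fun setT g) (g0 : forall x, (0 <= g x)%R).

Let mEg : measurable_fun setT (EFin \o g). Proof. exact/measurable_EFinP. Qed.

Let EFin_g_ge0 x : 0 <= (g x)%:E. Proof. by rewrite lee_fin. Qed.

(* mg and g0 are kept as arguments for the measure instance to be inferred. *)
Definition density (A : set T) : \bar R := let _ := (mg, g0) in
  \int[mu]_(x in A) (g x)%:E.

Let density0 : density set0 = 0.
Proof. exact: integral_set0. Qed.

Let density_ge0 A : 0 <= density A.
Proof. by apply: integral_ge0 => x _; rewrite lee_fin. Qed.

Let density_sigma_additive : semi_sigma_additive density.
Proof.
move=> F mF tF mUF; rewrite /density ge0_integral_bigcup//; last first.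
  exact: measurable_funS mEg.
apply: is_cvg_ereal_nneg_natsum_cond => n _ _; by apply: integral_ge0 => x _; rewrite lee_fin.
Qed.

HB.instance Definition _ := isMeasure.Build _ _ _ density
  density0 density_ge0 density_sigma_additive.

Import HBNNSimple.

(** Monotone approximation by simple functions reduces the claim to indicators, where it is the
    definition of [density]. *)
Lemma ge0_integral_density (f : T -> \bar R) :
  measurable_fun setT f -> (forall x, 0 <= f x) ->
  \int[density]_x f x = \int[mu]_x ((g x)%:E * f x).
Proof.
move=> mf f0; pose f_ := nnsfun_approx measurableT mf.
transitivity (limn (fun n => \int[density]_x (f_ n x)%:E)).
  rewrite -monotone_convergence//=.
  - apply: eq_integral => y _; apply/esym/cvg_lim => //.
    by apply: cvg_nnsfun_approx.
  - by move=> n; exact/measurable_EFinP/measurable_funP.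
  - by move=> n y _; rewrite lee_fin.
  - by move=> y _ m n mn; rewrite lee_fin; exact/lefP/nd_nnsfun_approx.
transitivity (limn (fun n => \int[mu]_x ((g x)%:E * (f_ n x)%:E))); last first.
  rewrite -monotone_convergence//=.
  - apply: eq_integral => y _; apply/cvg_lim => //.
    by apply: cvgeZl => //; apply: cvg_nnsfun_approx.
  - move=> n; apply: emeasurable_funM => //.
    exact/measurable_EFinP/measurable_funP.
  - by move=> n y _; rewrite mule_ge0// lee_fin.
  - move=> y _ m n mn; rewrite lee_wpmul2l// lee_fin.
    exact/lefP/nd_nnsfun_approx.
congr (limn _); apply/funext => n.
under [LHS]eq_integral do rewrite fimfunE -fsumEFin//.
rewrite ge0_integral_fsum//; last 2 first.
- by move=> r; exact/measurable_EFinP/measurableT_comp.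
- by move=> r x _; rewrite nnfun_muleindic_ge0.
rewrite [RHS](eq_integral (fun x => \sum_(r \in range (f_ n))
    ((g x)%:E * (r * \1_(f_ n @^-1` [set r]) x)%:E)))//; last first.
  move=> x _; rewrite fimfunE -fsumEFin// ge0_mule_fsumr// => r.
  by rewrite nnfun_muleindic_ge0.
rewrite ge0_integral_fsum//; last 2 first.
- move=> r; apply: emeasurable_funM => //.
  exact/measurable_EFinP/measurableT_comp.
- by move=> r x _; rewrite mule_ge0// nnfun_muleindic_ge0.
apply: eq_fsbigr => r _.
rewrite integralZl_indic_nnsfun// integral_indic//= setIT.
(* The approximants are nonnegative, so a negative value has empty preimage and both sides
   vanish. *)
have [r0|r0] := ltP r 0%R.
  rewrite preimage_nnfun0// /density integral_set0 mule0.
  by under eq_integral do rewrite indic0 mulr0 mule0; rewrite integral0.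
under eq_integral do rewrite EFinM muleCA.
rewrite ge0_integralZl//; first last.
- by move=> x _; rewrite mule_ge0// lee_fin.
- by apply: emeasurable_funM => //; exact/measurable_EFinP.
congr (_ * _); rewrite /density integral_mkcond.
by apply: eq_integral => x _; rewrite epatch_indic.
Qed.

End density_measure.

Section integral_unique.
Context d1 d2 d (T1 : measurableType d1) (T2 : measurableType d2)
  (S : measurableType d) (R : realType).
Variables (mu1 : {measure set T1 -> \bar R}) (mu2 : {measure set T2 -> \bar R}).
Variables (g1 : T1 -> R) (g2 : T2 -> R) (X1 : T1 -> S) (X2 : T2 -> S).
Hypotheses (mg1 : measurable_fun setT g1) (g10 : forall x, (0 <= g1 x)%R).
Hypotheses (mg2 : measurable_fun setT g2) (g20 : forall x, (0 <= g2 x)%R).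
Hypotheses (mX1 : measurable_fun setT X1) (mX2 : measurable_fun setT X2).

(** The images of [g1 mu1] under [X1] and of [g2 mu2] under [X2] agree on a pi-system that contains
    a countable cover by sets of finite mass, hence they agree everywhere. The weights allow
    substitutions, tilts and restrictions to survival to be treated as instances of one
    statement. *)
Lemma integral_unique (G : set_system S) (F : (set S)^nat) :
  measurable = <<s G >> -> setI_closed G -> (forall n, G (F n)) ->
  \bigcup_n F n = setT ->
  (forall n, \int[mu1]_(x in X1 @^-1` F n) (g1 x)%:E < +oo) ->
  (forall A, G A -> \int[mu1]_(x in X1 @^-1` A) (g1 x)%:E =
                    \int[mu2]_(x in X2 @^-1` A) (g2 x)%:E) ->
  forall h : S -> \bar R, measurable_fun setT h -> (forall y, 0 <= h y) ->
  \int[mu1]_x ((g1 x)%:E * h (X1 x)) = \int[mu2]_x ((g2 x)%:E * h (X2 x)).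
Proof.
move=> mG GI GF Fcover Ffin eqG h mh h0.
have mh1 : measurable_fun setT (h \o X1) by exact: (measurableT_comp mh mX1).
have mh2 : measurable_fun setT (h \o X2) by exact: (measurableT_comp mh mX2).
rewrite -(ge0_integral_density mu1 mg1 g10 mh1); last by move=> x; exact: h0.
rewrite -(ge0_integral_density mu2 mg2 g20 mh2); last by move=> x; exact: h0.
have P1 := ge0_integral_pushforward mX1 (density mu1 mg1 g10) measurableT mh.
have P2 := ge0_integral_pushforward mX2 (density mu2 mg2 g20) measurableT mh.
rewrite !preimage_setT in P1 P2.
rewrite -P1// -P2//; apply: eq_measure_integral => A mA _.
exact: (measure_unique G F).
Qed.

End integral_unique.

Lemma integral_gt_unique d1 d2 (T1 : measurableType d1) (T2 : measurableType d2)
  (R : realType) (mu1 : {measure set T1 -> \bar R})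
  (mu2 : {measure set T2 -> \bar R}) (g1 : T1 -> R) (g2 : T2 -> R)
  (X1 : T1 -> R) (X2 : T2 -> R) :
  measurable_fun setT g1 -> (forall x, (0 <= g1 x)%R) ->
  measurable_fun setT g2 -> (forall x, (0 <= g2 x)%R) ->
  measurable_fun setT X1 -> measurable_fun setT X2 ->
  (forall a, \int[mu1]_(x in [set x | (a < X1 x)%R]) (g1 x)%:E < +oo) ->
  (forall a, \int[mu1]_(x in [set x | (a < X1 x)%R]) (g1 x)%:E =
             \int[mu2]_(x in [set x | (a < X2 x)%R]) (g2 x)%:E) ->
  forall h : R -> \bar R, measurable_fun setT h -> (forall y, 0 <= h y) ->
  \int[mu1]_x ((g1 x)%:E * h (X1 x)) = \int[mu2]_x ((g2 x)%:E * h (X2 x)).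
Proof.
move=> mg1 g10 mg2 g20 mX1 mX2 fin eq12.
have E U (X : U -> R) x : X @^-1` `]x, +oo[ = [set z | (x < X z)%R].
  by apply/seteqP; split => z /=; rewrite in_itv/= andbT.
apply: (integral_unique mg1 g10 mg2 g20 mX1 mX2 (G := @RGenOInfty.G R)
  (F := fun n => `]-n%:R, +oo[%classic)%R) => //.
- exact: RGenOInfty.measurableE.
- move=> _ _ [x ->] [y ->]; exists (Num.max x y).
  by apply/seteqP; split => z /=; rewrite !in_itv/= !andbT gt_max;
    [case=> -> ->|move=> /andP[-> ->]].
- by move=> i; eexists.
- rewrite -subTset => x _; exists (Num.truncn `|x|).+1 => //=.
  rewrite in_itv/= andbT ltrNl; apply: le_lt_trans (truncnS_gt _).
  by rewrite -normrN ler_norm.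
- by move=> k; rewrite E.
- by move=> _ [x ->]; rewrite !E.
Qed.

(** * Killed paths *)

Section lpath_facts.
Context (R : realType).
Implicit Types (w : lpath R) (t u s a : R).

(** The definition of a path asks for right continuity at real values only; at -oo it follows from
    absorption. *)
Lemma lpath_right w t : (0 <= t)%R -> w u @[u --> t^'+] --> w t.
Proof.
case: w => f [/= fy fa fr fl] t0.
have [ft|] := boolP (f t \is a fin_num); first exact: fr.
rewrite fin_numE negb_and !negbK => /orP[|]/eqP ft; last first.
  by have := fy _ t0; rewrite ft.
rewrite ft; apply: (@cvg_trans _ ((cst -oo : R -> \bar R) u @[u --> t^'+])).
  apply: near_eq_cvg; near=> u; rewrite /= (fa t u)//.
  by apply/andP; split => //; apply: ltW; near: u; exact: nbhs_right_gt.
exact: cvg_cst.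
Unshelve. all: by end_near. Qed.

Lemma lpath_dead w t : (0 <= t)%R -> w t \isn't a fin_num -> w t = -oo.
Proof.
case: w => f [/= fy fa fr fl] t0; move: (fy t t0).
by case: (f t).
Qed.

Lemma lpath_fin_le w s t :
  (0 <= s <= t)%R -> w t \is a fin_num -> w s \is a fin_num.
Proof.
move=> st wt; apply/negPn/negP => ws; have s0 : (0 <= s)%R by case/andP: st.
by have := lpathP w => -[_ /(_ s t st (lpath_dead s0 ws))]; move: wt => /[swap] ->.
Qed.

(** A path that is real at [t] stays real on some [t, t + e[, by right continuity and because -oo is
    isolated; the infimum defining the lifetime is then strictly beyond [t]. *)
Lemma lifetime_gt w t : (0 <= t)%R -> (t%:E < lifetime w) = (w t \is a fin_num).
Proof.
move=> t0; apply/idP/idP => [tl|wt].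
  apply/negPn/negP => wt; move: tl; rewrite ltNge => /negP; apply.
  by apply: ereal_inf_lbound; exists t => //; split=> //; exact: lpath_dead.
have := lpath_right (w := w) t0; rewrite -(fineK wt) => /fine_cvgP[wfin _].
have [e /= e0 He] := wfin.
apply: (@lt_le_trans _ _ (t + e / 2)%:E).
  by rewrite lte_fin ltrDl divr_gt0.
apply: le_ereal_inf_tmp => _ [s [s0 ws] <-]; rewrite lee_fin leNgt; apply/negP => se.
have : w s \is a fin_num.
  have [st|ts] := leP s t; first by apply: lpath_fin_le wt; rewrite s0.
  apply: He => //=; rewrite ltr0_norm ?subr_lt0// opprB ltrBlDl.
  by rewrite (lt_trans se)// ltrD2l ltr_pdivrMr// ltr_pMr// ltr1n.
by rewrite ws.
Qed.

(** The first point of the grid of mesh 1/(n + 1) strictly after [t], even when [t] is itself on the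
    grid: right continuity then gives convergence along these points. *)
Definition grid_above (n : nat) t : R :=
  ((Num.truncn (t * n.+1%:R)).+1%:R / n.+1%:R)%R.

Lemma grid_above_gt n t : (t < grid_above n t)%R.
Proof. by rewrite ltr_pdivlMr// truncnS_gt. Qed.

Lemma grid_above_le n t : (0 <= t)%R -> (grid_above n t <= t + n.+1%:R^-1)%R.
Proof.
move=> t0; rewrite ler_pdivrMr// mulrDl mulVf//.
by rewrite -natr1 lerD2r truncn_le mulr_ge0.
Qed.

Lemma grid_above_cvg t : (0 <= t)%R -> grid_above n t @[n --> \oo] --> t.
Proof.
move=> t0; apply: (@squeeze_cvgr _ _ _ _ (cst t) (fun n => t + n.+1%:R^-1)%R).
- near=> n; rewrite (ltW (grid_above_gt _ _))/= grid_above_le//.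
- exact: cvg_cst.
- rewrite -[X in _ --> X]addr0; apply: cvgD; first exact: cvg_cst.
  exact: cvg_harmonic.
Unshelve. all: by end_near. Qed.

Lemma lpath_grid_above_cvg w t : (0 <= t)%R ->
  w (grid_above n t) @[n --> \oo] --> w t.
Proof.
move=> t0; apply: cvg_comp (lpath_right t0) => P [e /= e0 He].
have /cvgrPdist_lt/(_ _ e0) := grid_above_cvg t0.
by apply: filterS => n tn; apply: He => //=; exact: grid_above_gt.
Qed.

Lemma measurable_lcoord t : (0 <= t)%R -> measurable_fun setT (@lcoord R t).
Proof.
move=> t0 _ B mB; rewrite setTI; apply: sub_sigma_algebra.
by exists t, B; split => //=; rewrite in_itv/= andbT.
Qed.

(** On each strip [E k] the path read at [grid_above] is a single coordinate, and it converges to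
    the path as the mesh tends to 0. Time is clipped at 0 because only coordinates at nonnegative
    times generate the sigma-algebra. *)
Lemma measurable_eval :
  measurable_fun setT (fun p : R * lpath R => p.2 (Num.max p.1 0%R)).
Proof.
have max0 t : (0 <= Num.max t 0)%R by rewrite le_max lexx orbT.
apply: (emeasurable_fun_cvg
  (fun n (p : R * lpath R) => p.2 (grid_above n (Num.max p.1 0%R)))).
  move=> n.
  pose E k := [set t : R | Num.truncn (Num.max t 0 * n.+1%:R)%R = k] `*` [set: lpath R].
  have mE k : measurable (E k).
    apply: measurableX => //.
    have -> : [set t : R | Num.truncn (Num.max t 0 * n.+1%:R)%R = k] =
        (fun t => Num.max t 0 * n.+1%:R)%R @^-1` `[k%:R, k.+1%:R[.
      apply/seteqP; split => t /=; rewrite in_itv/= -truncn_eq ?mulr_ge0//.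
        by move/eqP.
      by move/eqP.
    rewrite -[X in measurable X]setTI.
    have : measurable_fun setT (fun t : R => Num.max t 0 * n.+1%:R)%R.
      by apply: measurable_funM => //; exact: measurable_maxr.
    by apply => //; exact: measurable_itv.
  have -> : [set: R * lpath R] = \bigcup_k E k.
    by apply/seteqP; split => // -[t w] _; exists (Num.truncn (Num.max t 0 * n.+1%:R)%R).
  apply/measurable_fun_bigcup => // k.
  apply: (eq_measurable_fun (fun p : R * lpath R => lcoord (k.+1%:R / n.+1%:R)%R p.2)).
    by move=> [t w]; rewrite inE /E /grid_above => -[/= -> _].
  apply: measurable_funTS.
  apply: measurableT_comp => //.
  by apply: measurable_lcoord; rewrite divr_ge0.
by move=> -[t w] _ /=; exact: lpath_grid_above_cvg.
Qed.

(** The cemetery is sent to 0 whatever the sign of [a], whereas [expeR (a%:E * y)] would be +oo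
    there for negative [a]. The value at +oo is a default, never met by a path at nonnegative
    times. *)
Definition kexp a (y : \bar R) : R := if y is r%:E then expR (a * r) else 0%R.

Lemma kexp_ge0 a y : (0 <= kexp a y)%R.
Proof. by case: y => //= r; exact: expR_ge0. Qed.

Lemma kexp_gt0 a y : y \is a fin_num -> (0 < kexp a y)%R.
Proof. by case: y => //= r; rewrite expR_gt0. Qed.

Lemma kexpE a y : y \is a fin_num -> kexp a y = expR (a * fine y).
Proof. by case: y. Qed.

Lemma measurable_kexp a : measurable_fun setT (kexp a).
Proof.
have -> : kexp a = (fun y : \bar R =>
    if y == +oo%E then 0 else if y == -oo%E then 0 else expR (a * fine y))%R.
  by apply/funext; case.
have m1 (c : \bar R) : measurable_fun setT (fun y => y == c).
  apply: (measurable_fun_bool true).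
  by rewrite setTI (_ : _ @^-1` _ = [set c])//; apply/seteqP; split => y /= /eqP.
apply: measurable_fun_ifT => //; apply: measurable_fun_ifT => //.
apply: measurableT_comp => //; apply: measurable_funM => //.
Qed.

Definition pexp a w t : R := kexp a (w (Num.max t 0%R)).

Lemma pexp_ge0 a w t : (0 <= pexp a w t)%R.
Proof. exact: kexp_ge0. Qed.

Lemma pexpE a w t : (0 <= t)%R -> pexp a w t = kexp a (w t).
Proof. by move=> t0; rewrite /pexp max_l. Qed.

Lemma measurable_pexp a :
  measurable_fun setT (fun p : R * lpath R => pexp a p.2 p.1).
Proof. exact: measurableT_comp (measurable_kexp a) measurable_eval. Qed.

Lemma measurable_pexp1 a w : measurable_fun setT (pexp a w).
Proof.
exact: (measurable_fun_pair1 w (measurable_pexp a)).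
Qed.

Lemma kexp_cvg (F : set_system R) {FF : Filter F} a (f : R -> \bar R) (l : R) :
  f u @[u --> F] --> l%:E -> kexp a (f u) @[u --> F] --> expR (a * l).
Proof.
move=> /fine_cvgP[ffin fl].
apply: (@cvg_trans _ (expR (a * fine (f u))%R @[u --> F])).
  apply: near_eq_cvg; near=> u; rewrite kexpE//; near: u; exact: ffin.
apply: cvg_comp; last exact: continuous_expR.
by apply: cvgM; [exact: cvg_cst|exact: fl].
Unshelve. all: by end_near. Qed.

Lemma pexp_right a w t : (0 <= t)%R -> pexp a w u @[u --> t^'+] --> pexp a w t.
Proof.
move=> t0; rewrite pexpE//.
apply: (@cvg_trans _ (kexp a (w u) @[u --> t^'+])).
  apply: near_eq_cvg; near=> u; rewrite pexpE//.
  by rewrite (le_trans t0)// ltW//; near: u; exact: nbhs_right_gt.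
have [wt|/(lpath_dead t0) wt] := boolP (w t \is a fin_num).
  rewrite kexpE//; apply: kexp_cvg; rewrite fineK//; exact: lpath_right.
rewrite wt /=; apply: (@cvg_trans _ ((cst 0%R : R -> R) u @[u --> t^'+])); last exact: cvg_cst.
apply: near_eq_cvg; near=> u.
have tu : (t < u)%R by near: u; exact: nbhs_right_gt.
suff -> : w u = -oo by [].
apply: lpath_dead; first by rewrite (le_trans t0)// ltW.
apply: contraT => /negPn /(@lpath_fin_le w t u) ; rewrite t0 ltW// => /(_ isT).
by rewrite wt.
Unshelve. all: by end_near. Qed.

Lemma pexp_left a w t : (0 < t)%R ->
  exists l : R, pexp a w u @[u --> t^'-] --> l.
Proof.
move=> t0.
have [wf|] := pselect (forall u : R, (0 <= u < t)%R -> w u \is a fin_num).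
  have [_ _ _ /(_ t t0 wf)[l wl]] := lpathP w.
  exists (expR (a * l)).
  apply: (@cvg_trans _ (kexp a (w u) @[u --> t^'-])); last exact: kexp_cvg.
  apply: near_eq_cvg; near=> u; rewrite pexpE//.
  near: u; exact: nbhs_left_ge.
move=> /existsNP[s /not_implyP[/andP[s0 st] ws]]; exists 0%R.
apply: (@cvg_trans _ ((cst 0%R : R -> R) u @[u --> t^'-])); last exact: cvg_cst.
apply: near_eq_cvg; near=> u.
have su : (s <= u)%R by near: u; exact: nbhs_left_ge.
rewrite pexpE ?(le_trans s0)// (_ : w u = -oo)//.
apply: lpath_dead; first by rewrite (le_trans s0).
by apply: contra_notN ws; apply: lpath_fin_le; rewrite s0.
Unshelve. all: by end_near. Qed.

(** One-sided limits bound the function on either side of each point of [0, t]; with its value at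
    the point this is a local bound, and compactness makes it global. *)
Lemma pexp_bounded a w t :
  exists M : R, forall u, (0 <= u <= t)%R -> (pexp a w u <= M)%R.
Proof.
have /near_covering_withinP cov : near_covering (`[0%R, t] : set R).
  exact/compact_near_coveringP/segment_compact.
have bnd (F : set_system R) (FF : Filter F) (l : R) :
    pexp a w u @[u --> F] --> l ->
    \forall u \near F & M \near +oo%R, (pexp a w u <= M)%R.
  move=> fl; exists ([set u | pexp a w u < l + 1]%R, [set M | l + 1 < M]%R) => /=.
    split; last by apply: nbhs_pinfty_gt; rewrite num_real.
    by apply: (cvgr_lt _ fl); rewrite ltrDl.
  by move=> [u M] /= [h1 h2]; rewrite ltW// (lt_trans h1).
have : \forall M \near +oo%R, `[0%R, t] `<=` [set u | pexp a w u <= M]%R.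
  apply: cov => u /=; rewrite in_itv/= => /andP[u0 ut].
  have [[A1 B1] [/= [e1 /= e10 He1] MB1] H1] := bnd _ _ _ (@pexp_right a w u u0).
  (* The bound on the left of [u]; at the origin no point of the segment lies there and any radius
     will do. *)
  have [B [MB [e2 e20 H2]]] : exists B, nbhs +oo%R B /\ exists2 e : R, (0 < e)%R & forall v M : R,
      (u - e < v < u)%R -> (0 <= v)%R -> B M -> (pexp a w v <= M)%R.
    have [u00|u00] := ltP 0%R u; last first.
      exists setT; split; first exact: filterT.
      exists 1%R => // v M /andP[_ vu] v0; exfalso.
      by move: (lt_le_trans vu u00); rewrite ltNge v0.
    have [l /bnd [[A2 B2] [/= [e2 /= e20 He2] MB2] H2]] := @pexp_left a w u u00.
    exists B2; split=> //; exists e2 => // v M /andP[v1 v2] _ BM.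
    apply: (H2 (v, M)); split => //=; apply: He2 => //=.
    by rewrite gtr0_norm ?subr_gt0// ltrBlDr -ltrBlDl.
  exists ([set v | u - Num.min e1 e2 < v < u + Num.min e1 e2]%R,
      [set M | [/\ B1 M, B M & (pexp a w u <= M)%R]]) => /=.
    split.
      have e0 : (0 < Num.min e1 e2)%R by rewrite lt_min e10.
      exists (Num.min e1 e2) => //= v /=.
      by rewrite ltr_distlC.
    near=> M; split; near: M => //.
    by apply: nbhs_pinfty_ge; rewrite num_real.
  move=> [v M] /= [/andP[v1 v2] [b1 b2 b3]]; rewrite in_itv/= => /andP[v0 vt].
  have [vu|uv|->//] := ltgtP v u.
    apply: H2 => //; rewrite vu andbT (le_lt_trans _ v1)// lerD2l lerN2.
    by rewrite ge_min lexx orbT.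
  apply: (H1 (v, M)); split => //=; apply: He1 => //=.
  rewrite ltr0_norm ?subr_lt0// opprB ltrBlDl (lt_le_trans v2)// lerD2l.
  by rewrite ge_min lexx.
move=> [M /= [Mr HM]].
exists (M + 1)%R => u ut; apply: (HM (M + 1)%R); first by rewrite ltrDl.
by rewrite /= in_itv.
Unshelve. all: by end_near. Qed.

End lpath_facts.

(** * Changes of variables *)

Section indicator_weights.
Context d (T : measurableType d) (R : realType).
Variables (mu : {measure set T -> \bar R}) (D : set T) (g : T -> R).

Lemma integral_weight_indic (h : T -> \bar R) :
  \int[mu]_x ((g x * \1_D x)%:E * h x) = \int[mu]_(x in D) ((g x)%:E * h x).
Proof.
rewrite [RHS]integral_mkcond; apply: eq_integral => x _.
by rewrite patchE indicE; case: ifPn => xD; rewrite ?mulr1// mulr0 mul0e.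
Qed.

Lemma integral_set_indic (S : set T) :
  \int[mu]_(x in S) (g x * \1_D x)%:E = \int[mu]_(x in S `&` D) (g x)%:E.
Proof.
rewrite integral_mkcondr; apply: eq_integral => x _.
by rewrite patchE indicE; case: ifPn => xD; rewrite ?mulr1// mulr0.
Qed.

End indicator_weights.

(** * Substitution along the primitive of a locally bounded function *)

Section primitive.
Context (R : realType).
Notation leb := (@lebesgue_measure R).
Variable g : R -> R.
Hypothesis mg : measurable_fun setT g.
Hypothesis g0 : forall u, (0 <= g u)%R.
Hypothesis gb : forall t, exists M : R, forall u, (0 <= u <= t)%R -> (g u <= M)%R.

Definition prim t : R := fine (\int[leb]_(u in `[0%R, t]) (g u)%:E).

Let mEg (D : set R) : measurable_fun D (EFin \o g).
Proof. by apply: measurable_funTS; exact/measurable_EFinP. Qed.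

Let int_le s t (M : R) : (0 <= s <= t)%R -> (forall u, (s <= u <= t)%R -> (g u <= M)%R) ->
  \int[leb]_(u in `]s, t]) (g u)%:E <= (M * (t - s))%:E.
Proof.
move=> /andP[s0 st] HM.
apply: (@le_trans _ _ (\int[leb]_(u in `]s, t]) (cst M%:E u))).
  apply: ge0_le_integral => //; first by move=> u _; rewrite lee_fin.
    exact: mEg.
  by move=> u /=; rewrite in_itv/= => /andP[su ut]; rewrite lee_fin HM// ltW.
rewrite integral_cst//= lebesgue_measure_itv/= lte_fin; case: ltP => ts.
  by rewrite -EFinB -EFinM.
have -> : s = t by apply/eqP; rewrite eq_le st.
by rewrite subrr mulr0 mule0.
Qed.

Lemma prim_le0 t : (t <= 0)%R -> prim t = 0%R.
Proof.
move=> t0; rewrite /prim; have [->|tn0] := eqVneq t 0%R.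
  by rewrite set_itv1 integral_set1.
by rewrite set_itv_ge ?integral_set0// bnd_simp -ltNge lt_neqAle tn0.
Qed.

Lemma primE t : (prim t)%:E = \int[leb]_(u in `[0%R, t]) (g u)%:E.
Proof.
rewrite /prim fineK//; have [M HM] := gb t.
have [t0|t0] := leP 0%R t; last first.
  by rewrite set_itv_ge ?integral_set0// bnd_simp -ltNge.
rewrite ge0_fin_numE; last by apply: integral_ge0 => u _; rewrite lee_fin.
rewrite -(@integral_itv_obnd_cbnd _ 0%R (BRight t) (EFin \o g)) ?mEg//=.
have t0' : (0 <= (0:R) <= t)%R by apply/andP; split => //.
by apply: le_lt_trans (int_le t0' HM) _; rewrite ltry.
Qed.

Lemma prim_ge0 t : (0 <= prim t)%R.
Proof. by rewrite -lee_fin primE integral_ge0// => u _; rewrite lee_fin. Qed.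

Lemma primB s t : (0 <= s <= t)%R ->
  \int[leb]_(u in `]s, t]) (g u)%:E = (prim t - prim s)%:E.
Proof.
move=> /andP[s0 st]; rewrite EFinB !primE.
rewrite (@itv_bndbnd_setU _ _ (BLeft 0%R) (BRight s) (BRight t)) ?bnd_simp//.
rewrite ge0_integral_setU//=; last 3 first.
- exact: mEg.
- by move=> u _; rewrite lee_fin.
- apply/disj_setPS => u /= []; rewrite !in_itv/= => /andP[_ us] /andP[su _].
  by move: (le_lt_trans us su); rewrite ltxx.
by rewrite -primE addeAC subee// add0e.
Qed.

Lemma prim_homo : {homo prim : s t / (s <= t)%R}.
Proof.
move=> s t st; have [s0|s0] := leP s 0%R; first by rewrite prim_le0// prim_ge0.
rewrite -subr_ge0 -lee_fin -primB ?integral_ge0// => [u _|]; rewrite ?lee_fin//.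
by rewrite ltW.
Qed.

Lemma prim_lipschitz t : exists2 M : R, (0 < M)%R &
  forall s r, (s <= r <= t)%R -> (prim r - prim s <= M * (r - s))%R.
Proof.
(* The maximum with 1 makes the constant positive, so that e / M can serve as a modulus of
   continuity. *)
have [M HM] := gb t; exists (Num.max M 1)%R; first by rewrite lt_max ltr01 orbT.
have HM' u : (0 <= u <= t)%R -> (g u <= Num.max M 1)%R.
  by move=> /HM; rewrite le_max => ->.
have M0 : (0 <= Num.max M 1)%R by rewrite le_max ler01 orbT.
have pos s r : (0 <= s)%R -> (s <= r <= t)%R ->
    (prim r - prim s <= Num.max M 1 * (r - s))%R.
  move=> s0 /andP[sr rt]; rewrite -lee_fin -primB ?s0//; apply: int_le.
    by rewrite s0.
  by move=> u /andP[su ut]; rewrite HM'// (le_trans s0)// (le_trans ut).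
move=> s r /andP[sr rt]; have [s0|s0] := leP 0%R s; first by rewrite pos// sr.
rewrite (prim_le0 (ltW s0)); have [r0|r0] := leP 0%R r; last first.
  by rewrite prim_le0 ?subrr ?mulr_ge0 ?subr_ge0// ltW.
apply: (@le_trans _ _ (Num.max M 1 * (r - 0))%R); last first.
  by rewrite ler_wpM2l// lerD2l lerN2 ltW.
by have := pos 0%R r (lexx _); rewrite (prim_le0 (lexx 0%R)); apply; rewrite r0.
Qed.

Lemma prim_continuous : continuous prim.
Proof.
move=> t; apply/cvgrPdist_lt => e e0.
have [M M0 HM] := prim_lipschitz (t + 1)%R.
have d0 : (0 < Num.min 1 (e / M))%R by rewrite lt_min ltr01 divr_gt0.
exists (Num.min 1 (e / M))%R => //= s /=; rewrite [in X in X -> _]ltr_distlC.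
move=> /andP[s1 s2].
have [st1 st2] : (s <= t + 1 /\ `|t - s| * M < e)%R.
  split; first by rewrite ltW// (lt_le_trans s2)// lerD2l ge_min lexx.
  rewrite -ltr_pdivlMr// ltr_distlC (le_lt_trans _ s1) ?(lt_le_trans s2)//.
    by rewrite lerD2l ?lerN2 ge_min lexx ?orbT.
  by rewrite lerD2l ?lerN2 ge_min lexx ?orbT.
have [st|/ltW ts] := leP s t.
  rewrite ger0_norm ?subr_ge0 ?prim_homo//.
  apply: le_lt_trans st2; rewrite ger0_norm ?subr_ge0// mulrC HM// st.
  by rewrite /= lerDl.
rewrite ler0_norm ?subr_le0 ?prim_homo// opprB.
by apply: le_lt_trans st2; rewrite ler0_norm ?subr_le0// opprB mulrC HM// ts.
Qed.

(** Since [g] may vanish on intervals, the level [a] can be attained at many times; the superlevel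
    set starts after the last of them, the supremum of the times where [prim] is at most [a]. *)
Lemma prim_hit T a : (0 <= T)%R -> (0 <= a < prim T)%R ->
  exists2 r, (0 <= r <= T)%R & prim r = a /\
    [set t | (a < prim t)%R] `&` `]0%R, T] = `]r, T]%classic.
Proof.
move=> T0 /andP[a0 aT].
have [r0] : exists2 c, c \in `[0%R, T] & prim c = a.
  apply: IVT => //; last by rewrite prim_le0// ge_min a0/= le_max (ltW aT) orbT.
  by apply: continuous_subspaceT; exact: prim_continuous.
rewrite in_itv/= => /andP[r00 r0T] pr0.
pose S := [set t | (0 <= t <= T)%R /\ (prim t <= a)%R].
have Sr0 : S r0 by split; [rewrite r00|rewrite pr0].
have ubS : ubound S T by move=> t [/andP[]].
have hS : has_sup S by split; [exists r0|exists T].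
have r0S : (r0 <= sup S)%R by apply: sup_upper_bound.
have ST : (sup S <= T)%R by apply: ge_sup => //; exists r0.
have prS : prim (sup S) = a.
  apply/eqP; rewrite eq_le -[X in _ && (X <= _)%R]pr0 prim_homo// andbT.
  (* The Lipschitz bound carries [prim t <= a] from points [t] of [S] within e / M of the supremum
     to the supremum itself. *)
  have [M M0 HM] := prim_lipschitz T.
  apply/ler_addgt0Pr => e e0.
  have [t St st] := sup_adherent (divr_gt0 e0 M0) hS.
  have tS : (t <= sup S)%R by apply: sup_upper_bound.
  have [/andP[t0 tT] ta] := St.
  rewrite -lerBlDl; apply: (@le_trans _ _ (prim (sup S) - prim t)%R).
    by rewrite lerD2l lerN2.
  apply: (le_trans (HM t (sup S) _)); first by rewrite tS.
  by rewrite mulrC -ler_pdivlMr// lerBlDr -lerBlDl ltW.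
exists (sup S); first by rewrite (le_trans r00).
split=> //; apply/seteqP; split => t /=; rewrite !in_itv/=.
  move=> [at_ /andP[t0 ->]]; rewrite andbT ltNge; apply: contraTN at_ => tS.
  by rewrite -leNgt -prS prim_homo.
move=> /andP[st tT]; have t0 : (0 < t)%R.
  by rewrite (le_lt_trans _ st)// (le_trans r00).
rewrite t0 tT; split=> //; rewrite ltNge; apply: contraTN st => ta.
rewrite -leNgt; apply: sup_upper_bound => //; split => //.
by rewrite (ltW t0).
Qed.

Let measurable_prim : measurable_fun setT prim.
Proof. exact: continuous_measurable_fun prim_continuous. Qed.

(* The image of g(t)dt on ]0, T] under its primitive is the Lebesgue measure
   on ]0, prim T]. *)
Lemma prim_substitution_bounded T (k : R -> \bar R) : (0 <= T)%R ->
  measurable_fun setT k -> (forall u, 0 <= k u) ->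
  \int[leb]_(u in `]0%R, prim T]) k u =
  \int[leb]_(t in `]0%R, T]) ((g t)%:E * k (prim t)).
Proof.
move=> T0 mk k0.
rewrite -(integral_weight_indic leb `]0%R, T] g (k \o prim)).
transitivity (\int[leb]_(u in `]0%R, prim T]) ((cst 1%R u)%:E * k (id u))).
  by apply: eq_integral => u _; rewrite mul1e.
rewrite -(integral_weight_indic leb `]0%R, prim T] (cst 1%R) (k \o id)).
have Eg : forall a, \int[leb]_(x in [set x | (a < x)%R])
    (cst 1%R x * \1_(`]0%R, prim T]) x)%:E =
   \int[leb]_(x in [set x | (a < prim x)%R]) (g x * \1_(`]0%R, T]) x)%:E.
  move=> a; rewrite !integral_set_indic.
  have mS : measurable ([set x : R | (a < x)%R] `&` `]0%R, prim T]).
    by apply: measurableI => //; rewrite -set_itvoy.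
  transitivity (leb ([set x : R | (a < x)%R] `&` `]0%R, prim T])).
    by rewrite -[RHS]mul1e -integral_cst.
  (* The tail is everything for a < 0, empty for a >= prim T, and in between ]a, prim T] corresponds
     to the interval ]r, T] of [prim_hit]. *)
  have [a0|a0] := ltP a 0%R.
    rewrite setIidr; last first.
      by move=> x /=; rewrite in_itv/= => /andP[x0 _]; rewrite (lt_trans a0).
    rewrite setIidr; last first.
      by move=> x /= _; rewrite (lt_le_trans a0)// prim_ge0.
    rewrite primB ?lexx// (prim_le0 (lexx 0%R)) lebesgue_measure_itv/= lte_fin.
    case: ltP => // p0; rewrite subr0; congr _%:E; apply/eqP.
    by rewrite eq_le p0 prim_ge0.
  have [aT|aT] := ltP a (prim T); last first.
    rewrite (_ : _ `&` _ = set0); last first.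
      rewrite -subset0 => x /=; rewrite in_itv/= => -[ax /andP[_ xT]].
      by move: (lt_le_trans ax (le_trans xT aT)); rewrite ltxx.
    rewrite measure0 (_ : _ `&` _ = set0) ?integral_set0//.
    rewrite -subset0 => x /=; rewrite in_itv/= => -[ax /andP[_ /prim_homo xT]].
    by move: (lt_le_trans ax (le_trans xT aT)); rewrite ltxx.
  have [r /andP[r0 rT] [pr ->]] := prim_hit T0 (introT andP (conj a0 aT)).
  rewrite primB ?r0// pr (_ : _ `&` _ = `]a, prim T]%classic).
    by rewrite lebesgue_measure_itv/= lte_fin aT.
  apply/seteqP; split => x /=; rewrite !in_itv/=.
    by move=> [-> /andP[_ ->]].
  by move=> /andP[ax ->]; rewrite ax (le_lt_trans a0 ax).
apply: (integral_gt_unique _ _ _ _ _ _ _ Eg) => //=.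
- by apply: measurable_funM => //; exact: measurable_indic.
- by apply: measurable_funM => //; exact: measurable_indic.
- by move=> x; rewrite mulr_ge0.
- move=> a; rewrite Eg integral_set_indic.
  apply: (@le_lt_trans _ _ (\int[leb]_(x in `]0%R, T]) (g x)%:E)); last first.
    by rewrite primB ?lexx// ltry.
  apply: ge0_subset_integral => //.
  - apply: measurableI => //.
    rewrite -[X in measurable X]setTI (_ : [set x | _] = prim @^-1` `]a, +oo[).
      exact: measurable_prim.
    by apply/seteqP; split => x /=; rewrite in_itv/= andbT.
  - exact: mEg.
  - by move=> x _; rewrite lee_fin.
Qed.

(** Exhaustion by the intervals ]0, n]. The union on the left is an interval with left end 0 that
    contains its supremum or not, according to whether the primitive attains its limit. *)
Lemma prim_substitution (k : R -> \bar R) :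
  measurable_fun setT k -> (forall u, 0 <= k u) ->
  \int[leb]_(u in \bigcup_n `]0%R, prim n%:R]%classic) k u =
  \int[leb]_(t in `]0%R, +oo[) ((g t)%:E * k (prim t)).
Proof.
move=> mk k0.
have <- : \bigcup_n `]0%R, n%:R]%classic = `]0%R, +oo[%classic :> set R.
  apply/seteqP; split => [t [n _] /=|t /=]; rewrite !in_itv/= => /andP[t0 _].
    by rewrite t0.
  exists (Num.truncn t).+1 => //=; rewrite in_itv/= t0 ltW//.
  exact: truncnS_gt.
have mgk : measurable_fun setT (fun t => (g t)%:E * k (prim t)).
  by apply: emeasurable_funM; [exact/measurable_EFinP|exact: measurableT_comp].
rewrite -(cvg_lim _ (@ge0_nondecreasing_set_cvg_integral _ (measurableTypeR R) R
  (fun n => `]0%R, prim n%:R]%classic) k leb _ _ _ _))//; last 2 first.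
- move=> m n mn; apply/subsetPset => u /=; rewrite !in_itv/=.
  by move=> /andP[-> um]; rewrite (le_trans um)// prim_homo// ler_nat.
- by move=> n; exact: measurable_funTS.
rewrite -(cvg_lim _ (@ge0_nondecreasing_set_cvg_integral _ (measurableTypeR R) R
  (fun n => `]0%R, n%:R]%classic) (fun t => (g t)%:E * k (prim t)) leb _ _ _ _))//;
  last 3 first.
- move=> m n mn; apply/subsetPset => u /=; rewrite !in_itv/=.
  by move=> /andP[-> um]; rewrite (le_trans um)// ler_nat.
- by move=> n; exact: measurable_funTS.
- by move=> n t _; rewrite mule_ge0// lee_fin.
by congr (limn _); apply/funext => n; rewrite prim_substitution_bounded.
Qed.

End primitive.

(** * Substitution by a power *)

Section power_substitution.
Context (R : realType).
Notation leb := (@lebesgue_measure R).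

Lemma powRV (x c : R) : (0 <= x)%R -> (x^-1 `^ c = (x `^ c)^-1)%R.
Proof. by move=> x0; rewrite -powR_inv1// -powRrM mulN1r powRN. Qed.

Lemma integral_powR (a b q : R) : (0 < a)%R -> (a < b)%R -> q != 0%R ->
  \int[leb]_(x in `[a, b]) (x `^ (q - 1))%:E = ((b `^ q - a `^ q) / q)%:E.
Proof.
move=> a0 ab q0.
have cont (c x : R) : (0 < x)%R -> {for x, continuous (fun x => x `^ c)%R}.
  move=> x0; apply/differentiable_continuous/derivable1_diffP.
  by apply: derivable_powR; rewrite in_itv/= x0.
have der (x : R) : (0 < x)%R ->
    is_derive x 1%R (fun x => q^-1 * x `^ q)%R (x `^ (q - 1))%R.
  move=> x0; have -> : (x `^ (q - 1) = q^-1 *: (q * x `^ (q - 1)))%R.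
    by rewrite /GRing.scale/= mulrA mulVf// mul1r.
  by apply: is_deriveZ; exact: is_derive1_powR.
rewrite (@continuous_FTC2 _ _ (fun x => q^-1 * x `^ q)%R)//.
- by rewrite -EFinB -mulrBr mulrC.
- apply: continuous_in_subspaceT => x; rewrite inE/= in_itv/= => /andP[ax _].
  by apply: cont; exact: lt_le_trans ax.
- split => [x| |]; rewrite ?in_itv/=.
  + by move=> /andP[ax _]; apply: (@ex_derive _ _ _ _ _ _ _ (der x (lt_trans a0 ax))).
  + apply: cvg_at_right_filter; apply: cvgM; [exact: cvg_cst|exact: cont].
  + apply: cvg_at_left_filter; apply: cvgM; [exact: cvg_cst|].
    by apply: cont; exact: lt_trans ab.
- move=> x; rewrite in_itv/= => /andP[ax _].
  by rewrite derive1E; apply: derive_val; exact: der (lt_trans a0 ax).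
Qed.

Let powR_harmonic (p : R) : (0 < p)%R -> ((n.+1%:R^-1 : R) `^ p)%R @[n --> \oo] --> (0 : R)%R.
Proof.
move=> p0; apply: cvg_comp (powR_cvg0 p0) => P [e /= e0 He].
have /cvgrPdist_lt/(_ _ e0) := @cvg_harmonic R.
by apply: filterS => n tn; apply: He => //=.
Qed.

Let measurable_powEFin q (D : set R) : measurable_fun D (fun x : R => (x `^ q)%:E).
Proof.
by apply: measurable_funTS; apply/measurable_EFinP; exact: measurable_powR.
Qed.

Lemma integral_powR_right (r q : R) : (0 < r)%R -> (q < 0)%R ->
  \int[leb]_(x in `]r, +oo[) (x `^ (q - 1))%:E = (- (r `^ q / q))%:E.
Proof.
move=> r0 q0; rewrite integral_itv_obnd_cbnd//.
have -> : `[r, +oo[%classic = \bigcup_n `[r, (r * n.+1%:R)%R]%classic.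
  apply/seteqP; split => [x /=|x [n _] /=]; rewrite !in_itv/=.
    rewrite andbT => rx; exists (Num.truncn (x / r)) => //=.
    by rewrite in_itv/= rx mulrC -ler_pdivrMr// ltW// truncnS_gt.
  by case/andP => ->.
rewrite -(cvg_lim _ (@ge0_nondecreasing_set_cvg_integral _ (measurableTypeR R) R
  (fun n => `[r, (r * n.+1%:R)%R]%classic) _ leb _ _ _ _))//; last 3 first.
- move=> m n mn; apply/subsetPset => x /=; rewrite !in_itv/= => /andP[-> h].
  by rewrite (le_trans h)// ler_pM2l// ler_nat ltnS.
- by move=> n; exact: measurable_powEFin.
- by move=> n x _; rewrite lee_fin powR_ge0.
(* The interval of index 0 is reduced to a point, whereas [integral_powR] asks for distinct ends;
   the shift drops it. *)
apply/cvg_lim => //; rewrite -cvg_shiftS/=.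
have E n : \int[leb]_(x in `[r, (r * n.+2%:R)%R]) (x `^ (q - 1))%:E =
    (r `^ q / q * ((n.+2%:R^-1) `^ (- q) - 1))%:E.
  rewrite integral_powR// ?lt_eqF// ?ltr_pMr ?ltr1n//; congr _%:E.
  rewrite powRM ?(ltW r0)// powRV// powRN invrK; field.
  by rewrite lt_eqF.
under eq_fun do rewrite E.
apply: cvg_EFin; first by near=> n.
rewrite -[X in _ --> (- X)%R]mulr1 -mulrN; apply: cvgM; first exact: cvg_cst.
rewrite -[X in _ --> X]add0r; apply: cvgB; last exact: cvg_cst.
rewrite (cvg_shiftS (fun n => (n.+1%:R^-1 `^ (- q)))%R).
by apply: powR_harmonic; rewrite oppr_gt0.
Unshelve. all: by end_near. Qed.

Lemma integral_powR_left (b p : R) : (0 < b)%R -> (0 < p)%R ->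
  \int[leb]_(x in `]0%R, b]) (x `^ (p - 1))%:E = (b `^ p / p)%:E.
Proof.
move=> b0 p0.
have -> : `]0%R, b]%classic = \bigcup_n `[(b * n.+1%:R^-1)%R, b]%classic.
  apply/seteqP; split => [x /=|x [n _] /=]; rewrite !in_itv/=.
    move=> /andP[x0 xb]; exists (Num.truncn (b / x)) => //=.
    by rewrite in_itv/= xb andbT ler_pdivrMr// mulrC -ler_pdivrMr// ltW// truncnS_gt.
  by move=> /andP[h ->]; rewrite (lt_le_trans _ h)// divr_gt0.
rewrite -(cvg_lim _ (@ge0_nondecreasing_set_cvg_integral _ (measurableTypeR R) R
  (fun n => `[(b * n.+1%:R^-1)%R, b]%classic) _ leb _ _ _ _))//; last 3 first.
- move=> m n mn; apply/subsetPset => x /=; rewrite !in_itv/= => /andP[h ->].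
  by rewrite (le_trans _ h)// ler_pM2l// lef_pV2 ?posrE// ler_nat ltnS.
- by move=> n; exact: measurable_powEFin.
- by move=> n x _; rewrite lee_fin powR_ge0.
apply/cvg_lim => //; rewrite -cvg_shiftS/=.
have E n : \int[leb]_(x in `[(b * n.+2%:R^-1)%R, b]) (x `^ (p - 1))%:E =
    (b `^ p / p * (1 - (n.+2%:R^-1) `^ p))%:E.
  rewrite integral_powR ?gt_eqF// ?divr_gt0// ?ltr_pdivrMr// ?ltr_pMr ?ltr1n//.
  rewrite powRM ?(ltW b0)// ; congr _%:E.
  field.
  by rewrite gt_eqF.
under eq_fun do rewrite E.
apply: cvg_EFin; first by near=> n.
rewrite -[X in _ --> X]mulr1; apply: cvgM; first exact: cvg_cst.
rewrite -[X in _ --> X]subr0; apply: cvgB; first exact: cvg_cst.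
rewrite (cvg_shiftS (fun n => (n.+1%:R^-1 `^ p))%R).
exact: powR_harmonic.
Unshelve. all: by end_near. Qed.

(** The measure u^(gamma/alpha - 1) du has infinite mass towards +oo but, gamma being positive,
    finite mass near 0. Tails are therefore compared for -u instead of u, whence the double
    negations in the proof. *)
Lemma power_substitution (alpha gamma s : R) (k : R -> \bar R) :
  (0 < alpha)%R -> (0 < gamma)%R -> (0 < s)%R ->
  measurable_fun setT k -> (forall u, 0 <= k u) ->
  \int[leb]_(x in `]0%R, +oo[)
    ((x `^ (1 + gamma))^-1%:E * k (s * x `^ (- alpha))%R) =
  (alpha^-1 * s `^ (- (gamma / alpha)))%:E *
  \int[leb]_(u in `]0%R, +oo[) ((u `^ (gamma / alpha - 1))%:E * k u).
Proof.
move=> al0 ga0 s0 mk k0.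
set C := (alpha^-1 * s `^ (- (gamma / alpha)))%R.
have p0 : (0 < gamma / alpha)%R by rewrite divr_gt0.
have C0 : (0 <= C)%R by rewrite mulr_ge0 ?invr_ge0 ?(ltW al0)// powR_ge0.
have mpow (c : R) : measurable_fun setT (fun x : R => (x `^ c)%R).
  exact: measurable_powR.
rewrite -ge0_integralZl//; last 2 first.
- apply: measurable_funTS; apply: emeasurable_funM => //.
  by apply/measurable_EFinP; exact: mpow.
- by move=> x _; rewrite mule_ge0// lee_fin powR_ge0.
under [LHS]eq_integral do rewrite -powRN opprD addrC -[(_ * _)%R]opprK.
under [RHS]eq_integral do rewrite muleA -EFinM -[X in k X]opprK.
rewrite -(integral_weight_indic leb `]0%R, +oo[ (fun x => x `^ (- gamma - 1))%R
  (fun x => k (- - (s * x `^ (- alpha)))%R)).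
rewrite -(integral_weight_indic leb `]0%R, +oo[ (fun u => C * u `^ (gamma / alpha - 1))%R
  (fun u => k (- - u)%R)).
have Eg : forall a : R, \int[leb]_(x in [set x | (a < - (s * x `^ (- alpha)))%R])
      (x `^ (- gamma - 1) * \1_`]0%R, +oo[ x)%:E =
    \int[leb]_(x in [set x | (a < - x)%R])
      (C * x `^ (gamma / alpha - 1) * \1_`]0%R, +oo[ x)%:E /\
    \int[leb]_(x in [set x | (a < - (s * x `^ (- alpha)))%R])
      (x `^ (- gamma - 1) * \1_`]0%R, +oo[ x)%:E < +oo.
  move=> a; rewrite !integral_set_indic.
  have [a0|a0] := leP 0%R a.
    rewrite (_ : _ `&` _ = set0); last first.
      rewrite -subset0 => x /=; rewrite in_itv/= andbT => -[ax x0].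
      have : (0 < - (s * x `^ (- alpha)))%R by exact: le_lt_trans ax.
      by rewrite oppr_gt0 ltNge mulr_ge0// ?(ltW s0)// powR_ge0.
    rewrite integral_set0 (_ : _ `&` _ = set0) ?integral_set0 ?ltry//.
    rewrite -subset0 => x /=; rewrite in_itv/= andbT => -[ax x0].
    by have := le_lt_trans a0 ax; rewrite oppr_gt0 ltNge ltW.
  pose b := (- a)%R; have b0 : (0 < b)%R by rewrite oppr_gt0.
  (* [r] is the solution x of s x^(-alpha) = b. *)
  pose r := ((s / b) `^ alpha^-1)%R; have r0 : (0 < r)%R by rewrite powR_gt0// divr_gt0.
  have -> : [set x | (a < - (s * x `^ (- alpha)))%R] `&` `]0%R, +oo[ = `]r, +oo[%classic.
    have ra : (r `^ alpha = s / b)%R.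
      by rewrite -powRrM mulVf ?gt_eqF// powRr1// ltW// divr_gt0.
    apply/seteqP; split => x /=; rewrite !in_itv/= !andbT ltrNr -/b powRN.
      move=> [h x0]; move: h; rewrite ltr_pdivrMr ?powR_gt0// mulrC -ltr_pdivrMr//.
      rewrite -ra ; apply: contraTT; rewrite -!leNgt => xr.
      by rewrite ge0_ler_powR// ?nnegrE ltW.
    move=> rx; have x0 := lt_trans r0 rx; split => //.
    rewrite ltr_pdivrMr ?powR_gt0// mulrC -ltr_pdivrMr// -ra.
    by rewrite gt0_ltr_powR// ?nnegrE ltW.
  have -> : [set x | (a < - x)%R] `&` `]0%R, +oo[ = `]0%R, b[%classic.
    apply/seteqP; split => x /=; rewrite !in_itv/= !andbT ltrNr -/b.
      by case=> -> ->.
    by case/andP => -> ->.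
  rewrite integral_powR_right ?oppr_lt0//; split; last exact: ltry.
  rewrite integral_itv_bndo_bndc; last first.
    apply: measurable_funTS; apply/measurable_EFinP; apply: measurable_funM => //.
  under eq_integral do rewrite EFinM.
  rewrite ge0_integralZl//; last 2 first.
  - exact: measurable_powEFin.
  - by move=> x _; rewrite lee_fin powR_ge0.
  rewrite integral_powR_left// -EFinM; congr _%:E; rewrite /C /r.
  rewrite -powRrM mulrN (mulrC (alpha^-1)%R) !powRN powRM ?(ltW s0) ?invr_ge0 ?(ltW b0)//.
  rewrite powRV ?(ltW b0)//.
  field.
  by rewrite !gt_eqF// powR_gt0.
have mN : measurable_fun setT (fun u : R => k (- u)%R).
  by apply: measurableT_comp => //; exact: measurable_oppr.
have mX : measurable_fun setT (fun x : R => - (s * x `^ (- alpha)))%R.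
  apply: measurableT_comp => //; apply: measurable_funM => //; exact: mpow.
apply: (@integral_gt_unique _ _ _ _ _ leb leb _ _ _ _ _ _ _ _ mX _ _ _
    (fun u : R => k (- u)%R)) => //=.
- by apply: measurable_funM => //; exact: measurable_indic.
- by move=> x; rewrite mulr_ge0// powR_ge0.
- apply: measurable_funM; last exact: measurable_indic.
  exact: measurable_funM.
- by move=> x; apply: mulr_ge0 => //; apply: mulr_ge0 => //; exact: powR_ge0.
- by move=> a; have [] := Eg a.
- by move=> a; have [] := Eg a.
Qed.

End power_substitution.

(** * Additive functionals and the Lamperti transform *)

Section additive_functionals.
Context (R : realType).
Notation leb := (@lebesgue_measure R).
Implicit Types (w : lpath R) (t u s a : R).

Definition afun a w t : R := prim (pexp a w) t.

Section primitive_lemmas.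
Variables (a : R) (w : lpath R).

Lemma afunE t : (afun a w t)%:E = \int[leb]_(u in `[0%R, t]) (pexp a w u)%:E.
Proof.
by apply: primE; [exact: measurable_pexp1|exact: pexp_ge0|exact: pexp_bounded].
Qed.

Lemma afun_le0 t : (t <= 0)%R -> afun a w t = 0%R.
Proof. exact: prim_le0. Qed.

Lemma afun_ge0 t : (0 <= afun a w t)%R.
Proof.
by apply: prim_ge0; [exact: measurable_pexp1|exact: pexp_ge0|exact: pexp_bounded].
Qed.

Lemma afun_homo : {homo afun a w : s t / (s <= t)%R}.
Proof.
by apply: prim_homo; [exact: measurable_pexp1|exact: pexp_ge0|exact: pexp_bounded].
Qed.

Lemma afunB s t : (0 <= s <= t)%R ->
  \int[leb]_(u in `]s, t]) (pexp a w u)%:E = (afun a w t - afun a w s)%:E.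
Proof.
by apply: primB; [exact: measurable_pexp1|exact: pexp_ge0|exact: pexp_bounded].
Qed.

Lemma afun_continuous : continuous (afun a w).
Proof.
by apply: prim_continuous; [exact: measurable_pexp1|exact: pexp_ge0|exact: pexp_bounded].
Qed.

Lemma afun_substitution (k : R -> \bar R) :
  measurable_fun setT k -> (forall u, 0 <= k u) ->
  \int[leb]_(u in \bigcup_n `]0%R, afun a w n%:R]%classic) k u =
  \int[leb]_(t in `]0%R, +oo[) ((pexp a w t)%:E * k (afun a w t)).
Proof.
by apply: prim_substitution; [exact: measurable_pexp1|exact: pexp_ge0|exact: pexp_bounded].
Qed.

(** The integrand is positive at an alive time and, by right continuity, exceeds half its value on
    an interval just after it. *)
Lemma afun_lt s t : (0 <= s)%R -> (s < t)%R -> w s \is a fin_num ->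
  (afun a w s < afun a w t)%R.
Proof.
move=> s0 st ws; have p0 : (0 < pexp a w s)%R by rewrite pexpE// kexp_gt0.
have [e /= e0 He] : \forall u \near s^'+, (pexp a w s / 2 < pexp a w u)%R.
  apply: (cvgr_gt _ (pexp_right (a := a) (w := w) s0)).
  by rewrite ltr_pdivrMr// ltr_pMr// ltr1n.
pose r := (Num.min t (s + e / 2))%R.
have sr : (s < r)%R by rewrite lt_min st ltrDl divr_gt0.
have rt : (r <= t)%R by rewrite ge_min lexx.
apply: lt_le_trans (afun_homo rt).
rewrite -subr_gt0 -lte_fin -afunB; last by rewrite s0 ltW.
apply: (@lt_le_trans _ _ (\int[leb]_(u in `]s, r]) (cst (pexp a w s / 2)%:E u))).
  rewrite integral_cst//= lebesgue_measure_itv/= lte_fin sr -EFinB -EFinM lte_fin.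
  by rewrite mulr_gt0// ?divr_gt0// subr_gt0.
apply: ge0_le_integral => //.
- by move=> u _; rewrite lee_fin ltW// divr_gt0.
- by apply: measurable_funTS; apply/measurable_EFinP; exact: measurable_pexp1.
- move=> u /=; rewrite in_itv/= => /andP[su ur]; rewrite lee_fin ltW//.
  apply: He => //=; rewrite ltr0_norm ?subr_lt0// opprB ltrBlDl.
  apply: (le_lt_trans ur); rewrite gt_min; apply/orP; right.
  by rewrite ltrD2l ltr_pdivrMr// ltr_pMr// ltr1n.
Qed.

End primitive_lemmas.

(** The variable domain [0, t] is moved into the integrand, so that Tonelli gives measurability in
    time and path together. *)
Lemma measurable_afun a :
  measurable_fun setT (fun p : R * lpath R => afun a p.2 p.1).
Proof.
pose f (q : (R * lpath R) * R) : \bar R :=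
  (if (0 <= q.2)%R && (q.2 <= q.1.1)%R then pexp a q.1.2 q.2 else 0%R)%:E.
have mf : measurable_fun setT f.
  apply/measurable_EFinP; apply: measurable_fun_ifT.
  - apply: measurable_and; apply: measurable_fun_ler => //.
    by apply: measurableT_comp => //; exact: measurable_fst.
  - apply: (measurableT_comp (measurable_pexp a)
      (g := fun q : (R * lpath R) * R => (q.2, q.1.2))).
    apply: measurable_fun_pair => //.
    by apply: measurableT_comp => //; exact: measurable_snd.
  - exact: measurable_cst.
have f0 q : 0 <= f q.
  by rewrite lee_fin; case: ifP => // _; exact: pexp_ge0.
have mF := measurable_fun_fubini_tonelli_F (m2 := leb) f mf f0.
have := measurableT_comp (fine_measurable (R := R) measurableT) mF.
apply: eq_measurable_fun => -[t w] _; rewrite /= /afun /prim/=; congr fine.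
rewrite [RHS]integral_mkcond; apply: eq_integral => u _.
rewrite patchE /f/= (_ : (u \in _) = (0 <= u)%R && (u <= t)%R); first by case: ifP.
by apply/idP/idP; rewrite inE/= in_itv.
Qed.

Lemma measurable_afun1 a t : measurable_fun setT (fun w => afun a w t).
Proof. exact: (measurable_fun_pair2 t (measurable_afun a)). Qed.

Lemma measurable_pexp2 a t : measurable_fun setT (fun w => pexp a w t).
Proof. exact: (measurable_fun_pair2 t (measurable_pexp a)). Qed.

End additive_functionals.

Lemma mem_set_itv (R : realType) (i : interval R) (u : R) :
  (u \in [set` i]) = (u \in i).
Proof. by apply/idP/idP => [/set_mem|ui]; [|exact: mem_set]. Qed.

(** * The Lamperti time change and the exponential functional *)

Section lamperti_transform.
Context (R : realType) (alpha : R).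
Hypothesis alpha_gt0 : (0 < alpha)%R.
Notation leb := (@lebesgue_measure R).
Implicit Types (w : lpath R) (t u s x : R).

Lemma additive_functionalE w s :
  additive_functional alpha w s = (afun alpha w s)%:E.
Proof.
rewrite afunE; apply: eq_integral => u; rewrite inE/= in_itv/= => /andP[u0 _].
rewrite pexpE//; have [wu|/(lpath_dead u0) ->] := boolP (w u \is a fin_num).
  by rewrite kexpE// -[in LHS](fineK wu) -EFinM.
by rewrite gt0_muleNy ?lte_fin.
Qed.

Lemma time_change_ge0 w u : 0 <= time_change alpha w u.
Proof.
by apply: le_ereal_inf_tmp => _ [s [s0 _] <-]; rewrite lee_fin ltW.
Qed.

(** At an alive time the additive functional increases strictly just afterwards, so its right
    inverse returns to [t]. After the lifetime the functional is constant and this inversion is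
    lost. *)
Lemma time_change_afun w t : (0 <= t)%R -> w t \is a fin_num ->
  time_change alpha w (afun alpha w t) = t%:E.
Proof.
move=> t0 wt; apply/eqP; rewrite eq_le; apply/andP; split.
  apply/lee_addgt0Pr => e e0; apply: ereal_inf_lbound; exists (t + e)%R => //.
  rewrite /= additive_functionalE lte_fin afun_lt// ?ltrDl//; split => //.
  by rewrite ltr_wpDl.
apply: le_ereal_inf_tmp => _ [s [s0 ts] <-].
move: ts; rewrite additive_functionalE lte_fin => ts.
by rewrite lee_fin leNgt; apply: contraTN ts => /ltW st; rewrite -leNgt afun_homo.
Qed.

Lemma time_change_infty w u : (forall n : nat, afun alpha w n%:R <= u)%R ->
  time_change alpha w u = +oo.
Proof.
move=> Au; rewrite /time_change (_ : [set _ | _ in _] = set0) ?ereal_inf0//.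
rewrite -subset0 => y [s [s0 us] _]; move: us.
rewrite additive_functionalE lte_fin => us.
have : (afun alpha w s <= u)%R.
  by apply: le_trans (Au (Num.truncn s).+1); rewrite afun_homo// ltW// truncnS_gt.
by rewrite leNgt us.
Qed.

(** By monotonicity of the additive functional A, the event {tau(u) < r} is the union of the events
    {u < A_q} over rational q in ]0, r[. *)
Lemma measurable_time_change :
  measurable_fun setT (fun p : R * lpath R => time_change alpha p.2 p.1).
Proof.
move=> mT; apply: (measurability _ (ErealGenInftyO.measurableE R)) => //.
move=> _ [_ [r ->] <-]; rewrite setTI.
have -> : (fun p : R * lpath R => time_change alpha p.2 p.1) @^-1` `]-oo, r%:E[ =
    \bigcup_q ([set p : R * lpath R | (0 < (ratr q : R) < r)%R] `&`
      [set p : R * lpath R | p.1 < afun alpha p.2 (ratr q)]%R).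
  apply/seteqP; split => [[u w]/=|[u w] [q _] /= [/andP[q0 qr] uq]]; last first.
    rewrite in_itv/=; apply: (@le_lt_trans _ _ (ratr q)%:E); last by rewrite lte_fin.
    by apply: ereal_inf_lbound; exists (ratr q) => //=; rewrite additive_functionalE lte_fin.
  rewrite in_itv/= => /ereal_inf_lt[_ [s [s0 us] <-]].
  move: us; rewrite additive_functionalE !lte_fin => us => /rat_in_itvoo[q]; rewrite in_itv/= => /andP[sq qr].
  exists q => //=; rewrite qr (lt_trans s0)//; split => //.
  by rewrite (lt_le_trans us)// afun_homo// ltW.
apply: bigcupT_measurable_rat => q.
have [qr|qr] := boolP (0 < (ratr q : R) < r)%R; last first.
  rewrite (_ : _ `&` _ = set0)//; by apply/seteqP; split => p //= -[].
rewrite (_ : _ `&` _ = [set p : R * lpath R | p.1 < afun alpha p.2 (ratr q)]%R); last first.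
  by apply/seteqP; split => p //= -[].
rewrite -[X in measurable X]setTI.
have mA : measurable_fun setT (fun p : R * lpath R => p.1 < afun alpha p.2 (ratr q))%R.
  apply: measurable_fun_ltr => //.
  by apply: measurableT_comp (measurable_afun1 alpha (ratr q)) _.
exact: (mA measurableT [set true]).
Qed.

(** The comparison with the lifetime is absorbed by [pexp], which vanishes on dead paths; only
    finiteness of the time change is left to test. *)
Lemma lampertiE x w s : lamperti alpha x w s =
  let T := time_change alpha w (s * x `^ (- alpha))%R in
  if T \is a fin_num then (x * pexp 1 w (fine T))%R else 0%R.
Proof.
rewrite /lamperti /=; set T := time_change _ _ _.
have := time_change_ge0 w (s * x `^ (- alpha)); rewrite -/T.
case: T => [t| |]; last 2 first.
- by move=> _ /=; rewrite ltNge leey.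
- by rewrite leeNy_eq.
rewrite lee_fin => t0; rewrite lifetime_gt// pexpE//.
case: ifP => wt; first by rewrite kexpE ?mul1r.
by rewrite (@lpath_dead _ _ _ t0) ?wt//= mulr0.
Qed.

Lemma measurable_lamperti s :
  measurable_fun setT (fun p : R * lpath R => lamperti alpha p.1 p.2 s).
Proof.
apply: (eq_measurable_fun (fun p : R * lpath R =>
    let T := time_change alpha p.2 (s * p.1 `^ (- alpha))%R in
    if T \is a fin_num then (p.1 * pexp 1 p.2 (fine T))%R else 0%R)).
  by move=> p _; rewrite lampertiE.
have mT : measurable_fun setT (fun p : R * lpath R =>
    time_change alpha p.2 (s * p.1 `^ (- alpha))%R).
  apply: (measurableT_comp measurable_time_change
    (g := fun p : R * lpath R => ((s * p.1 `^ (- alpha))%R, p.2))).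
  apply: measurable_fun_pair => //.
  apply: measurable_funM => //.
  exact: (measurableT_comp (@measurable_powR R (- alpha)%R) measurable_fst).
apply: measurable_fun_ifT => //.
  apply: (measurable_fun_bool true); rewrite setTI.
  rewrite (_ : _ @^-1` _ = (fun p : R * lpath R =>
    time_change alpha p.2 (s * p.1 `^ (- alpha))%R) @^-1` [set~ +oo]).
    rewrite -[X in measurable X]setTI; apply: mT => //.
    exact: measurableC.
  apply/seteqP; split => p /=; have := time_change_ge0 p.2 (s * p.1 `^ (- alpha)).
    by case: (time_change _ _ _).
  by case: (time_change _ _ _).
apply: measurable_funM => //.
apply: (measurableT_comp (measurable_pexp 1) (g := fun p : R * lpath R =>
    (fine (time_change alpha p.2 (s * p.1 `^ (- alpha))%R), p.2))).
apply: measurable_fun_pair => //.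
by apply: measurableT_comp mT => //; exact: fine_measurable.
Qed.

Lemma exp_functional_opp w : exp_functional alpha (lpath_opp w) =
  \int[leb]_(u in `[0%R, +oo[) (pexp (- alpha) w u)%:E.
Proof.
rewrite /exp_functional integral_mkcond [RHS]integral_mkcond.
apply: eq_integral => u _; rewrite !patchE mem_set_itv in_itv/= andbT.
have [u0|u0] := leP 0%R u; last first.
  by rewrite memNset//= => -[]; rewrite leNgt u0.
rewrite pexpE//; have [wu|wu] := boolP (w u \is a fin_num).
  rewrite mem_set/=; last first.
    by split => //; rewrite lifetime_gt//= oppkE// fin_numN.
  by rewrite kexpE// oppkE// -[in LHS](fineK wu) -EFinN -EFinM mulrN mulNr.
rewrite memNset/=.
  by rewrite (lpath_dead u0 wu).
by move=> [_]; rewrite lifetime_gt//= (lpath_dead u0 wu).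
Qed.

Lemma measurable_exp_functional_opp :
  measurable_fun setT (fun w => exp_functional alpha (lpath_opp w)).
Proof.
pose f (p : lpath R * R) : \bar R :=
  (if (0 <= p.2)%R then pexp (- alpha) p.1 p.2 else 0%R)%:E.
have mf : measurable_fun setT f.
  apply/measurable_EFinP; apply: measurable_fun_ifT => //.
    exact: measurable_fun_ler.
  apply: (measurableT_comp (measurable_pexp (- alpha))
      (g := fun p : lpath R * R => (p.2, p.1))).
  exact: measurable_fun_pair.
have f0 p : 0 <= f p.
  by rewrite lee_fin; case: ifP => // _; exact: pexp_ge0.
have := measurable_fun_fubini_tonelli_F (m2 := leb) f mf f0.
apply: eq_measurable_fun => w _; rewrite exp_functional_opp /fubini_F.
rewrite [RHS]integral_mkcond; apply: eq_integral => u _.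
by rewrite patchE /f/= mem_set_itv in_itv/= andbT; case: ifP.
Qed.

Lemma exp_functional_dead w t : (0 <= t)%R -> w t \isn't a fin_num ->
  exp_functional alpha (lpath_opp w) = (afun (- alpha) w t)%:E.
Proof.
move=> t0 wt; rewrite exp_functional_opp afunE integral_mkcond [RHS]integral_mkcond.
apply: eq_integral => u _; rewrite !patchE !mem_set_itv !in_itv/= andbT.
have [u0|//] := leP 0%R u; have [//|tu] := leP u t.
rewrite /= pexpE// (_ : w u = -oo)//; apply: lpath_dead => //.
by apply: contra wt; apply: lpath_fin_le; rewrite t0 ltW.
Qed.

End lamperti_transform.

(** * From independence on rectangles to functions *)

Section rectangles.
Context d (T : measurableType d) d1 (S1 : measurableType d1)
  d2 (S2 : measurableType d2) (R : realType) (P : probability T R).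

(** A pi-system argument on the product space. With survival events at t + s, t and s as [D], [D1]
    and [D2], it turns independence of increments into the Markov property for functions of the past
    and of the next increment. *)
Lemma integral_rectangles (D D1 D2 : set T) (Y : T -> S1) (Z Z2 : T -> S2) :
  measurable D -> measurable D1 -> measurable D2 ->
  measurable_fun setT Y -> measurable_fun setT Z -> measurable_fun setT Z2 ->
  (forall B1 B2, measurable B1 -> measurable B2 ->
    P (D `&` (Y @^-1` B1 `&` Z @^-1` B2)) =
    P (D1 `&` Y @^-1` B1) * P (D2 `&` Z2 @^-1` B2)) ->
  forall h : S1 * S2 -> \bar R, measurable_fun setT h -> (forall y, 0 <= h y) ->
  \int[P]_(w in D) h (Y w, Z w) =
  \int[P]_(w in D1) \int[P]_(w2 in D2) h (Y w, Z2 w2).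
Proof.
move=> mD mD1 mD2 mY mZ mZ2 DY h mh h0.
have ind (U : Type) (E : set U) (f : U -> \bar R) u :
    (f \_ E) u = (\1_E u)%:E * f u.
  by rewrite patchE indicE; case: ifPn => _; rewrite ?mul1e ?mul0e.
have mX2 : measurable_fun setT (fun z : T * T => (Y z.1, Z2 z.2)).
  apply: measurable_fun_pair.
    exact: measurableT_comp mY measurable_fst.
  exact: measurableT_comp mZ2 measurable_snd.
transitivity (\int[P]_w ((\1_D w)%:E * h (Y w, Z w))).
  by rewrite integral_mkcond; apply: eq_integral => w _; rewrite ind.
transitivity (\int[P \x P]_z ((\1_(D1 `*` D2) z)%:E * h (Y z.1, Z2 z.2))); last first.
  rewrite fubini_tonelli1//=; last 2 first.
  - apply: emeasurable_funM; last exact: measurableT_comp mh mX2.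
    apply/measurable_EFinP; apply: measurable_indic; exact: measurableX.
  - by move=> z; rewrite mule_ge0// lee_fin.
  rewrite [RHS]integral_mkcond; apply: eq_integral => w _; rewrite ind /=.
  rewrite /fubini_F/= -ge0_integralZl//; last first.
    apply: measurable_funTS; apply: (measurableT_comp mh).
    by apply: measurable_fun_pair => //; exact: measurable_cst.
  rewrite [RHS]integral_mkcond; apply: eq_integral => y _.
  rewrite ind muleA !indicE in_setX; congr (_ * _).
  by case: (_ \in D1); case: (_ \in D2); rewrite ?mul1e ?mul0e.
apply: (@integral_unique _ _ _ _ _ _ R P (P \x P) (\1_D) (\1_(D1 `*` D2))
  (fun w => (Y w, Z w)) (fun z => (Y z.1, Z2 z.2)) _ _ _ _ _ mX2
  [set A `*` B | A in measurable & B in measurable] (fun=> setT)) => //.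
- by apply: measurable_indic; exact: measurableX.
- exact: measurable_fun_pair.
- by rewrite measurable_prod_measurableType.
- move=> _ _ [A mA [B mB <-]] [A' mA' [B' mB' <-]].
  rewrite -setXI; exists (A `&` A'); first exact: measurableI.
  by exists (B `&` B') => //; exact: measurableI.
- by move=> _; exists setT => //; exists setT => //; rewrite setXTT.
- by apply/seteqP; split => // x _; exists 0%N.
- move=> _; rewrite preimage_setT integral_indic// setIT.
  by rewrite (le_lt_trans (probability_le1 _ _))// ltry.
move=> _ [A mA [B mB <-]].
have mYA : measurable (Y @^-1` A) by rewrite -[X in measurable X]setTI; exact: mY.
have mZB : measurable (Z @^-1` B) by rewrite -[X in measurable X]setTI; exact: mZ.
have mZ2B : measurable (Z2 @^-1` B) by rewrite -[X in measurable X]setTI; exact: mZ2.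
have -> : (fun w => (Y w, Z w)) @^-1` (A `*` B) = Y @^-1` A `&` Z @^-1` B by [].
have mA2 : measurable ((fun z => (Y z.1, Z2 z.2)) @^-1` (A `*` B)).
  by rewrite -[X in measurable X]setTI; apply: mX2 => //; exact: measurableX.
rewrite integral_indic//; last exact: measurableI.
rewrite integral_indic//; last exact: measurableX.
apply: (eq_trans (DY _ _ mA mB)).
have m1 : measurable (D1 `&` Y @^-1` A) by exact: measurableI.
have m2 : measurable (D2 `&` Z2 @^-1` B) by exact: measurableI.
apply: (eq_trans (esym (product_measure1E P P m1 m2))).
by congr (_ _); apply/seteqP; split => -[u v] /=; tauto.
Qed.

End rectangles.

(** * Paths stopped at a fixed time *)

Section stopped_paths.
Context (R : realType).
Implicit Types (w : lpath R) (t s u : R).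

Lemma is_lpath_stop t w : (0 <= t)%R -> is_lpath (fun u => w (Num.min u t)).
Proof.
move=> t0; have min0 u : (0 <= u -> 0 <= Num.min u t)%R by move=> u0; rewrite le_min u0.
have [wy wa wr wl] := lpathP w; split.
- by move=> u /min0; exact: wy.
- move=> s u /andP[s0 su]; apply: wa; rewrite min0//=.
  by rewrite le_min !ge_min su lexx orbT.
- move=> u u0; have [ut|tu] := ltP u t => wu.
    apply: (@cvg_trans _ (w v @[v --> u^'+])).
      apply: near_eq_cvg; near=> v; rewrite /= min_l//.
      by near: v; exact: nbhs_right_le.
    exact: wr.
  apply: (@cvg_trans _ ((cst (w t) : R -> \bar R) v @[v --> u^'+])).
    apply: near_eq_cvg; near=> v.
    have uv : (u <= v)%R by near: v; exact: nbhs_right_ge.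
    by rewrite /= min_r// (le_trans tu).
  exact: cvg_cst.
- move=> u u0 wu; have [ut|tu] := leP u t.
    have [|l wl'] := wl u u0.
      by move=> v /[dup] uv /wu; rewrite /= min_l//; case/andP: uv => _ /ltW /le_trans; apply.
    exists l; apply: (@cvg_trans _ (w v @[v --> u^'-])); last exact: wl'.
    apply: near_eq_cvg; near=> v.
    have vu : (v <= u)%R by near: v; exact: nbhs_left_le.
    by rewrite /= min_l// (le_trans vu).
  exists (fine (w t)).
  apply: (@cvg_trans _ ((cst (w t) : R -> \bar R) v @[v --> u^'-])).
    apply: near_eq_cvg; near=> v.
    have tv : (t <= v)%R by near: v; exact: nbhs_left_ge.
    by rewrite /= min_r.
  rewrite fineK; first exact: cvg_cst.
  by have := wu t; rewrite /= min_l ?t0//; apply.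
Unshelve. all: by end_near. Qed.

Definition lstop t (t0 : (0 <= t)%R) w := LPath (is_lpath_stop w t0).

Lemma lstopE t (t0 : (0 <= t)%R) w u : (u <= t)%R -> lstop t0 w u = w u.
Proof. by move=> ut; rewrite /lstop/= min_l. Qed.

(** Stopping reads the coordinates at times min(u, t) only, hence is measurable with respect to the
    past up to [t]; an event unchanged by stopping is its own preimage. *)
Lemma sigma_of_stop t (C : set (lpath R)) (t0 : (0 <= t)%R) : measurable C ->
  (forall w, C (lstop t0 w) <-> C w) -> sigma_of (@lcoord R) `[0%R, t] C.
Proof.
move=> mC CE.
have m : measurable_fun setT (lstop t0 :
    g_sigma_algebraType (cylinders (@lcoord R) `[0%R, t]) -> lpath R).
  apply: (@measurability _ _ _ _ _ _ (cylinders (@lcoord R) `[0%R, +oo[)) => //.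
  move=> _ [_ [u [B [u0 mB ->]]] <-]; rewrite setTI; apply: sub_sigma_algebra.
  exists (Num.min u t), B; split => //=; rewrite in_itv/= le_min t0 ge_min lexx orbT andbT.
  by move: u0; rewrite /= in_itv/= andbT => ->.
have := m measurableT C mC; rewrite setTI.
by rewrite (_ : _ @^-1` C = C)//; apply/seteqP; split => w /CE.
Qed.

Lemma sigma_of_sub d (S : measurableType d) (T : Type) (Y : R -> T -> S)
  (J1 J2 : set R) : J1 `<=` J2 -> sigma_of Y J1 `<=` sigma_of Y J2.
Proof.
move=> J12; apply: sub_sigma_algebra2.
by move=> _ [t [B [Jt mB ->]]]; exists t, B; split => //; exact: J12.
Qed.

End stopped_paths.

(** * Killed Levy processes and exponential tilting *)

Section killed_increments.
Context (R : realType).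
Implicit Types (t s u : R).

Lemma measurable_alive t : (0 <= t)%R ->
  measurable [set w : lpath R | w t \is a fin_num].
Proof.
move=> t0; have /(_ measurableT (~` [set -oo])) := @measurable_lcoord R t t0.
rewrite setTI => /(_ (measurableC (emeasurable_set1 _))).
rewrite (_ : _ @^-1` _ = [set w : lpath R | w t \is a fin_num])//.
apply/seteqP; split => w /=; rewrite /lcoord.
  by move=> wt; apply/negPn/negP => /(lpath_dead t0).
by move=> /[swap] ->.
Qed.

Lemma measurable_fine_coord t : (0 <= t)%R ->
  measurable_fun setT (fun w : lpath R => fine (w t)).
Proof.
by move=> t0; apply: measurableT_comp (measurable_lcoord t0); exact: fine_measurable.
Qed.

Lemma measurable_alive_preimage t (f : lpath R -> R) (B : set R) : (0 <= t)%R ->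
  measurable_fun setT f -> measurable B ->
  measurable [set w : lpath R | w t \is a fin_num /\ B (f w)].
Proof.
move=> t0 mf mB; have := mf measurableT B mB; rewrite setTI => mfB.
by apply: (measurableI [set w : lpath R | w t \is a fin_num]) => //; exact: measurable_alive.
Qed.

Lemma sigma_of_measurable t (A : set (lpath R)) :
  sigma_of (@lcoord R) `[0%R, t] A -> measurable A.
Proof.
by apply: sigma_of_sub => u /=; rewrite !in_itv/= andbT => /andP[].
Qed.

(* Unlike the construction in [killed_levy], this property passes to the law
   tilted by an exponential. *)
Definition killed_increments (Q : probability (lpath R) R) :=
  Q [set w : lpath R | w 0%R = 0] = 1 /\
  forall t s (A : set (lpath R)) (B : set R), (0 <= t)%R -> (0 <= s)%R ->
    sigma_of (@lcoord R) `[0%R, t] A -> measurable B ->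
  Q (A `&` [set w : lpath R | w (t + s)%R \is a fin_num /\
                    B (fine (w (t + s)) - fine (w t))%R]) =
  Q (A `&` [set w : lpath R | w t \is a fin_num]) *
  Q [set w : lpath R | w s \is a fin_num /\ B (fine (w s))].

Section levy.
Context d (Omega : measurableType d) (m : probability Omega R)
  (eta : R -> Omega -> R) (q : R) (e : Omega -> \bar R)
  (Xi : {mfun Omega >-> lpath R}).
Hypothesis levy : real_levy m eta.
Hypothesis exp_e : exponential_time m q e.
Hypothesis indep_e : indep_sigma m (sigma_of eta `[0%R, +oo[)
  [set e @^-1` B | B in (measurable : set (set \bar R))].
Hypothesis XiE : forall (w : Omega) t, (0 <= t)%R ->
  Xi w t = if t%:E < e w then (eta t w)%:E else -oo.

Lemma Xi_alive w t : (0 <= t)%R -> (Xi w t \is a fin_num) = (t%:E < e w).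
Proof. by move=> t0; rewrite XiE//; case: ifP. Qed.

Lemma fine_Xi w t : (0 <= t)%R -> t%:E < e w -> fine (Xi w t) = eta t w.
Proof. by move=> t0 te; rewrite XiE// te. Qed.

Lemma sigma_of_eta t (B : set R) (J : set R) : J t -> measurable B ->
  sigma_of eta J (eta t @^-1` B).
Proof. by move=> Jt mB; apply: sub_sigma_algebra; exists t, B. Qed.

(** Before killing, the path coincides with [eta]. The events whose trace on {t < e} comes from the
    past of [eta] form a sigma-algebra that contains the cylinders. *)
Lemma Xi_trace t (A : set (lpath R)) : (0 <= t)%R ->
  sigma_of (@lcoord R) `[0%R, t] A ->
  exists2 A' : set Omega, sigma_of eta `[0%R, t] A' &
    Xi @^-1` A `&` [set w | t%:E < e w] = A' `&` [set w | t%:E < e w].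
Proof.
move=> t0; pose F : set_system (lpath R) := [set A | exists2 A' : set Omega,
  sigma_of eta `[0%R, t] A' &
  Xi @^-1` A `&` [set w | t%:E < e w] = A' `&` [set w | t%:E < e w]].
apply: (@smallest_sub _ _ _ F) => {A}; first split.
- by exists set0; [exact: sigma_algebra0|rewrite preimage_set0 !set0I].
- move=> A [A' sA' AA']; exists (~` A'); first exact: sigma_algebraC.
  apply/seteqP; split => w /= [h te]; split => //.
    move=> /= A'w; have : (A' `&` [set w | t%:E < e w]) w by [].
    by rewrite -AA' => -[/= Aw _]; case: h.
  split => // Aw; have : (Xi @^-1` A `&` [set w | t%:E < e w]) w by [].
  by rewrite AA' => -[].
- move=> A FA; have /choice[A' HA'] : forall n, exists X, sigma_of eta `[0%R, t] X /\
      Xi @^-1` A n `&` [set w | t%:E < e w] = X `&` [set w | t%:E < e w].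
    by move=> n; have [X] := FA n; exists X.
  exists (\bigcup_n A' n).
    by apply: sigma_algebra_bigcup => n; have [] := HA' n.
  rewrite preimage_bigcup !setI_bigcupl; apply: eq_bigcupr => n _.
  by have [] := HA' n.
move=> _ [u [B [/= itu mB ->]]]; move: itu; rewrite in_itv/= => /andP[u0 ut].
exists (eta u @^-1` (EFin @^-1` B)).
  apply: sigma_of_eta; first by rewrite /= in_itv/= u0.
  have mE : measurable_fun setT (@EFin R) by apply/measurable_EFinP.
  by have := mE measurableT B mB; rewrite setTI.
apply/seteqP; split => w /= [h te]; split => //; move: h; rewrite /lcoord XiE//.
  by rewrite (le_lt_trans _ te).
by rewrite (le_lt_trans _ te).
Qed.

Let m_alive t (A : set Omega) : (0 <= t)%R -> sigma_of eta `[0%R, +oo[ A ->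
  m (A `&` [set w | t%:E < e w]) = m A * (expR (- (q * t)))%:E.
Proof.
move=> t0 sA; have [me <-//] := exp_e.
have -> : [set w | t%:E < e w] = e @^-1` `]t%:E, +oo[.
  by apply/seteqP; split => w /=; rewrite in_itv/= andbT.
by apply: indep_e => //; exists [set` `]t%:E, +oo[] => //; exact: emeasurable_itv.
Qed.

Lemma measurable_increment t s (J : set R) (B : set R) : J t -> J s -> measurable B ->
  sigma_of eta J ((fun w => eta s w - eta t w)%R @^-1` B).
Proof.
move=> Jt Js mB.
have mc u : J u -> measurable_fun setT (eta u : g_sigma_algebraType (cylinders eta J) -> R).
  by move=> Ju _ C mC; rewrite setTI; exact: sigma_of_eta.
have := measurable_funB (mc _ Js) (mc _ Jt).
by move=> /(_ measurableT B mB); rewrite setTI.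
Qed.

(** Independence of [e] factors out e^(-q (t + s)), which splits between past and future; the rest
    is the independence and stationarity of the increments of [eta]. *)
Lemma killed_increments_levy (P : probability (lpath R) R) :
  (forall A, measurable A -> P A = distribution m Xi A) -> killed_increments P.
Proof.
move=> PE; have [meta _ eta0 indep_eta stat] := levy.
have nn t : (0 <= t)%R -> (`[0%R, +oo[%classic : set R) t by move=> t0; rewrite /= in_itv/= t0.
split.
  have m0 : measurable [set w : lpath R | w 0%R = 0].
    by have /(_ measurableT [set 0]) := @measurable_lcoord R 0%R (lexx _); rewrite setTI; apply.
  rewrite PE//; change (m (Xi @^-1` [set w : lpath R | w 0%R = 0]) = 1).
  have mX : measurable (Xi @^-1` [set w : lpath R | w 0%R = 0]).
    by rewrite -[X in measurable X]setTI; exact: (@measurable_funPT _ _ _ _ Xi).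
  have [N [mN N0 subN]] := eta0.
  have [me e_gt] := exp_e.
  have mA : measurable [set w | 0 < e w].
    have /(_ measurableT `]0, +oo[%classic (emeasurable_itv _)) := me.
    rewrite setTI; congr (measurable _).
    by apply/seteqP; split => w /=; rewrite in_itv/= andbT.
  apply/eqP; rewrite eq_le probability_le1//=.
  (* The exponential tail at time 0 gives P(0 < e) = 1, so the killed path almost surely starts at
     [eta 0]. *)
  have := e_gt 0%R (lexx _); rewrite mulr0 oppr0 expR0 => <-.
  rewrite -[leRHS]adde0 -[X in _ + X]N0; apply: le_trans (measureU2 _ mX mN).
  apply: le_measure; rewrite ?inE//; first exact: measurableU.
  move=> w /= ew; have [Nw|Nw] := pselect (N w); [by right|left].
  rewrite /= XiE// ew; have [->//|/subN] := pselect (eta 0%R w = 0%R).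
  by [].
move=> t s A B t0 s0 sA mB; have [A' sA' AA'] := Xi_trace t0 sA.
have ts0 : (0 <= t + s)%R by exact: addr_ge0.
have mA := sigma_of_measurable sA.
have sA'y : sigma_of eta `[0%R, +oo[ A'.
  by apply: sigma_of_sub sA' => u /=; rewrite !in_itv/= andbT => /andP[].
rewrite !PE; last 3 first.
- exact: (measurable_alive_preimage s0 (measurable_fine_coord s0) mB).
- by apply: measurableI => //; exact: measurable_alive.
- apply: measurableI => //.
  apply: (@measurable_alive_preimage (t + s)%R
    (fun w : lpath R => fine (w (t + s)) - fine (w t))%R B ts0 _ mB).
  by apply: measurable_funB; exact: measurable_fine_coord.
have dE X : distribution m Xi X = m (Xi @^-1` X) by [].
rewrite !dE.
have -> : Xi @^-1` (A `&` [set w : lpath R | w (t + s)%R \is a fin_num /\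
    B (fine (w (t + s)) - fine (w t))%R]) =
    (A' `&` (fun w => eta (t + s) w - eta t w)%R @^-1` B) `&` [set w | (t + s)%:E < e w].
  apply/seteqP; split => w /=; rewrite Xi_alive//.
    move=> [Aw [ew Bw]].
    have te : t%:E < e w by apply: le_lt_trans ew; rewrite lee_fin lerDl.
    have : (Xi @^-1` A `&` [set w | t%:E < e w]) w by [].
    by rewrite AA' => -[A'w _]; move: Bw; rewrite !fine_Xi.
  move=> [[A'w Bw] ew].
  have te : t%:E < e w by apply: le_lt_trans ew; rewrite lee_fin lerDl.
  have : (A' `&` [set w | t%:E < e w]) w by [].
  by rewrite -AA' => -[Aw _]; rewrite !fine_Xi.
have -> : Xi @^-1` (A `&` [set w : lpath R | w t \is a fin_num]) =
    A' `&` [set w | t%:E < e w].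
  by rewrite -AA'; apply/seteqP; split => w /=; rewrite Xi_alive.
have -> : Xi @^-1` [set w : lpath R | w s \is a fin_num /\ B (fine (w s))] =
    (eta s @^-1` B) `&` [set w | s%:E < e w].
  apply/seteqP; split => w /=; rewrite Xi_alive//.
    by move=> [es]; rewrite fine_Xi.
  by move=> [Bs es]; rewrite fine_Xi.
have sB : sigma_of eta `[0%R, +oo[ ((fun w => eta (t + s) w - eta t w)%R @^-1` B).
  by apply: measurable_increment => //; exact: nn.
rewrite !m_alive//; last 2 first.
- exact: (@measurableI _ (g_sigma_algebraType (cylinders eta `[0%R, +oo[))).
- by apply: sigma_of_eta => //; exact: nn.
have -> : m (A' `&` (fun w => eta (t + s) w - eta t w)%R @^-1` B) =
    m A' * m ((fun w => eta (t + s) w - eta t w)%R @^-1` B).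
  by apply: (indep_eta t s) => //; exists B.
rewrite stat// mulrDr opprD expRD EFinM !muleA; congr (_ * _).
by rewrite -!muleA; congr (_ * _); rewrite muleC.
Qed.

End levy.
End killed_increments.

Lemma integral_indic_mul d (T : measurableType d) (R : realType)
  (mu : {measure set T -> \bar R}) (D : set T) (h : T -> \bar R) :
  \int[mu]_x ((\1_D x)%:E * h x) = \int[mu]_(x in D) h x.
Proof.
rewrite [RHS]integral_mkcond; apply: eq_integral => x _.
by rewrite patchE indicE; case: ifPn => xD; rewrite ?mul1e// mul0e.
Qed.

(** * Exponential tilting *)

Section exponential_tilting.
Context (R : realType) (P Q : probability (lpath R) R) (gamma : R).
Hypothesis tiltPQ : exp_tilt P gamma Q.
Implicit Types (t s u : R) (A : set (lpath R)).

Definition alive t : set (lpath R) := [set w : lpath R | w t \is a fin_num].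

Lemma alive_measurable t : (0 <= t)%R -> measurable (alive t).
Proof. exact: measurable_alive. Qed.

Lemma measurable_kexp_coord (a : R) t : (0 <= t)%R ->
  measurable_fun setT (fun w : lpath R => kexp a (w t)).
Proof.
by move=> t0; apply: measurableT_comp (measurable_lcoord t0); exact: measurable_kexp.
Qed.

Lemma kexp_indic (a : R) t (w : lpath R) : (0 <= t)%R ->
  kexp a (w t) = (expR (a * fine (w t)) * \1_(alive t) w)%R.
Proof.
move=> t0; rewrite indicE; have [wt|wt] := boolP (w t \is a fin_num).
  by rewrite mem_set// kexpE// mulr1.
by rewrite memNset ?mulr0 ?(lpath_dead t0 wt)//; exact/negP.
Qed.

Lemma exp_momentE t A : (0 <= t)%R -> exp_moment P gamma t A =
  \int[P]_(w in A) (kexp gamma (w t))%:E.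
Proof.
move=> t0; rewrite /exp_moment [LHS]integral_mkcondr; apply: eq_integral => w _.
rewrite patchE; have [wt|wt] := boolP (w t \is a fin_num).
  by rewrite mem_set/= ?lifetime_gt// kexpE// -[in LHS](fineK wt) -EFinM.
by rewrite memNset/= ?(lpath_dead t0 wt)// lifetime_gt//; exact/negP.
Qed.

Lemma tiltE t A : (0 <= t)%R -> sigma_of (@lcoord R) `[0%R, t] A ->
  Q (A `&` alive t) = \int[P]_(w in A) (kexp gamma (w t))%:E.
Proof.
move=> t0 sA; rewrite -exp_momentE// -tiltPQ//; congr (Q (_ `&` _)).
by apply/seteqP; split => w /=; rewrite lifetime_gt.
Qed.

(** Invariance under stopping places the events defined by [Y] in the past up to [t], where the tilt
    gives their probabilities. *)
Lemma tilt_integral d (S : measurableType d) t (t0 : (0 <= t)%R)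
    (Y : lpath R -> S) (h : S -> \bar R) :
  measurable_fun setT Y -> (forall w, Y (lstop t0 w) = Y w) ->
  measurable_fun setT h -> (forall y, 0 <= h y) ->
  \int[Q]_(w in alive t) h (Y w) = \int[P]_w ((kexp gamma (w t))%:E * h (Y w)).
Proof.
move=> mY Ystop mh h0.
rewrite -integral_indic_mul.
apply: (@integral_unique _ _ _ _ _ _ R Q P (\1_(alive t))
  (fun w : lpath R => kexp gamma (w t)) Y Y _ _ _ _ _ _ measurable (fun=> setT)) => //.
- by apply: measurable_indic; exact: alive_measurable.
- exact: measurable_kexp_coord.
- by move=> w; exact: kexp_ge0.
- by rewrite sigma_algebra_id//; exact: sigma_algebra_measurable.
- by move=> A B mA mB; exact: measurableI.
- by apply/seteqP; split => // y _; exists 0%N.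
- move=> _; rewrite preimage_setT integral_indic ?setIT//; last exact: alive_measurable.
  by rewrite (le_lt_trans (probability_le1 _ _))// ?ltry//; exact: alive_measurable.
- move=> A mA; have mYA : measurable (Y @^-1` A).
    by rewrite -[X in measurable X]setTI; exact: mY.
  rewrite integral_indic//; last exact: alive_measurable.
  rewrite setIC; apply: (tiltE t0); apply: (@sigma_of_stop _ _ _ t0) => // w /=; by rewrite Ystop.
Qed.

(** The density factorises as e^(gamma xi_t) e^(gamma (xi_(t+s) - xi_t)), and under [P] the second
    factor is independent of the past on survival. *)
Lemma killed_increments_tilt : killed_increments P -> killed_increments Q.
Proof.
move=> [P0 Pinc]; split.
  have m0 : measurable [set w : lpath R | w 0%R = 0].
    by have /(_ measurableT [set 0]) := @measurable_lcoord R 0%R (lexx _); rewrite setTI; apply.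
  have s0 : sigma_of (@lcoord R) `[0%R, 0%R] [set w : lpath R | w 0%R = 0].
    by apply: (@sigma_of_stop _ _ _ (lexx 0%R)) => // w /=; rewrite minxx.
  transitivity (Q ([set w : lpath R | w 0%R = 0] `&` alive 0%R)).
    by congr (Q _); apply/seteqP; split => w /=; rewrite /alive/=; [move=> ->|case].
  rewrite tiltE// -P0 -[RHS]mul1e -integral_cst//; apply: eq_integral => w.
  by rewrite inE/= => ->; rewrite /= mulr0 expR0.
move=> t s A B t0 s0 sA mB.
have ts0 : (0 <= t + s)%R by exact: addr_ge0.
have mA := sigma_of_measurable sA.
pose inc (w : lpath R) : R := (fine (w (t + s)) - fine (w t))%R.
have minc : measurable_fun setT inc.
  by apply: measurable_funB; exact: measurable_fine_coord.
have mincB : measurable (inc @^-1` B).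
  by rewrite -[X in measurable X]setTI; exact: minc.
have msB : measurable ((fun w : lpath R => fine (w s)) @^-1` B).
  by rewrite -[X in measurable X]setTI; exact: measurable_fine_coord.
have sub : sigma_of (@lcoord R) `[0%R, (t + s)%R] (A `&` inc @^-1` B).
  apply: (@measurableI _ (g_sigma_algebraType (cylinders (@lcoord R) `[0%R, (t + s)%R]))).
    apply: sigma_of_sub sA => u /=; rewrite !in_itv/= => /andP[-> ut].
    by rewrite (le_trans ut)// lerDl.
  apply: (@sigma_of_stop _ _ _ ts0) => // w; rewrite /inc/= !min_l// ?lerDl//.
have sB : sigma_of (@lcoord R) `[0%R, s] ((fun w : lpath R => fine (w s)) @^-1` B).
  apply: (@sigma_of_stop _ _ _ s0) => // w /=; by rewrite minxx.
transitivity (Q ((A `&` inc @^-1` B) `&` alive (t + s))).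
  by congr (Q _); apply/seteqP; split => w /=; rewrite /alive/=; tauto.
transitivity (Q (A `&` alive t) * Q ((fun w : lpath R => fine (w s)) @^-1` B `&` alive s)); last first.
  by congr (_ * Q _); apply/seteqP; split => w /=; rewrite /alive/=; tauto.
rewrite !tiltE//.
pose h (z : R * R) : \bar R := (expR (gamma * z.1) * (expR (gamma * z.2) * \1_B z.2))%:E.
have mh : measurable_fun setT h.
  apply/measurable_EFinP; apply: measurable_funM.
    apply: measurableT_comp => //; apply: measurable_funM => //.
  apply: measurable_funM.
    apply: measurableT_comp => //; apply: measurable_funM => //.
  by apply: measurableT_comp => //; exact: measurable_indic.
have h0 z : 0 <= h z by rewrite lee_fin !mulr_ge0// expR_ge0.
transitivity (\int[P]_(w in A `&` alive (t + s)) h (fine (w t), inc w)).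
  rewrite [LHS]integral_mkcondr [RHS]integral_mkcondr; apply: eq_integral => w _.
  rewrite !patchE /h/= kexp_indic// mulrA -expRD -mulrDr /inc subrKC !indicE.
  rewrite (_ : (w \in alive _) = (w (t + s)%R \is a fin_num)); last first.
    by apply/idP/idP => [/set_mem//|?]; exact: mem_set.
  rewrite (_ : (w \in _ @^-1` B) = ((fine (w (t + s)) - fine (w t))%R \in B)); last first.
    by apply/idP/idP => /set_mem ?; exact: mem_set.
  by case: (_ \in B); case: (_ \is a fin_num); rewrite ?mulr1 ?mulr0.
rewrite (@integral_rectangles _ _ _ _ _ _ _ P (A `&` alive (t + s)) (A `&` alive t)
  (alive s) (fun w : lpath R => fine (w t)) inc (fun w : lpath R => fine (w s)) _ _ _ _ _ _ _ h)//;
  try exact: measurable_fine_coord; try exact: alive_measurable;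
  try (by apply: measurableI => //; exact: alive_measurable); last first.
  move=> B1 B2 mB1 mB2.
  have sAY : sigma_of (@lcoord R) `[0%R, t] (A `&` (fun w : lpath R => fine (w t)) @^-1` B1).
    apply: (@measurableI _ (g_sigma_algebraType (cylinders (@lcoord R) `[0%R, t]))) => //.
    apply: (@sigma_of_stop _ _ _ t0); last by move=> w /=; rewrite minxx.
    by rewrite -[X in measurable X]setTI; exact: measurable_fine_coord.
  have := Pinc t s _ B2 t0 s0 sAY mB2.
  rewrite (_ : _ `&` _ `&` _ = A `&` alive (t + s) `&`
    ((fun w : lpath R => fine (w t)) @^-1` B1 `&` inc @^-1` B2)); last first.
    by apply/seteqP; split => w /=; rewrite /alive/inc/=; tauto.
  move=> ->; congr (P _ * P _); apply/seteqP; split => w /=; rewrite /alive/=; tauto.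
(* Integrating out the increment leaves this constant, the tilted probability of the event at time
   [s]. *)
pose C := \int[P]_(w in (fun w : lpath R => fine (w s)) @^-1` B) (kexp gamma (w s))%:E.
have CE : \int[P]_(w in alive s) (expR (gamma * fine (w s)) * \1_B (fine (w s)))%:E = C.
  rewrite /C [LHS]integral_mkcond [RHS]integral_mkcond; apply: eq_integral => w _.
  rewrite !patchE kexp_indic// !indicE.
  rewrite (_ : (w \in alive _) = (w s \is a fin_num)); last first.
    by apply/idP/idP => [/set_mem//|?]; exact: mem_set.
  rewrite (_ : (w \in _ @^-1` B) = (fine (w s) \in B)); last first.
    by apply/idP/idP => /set_mem ?; exact: mem_set.
  by case: (_ \in B); case: (_ \is a fin_num); rewrite ?mulr1 ?mulr0.
have mexp u : (0 <= u)%R -> measurable_fun setT (fun w : lpath R => (expR (gamma * fine (w u)))%:E).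
  move=> u0; apply/measurable_EFinP; apply: measurableT_comp => //.
  by apply: measurable_funM => //; exact: measurable_fine_coord.
have C0 : 0 <= C by apply: integral_ge0 => w _; rewrite lee_fin kexp_ge0.
transitivity (\int[P]_(w in A `&` alive t) ((expR (gamma * fine (w t)))%:E * C)).
  apply: eq_integral => w _; rewrite -CE -ge0_integralZl//.
  - exact: alive_measurable.
  - apply: measurable_funTS; apply/measurable_EFinP; apply: measurable_funM.
      by apply/measurable_EFinP; exact: mexp.
    apply: measurableT_comp; first exact: measurable_indic.
    exact: measurable_fine_coord.
rewrite ge0_integralZr//; last 2 first.
- by apply: measurableI => //; exact: alive_measurable.
- by apply: measurable_funTS; exact: mexp.
congr (_ * _); rewrite -integral_set_indic; apply: eq_integral => w _.
by rewrite kexp_indic.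
Qed.

End exponential_tilting.

(** * Time reversal *)

Section discrete_reversal.
Context (R : realType) (Q : probability (lpath R) R).
Hypothesis Qinc : killed_increments Q.
Variables (alpha delta : R).
Hypothesis delta0 : (0 <= delta)%R.

(** Transition operator of the chain z -> F z x, where x is the increment over a time [delta]; it is
    sub-Markovian, paths killed during the step contributing 0. *)
Definition step_op (F : R * R -> R -> R * R) (h : R * R -> \bar R) (z : R * R) : \bar R :=
  \int[Q]_w ((\1_(alive delta) w)%:E * h (F z (fine (w delta)))).

Section step_op_lemmas.
Variable F : R * R -> R -> R * R.
Hypothesis mF : measurable_fun setT (fun p : (R * R) * R => F p.1 p.2).
Variable h : R * R -> \bar R.
Hypotheses (mh : measurable_fun setT h) (h0 : forall z, 0 <= h z).

Let mFw : measurable_fun setT (fun p : (R * R) * lpath R => F p.1 (fine (p.2 delta))).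
Proof.
apply: (measurableT_comp mF (g := fun p : (R * R) * lpath R => (p.1, fine (p.2 delta)))).
apply: measurable_fun_pair => //.
exact: measurableT_comp (measurable_fine_coord delta0) measurable_snd.
Qed.

Lemma measurable_alive_indic :
  measurable_fun setT (fun w : lpath R => (\1_(alive delta) w : R)%:E).
Proof. by apply/measurable_EFinP; apply: measurable_indic; exact: alive_measurable. Qed.

Lemma measurable_step_op : measurable_fun setT (step_op F h).
Proof.
apply: (measurable_fun_fubini_tonelli_F (m2 := Q)
  (fun p : (R * R) * lpath R => (\1_(alive delta) p.2)%:E * h (F p.1 (fine (p.2 delta))))).
- apply: emeasurable_funM.
    exact: (measurableT_comp measurable_alive_indic measurable_snd).
  exact: measurableT_comp mh mFw.
- by move=> p; rewrite mule_ge0// lee_fin.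
Qed.

Lemma step_op_ge0 z : 0 <= step_op F h z.
Proof. by apply: integral_ge0 => w _; rewrite mule_ge0// lee_fin. Qed.

Lemma step_op_integrand z :
  measurable_fun setT (fun w : lpath R => h (F z (fine (w delta)))).
Proof. exact: measurableT_comp mh (measurableT_comp mFw (measurable_pair1 _)). Qed.

End step_op_lemmas.

(** Both compositions are double integrals over two independent increments; Tonelli exchanges them
    once the commutation matches the integrands. *)
Lemma step_op_comm (F G : R * R -> R -> R * R) (h : R * R -> \bar R) :
  measurable_fun setT (fun p : (R * R) * R => F p.1 p.2) ->
  measurable_fun setT (fun p : (R * R) * R => G p.1 p.2) ->
  measurable_fun setT h -> (forall z, 0 <= h z) ->
  (forall z x y, F (G z x) y = G (F z y) x) ->
  step_op F (step_op G h) = step_op G (step_op F h).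
Proof.
move=> mF mG mh h0 FG; apply/funext => z; rewrite /step_op.
pose k (p : lpath R * lpath R) : \bar R := (\1_(alive delta) p.1)%:E *
  ((\1_(alive delta) p.2)%:E * h (G (F z (fine (p.1 delta))) (fine (p.2 delta)))).
have mFw : measurable_fun setT (fun p : lpath R * lpath R => F z (fine (p.1 delta))).
  apply: (measurableT_comp mF (g := fun p : lpath R * lpath R => (z, fine (p.1 delta)))).
  apply: measurable_fun_pair => //.
  exact: measurableT_comp (measurable_fine_coord delta0) measurable_fst.
have mGw : measurable_fun setT (fun p : lpath R * lpath R =>
    G (F z (fine (p.1 delta))) (fine (p.2 delta))).
  apply: (measurableT_comp mG (g := fun p : lpath R * lpath R =>
    (F z (fine (p.1 delta)), fine (p.2 delta)))).
  apply: measurable_fun_pair => //.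
  exact: measurableT_comp (measurable_fine_coord delta0) measurable_snd.
have mk : measurable_fun setT k.
  apply: emeasurable_funM.
    exact: measurableT_comp measurable_alive_indic measurable_fst.
  apply: emeasurable_funM; last exact: measurableT_comp mh mGw.
  exact: measurableT_comp measurable_alive_indic measurable_snd.
have k0 p : 0 <= k p by rewrite !mule_ge0// lee_fin.
have mint (H : R * R -> R -> R * R) z1 :
    measurable_fun setT (fun p : (R * R) * R => H p.1 p.2) ->
    measurable_fun setT (fun w : lpath R => (\1_(alive delta) w)%:E * h (H z1 (fine (w delta)))).
  by move=> mH; apply: emeasurable_funM; [exact: measurable_alive_indic|exact: (step_op_integrand mH mh)].
transitivity (\int[Q]_w \int[Q]_w' k (w, w')).
  apply: eq_integral => w _; rewrite -ge0_integralZl ?lee_fin//; first exact: mint.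
  by move=> w' _; rewrite mule_ge0// lee_fin.
rewrite (fubini_tonelli k)//; apply: eq_integral => w _.
rewrite -ge0_integralZl ?lee_fin//; last 2 first.
- exact: mint.
- by move=> w' _; rewrite mule_ge0// lee_fin.
by apply: eq_integral => w' _; rewrite /k/= muleCA FG.
Qed.

(* For two chains driven by the same i.i.d. increments, the commutation FG
   says that reversing the order of the increments exchanges the chains. *)
Variables (F G : R * R -> R -> R * R).
Hypothesis mF : measurable_fun setT (fun p : (R * R) * R => F p.1 p.2).
Hypothesis mG : measurable_fun setT (fun p : (R * R) * R => G p.1 p.2).
Hypothesis FG : forall z x y, F (G z x) y = G (F z y) x.
Variable z0 : R * R.
Hypothesis FG0 : F z0 = G z0.

(** Writing T_F and T_G for the two operators, T_F^(n+1) h = T_G T_F^n h = T_F^n T_G h at [z0]: the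
    first equality holds since the steps agree at [z0], the second by commutation. The induction
    hypothesis is then used for T_G h. *)
Lemma step_op_iter n (h : R * R -> \bar R) :
  measurable_fun setT h -> (forall z, 0 <= h z) ->
  iter n (step_op F) h z0 = iter n (step_op G) h z0.
Proof.
have meas_iter k g : measurable_fun setT g -> (forall z, 0 <= g z) ->
    measurable_fun setT (iter k (step_op F) g) /\ (forall z, 0 <= iter k (step_op F) g z).
  move=> mg g0; elim: k => [//|k [IH1 IH2]] /=.
  by split; [exact: measurable_step_op|move=> z; exact: step_op_ge0].
have iter_comm k g : measurable_fun setT g -> (forall z, 0 <= g z) ->
    step_op G (iter k (step_op F) g) = iter k (step_op F) (step_op G g).
  move=> mg g0; elim: k => [//|k IH] /=.
  have [m1 m2] := meas_iter k g mg g0.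
  by rewrite -IH step_op_comm.
elim: n h => [//|n IH] h mh h0.
rewrite iterS; transitivity (step_op G (iter n (step_op F) h) z0).
  by rewrite /step_op FG0.
rewrite iter_comm// IH ?iterSr//; first exact: measurable_step_op.
by move=> z; exact: step_op_ge0.
Qed.

Variable Z : nat -> lpath R -> R * R.
Hypothesis mZ : forall n, measurable_fun setT (Z n).
Hypothesis Zstop : forall n (w : lpath R) (t0 : (0 <= n%:R * delta)%R), Z n (lstop t0 w) = Z n w.

(** [Z n] depends on the path up to n delta only, so on survival the next increment is independent
    of it and can be integrated out. *)
Lemma step_op_chain (H : R * R -> R -> R * R) n (h : R * R -> \bar R) :
  measurable_fun setT (fun p : (R * R) * R => H p.1 p.2) ->
  measurable_fun setT h -> (forall z, 0 <= h z) ->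
  (forall w : lpath R, w 0%R = 0 -> Z 0%N w = z0) ->
  (forall n (w : lpath R), Z n.+1 w = H (Z n w)
     (fine (w (n.+1%:R * delta)) - fine (w (n%:R * delta)))%R) ->
  \int[Q]_(w in alive (n%:R * delta)) h (Z n w) = iter n (step_op H) h z0.
Proof.
move=> mH mh h0 Z0 ZS.
elim: n h mh h0 => [|n IH] h mh h0.
  rewrite /= mul0r; have [Q0 _] := Qinc.
  pose E : set (lpath R) := [set w | w 0%R = 0].
  have mE : measurable E.
    by have /(_ measurableT [set 0]) := @measurable_lcoord R 0%R (lexx _); rewrite setTI; apply.
  have QE : Q E = 1 by exact: Q0.
  have mA : measurable (alive 0%R : set (lpath R)) by exact: alive_measurable.
  have EA : E `<=` alive 0%R by move=> w /= w0; rewrite /alive/= w0.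
  have mhZ (D : set (lpath R)) : measurable_fun D (fun w => h (Z 0%N w)).
    by apply: measurable_funTS; exact: measurableT_comp mh (mZ 0%N).
  (* Paths alive at time 0 but not started from 0 form a null set. *)
  rewrite -(setDUK EA) ge0_integral_setU//; last 2 first.
  - exact: measurableD.
  - by apply/disj_setPS => w /= [Ew [_ nEw]]; exact: nEw.
  rewrite [X in _ + X]null_set_integral ?adde0//; last 2 first.
  - exact: measurableD.
  - apply/eqP; rewrite eq_le measure_ge0 andbT.
    apply: (@le_trans _ _ (Q (~` E))).
      by apply: le_measure; rewrite ?inE; [exact: measurableD|exact: measurableC|move=> w []].
    by rewrite probability_setC// QE subee.
  rewrite (eq_integral (cst (h z0))); first by rewrite integral_cst// -[RHS]mule1; congr (_ * _); exact: QE.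
  by move=> w; rewrite inE => /Z0 ->.
have nd0 : (0 <= n%:R * delta)%R by rewrite mulr_ge0.
have nSd : (n.+1%:R * delta = n%:R * delta + delta)%R by rewrite -natr1 mulrDl mul1r.
have nSd0 : (0 <= n%:R * delta + delta)%R by rewrite addr_ge0.
rewrite iterSr -IH; [|exact: measurable_step_op|by move=> z; exact: step_op_ge0].
transitivity (\int[Q]_(w in alive (n%:R * delta + delta)) (h \o (fun p => H p.1 p.2))
   (Z n w, (fine (w (n%:R * delta + delta)) - fine (w (n%:R * delta)))%R)).
  by rewrite nSd; apply: eq_integral => w _; rewrite ZS /= nSd.
rewrite (@integral_rectangles _ _ _ _ _ _ _ Q _ (alive (n%:R * delta)) (alive delta)
  (Z n) _ (fun w : lpath R => fine (w delta)) _ _ _ _ _ _ _ (h \o (fun p => H p.1 p.2)))//;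
  try exact: measurable_fine_coord; try exact: alive_measurable.
- apply: eq_integral => w _; rewrite /step_op integral_indic_mul//.
- by apply: measurable_funB; exact: measurable_fine_coord.
- move=> B1 B2 mB1 mB2; have [_ /(_ (n%:R * delta)%R delta (Z n @^-1` B1) B2 nd0 delta0)] := Qinc.
  have sZ : sigma_of (@lcoord R) `[0%R, (n%:R * delta)%R] (Z n @^-1` B1).
    apply: (@sigma_of_stop _ _ _ nd0); last by move=> w /=; rewrite Zstop.
    by rewrite -[X in measurable X]setTI; exact: mZ.
  move=> /(_ sZ mB2); rewrite setIC (setIC (Z n @^-1` B1) (alive _)) => <-.
  by congr (Q _); apply/seteqP; split => w /=; rewrite /alive/=; tauto.
- exact: measurableT_comp mh mH.
- by move=> y; exact: h0.
Qed.

End discrete_reversal.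

Section riemann_sums.
Context (R : realType).
Notation leb := (@lebesgue_measure R).
Variables (a : R) (w : lpath R) (t : R).
Hypothesis t0 : (0 < t)%R.

Let delta n : R := (t / n.+1%:R)%R.

Let delta_gt0 n : (0 < delta n)%R. Proof. exact: divr_gt0. Qed.

Let step n (u : R) : R := (\sum_(k < n.+1)
  pexp a w (k.+1%:R * delta n) * \1_`[(k%:R * delta n)%R, (k.+1%:R * delta n)%R[ u)%R.

Let step_in n u : (0 <= u < t)%R -> exists2 v, (u < v <= u + delta n)%R & (v <= t)%R /\
  step n u = pexp a w v.
Proof.
move=> /andP[u0 ut]; pose k := Num.truncn (u / delta n).
have k_itv : (k%:R <= u / delta n < k.+1%:R)%R.
  by apply: truncn_itv; rewrite divr_ge0// ltW.
have kn : (k < n.+1)%N.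
  have [k1 _] := andP k_itv; rewrite -(ltr_nat R) (le_lt_trans k1)// /delta.
  by rewrite invf_div mulrA ltr_pdivrMr// mulrC ltr_pM2l.
have [] := andP k_itv; rewrite ler_pdivlMr// ltr_pdivrMr// => ku uk.
exists (k.+1%:R * delta n)%R.
  by rewrite uk -natr1 mulrDl mul1r lerD2r.
split.
  by rewrite /delta mulrC -mulrA ler_piMr ?(ltW t0)// ler_pdivrMl// mulr1 ler_nat.
rewrite /step (bigD1 (Ordinal kn))//= big1 ?addr0.
  by rewrite indicE mem_set/= ?mulr1// in_itv/= ku.
move=> i ik; rewrite indicE memNset ?mulr0//= in_itv/= => /andP[iu ui].
have : (Num.truncn (u / delta n) == i).
  rewrite truncn_eq; last by rewrite divr_ge0// ltW.
  by rewrite ler_pdivlMr// ltr_pdivrMr// iu.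
by rewrite -/k => /eqP ki; move/eqP: ik; apply; apply/val_inj.
Qed.

(** The sum is the integral of a step function whose value at [u] is the integrand at a grid point
    strictly after [u], at distance at most the mesh. Right continuity gives pointwise convergence,
    and boundedness on [0, t] gives domination. *)
Lemma riemann_cvg :
  (delta n * \sum_(k < n.+1) pexp a w (k.+1%:R * delta n))%R @[n --> \oo] --> afun a w t.
Proof.
suff : ((delta n * \sum_(k < n.+1) pexp a w (k.+1%:R * delta n))%R)%:E @[n --> \oo] --> (afun a w t)%:E.
  by move=> /fine_cvgP[].
rewrite afunE -integral_itv_bndo_bndc; last first.
  by apply: measurable_funTS; apply/measurable_EFinP; exact: measurable_pexp1.
have mstep n : measurable_fun setT (step n).
  apply: measurable_sum => k; apply: measurable_funM => //.
have intstep n : \int[leb]_(u in `[0%R, t[) (step n u)%:E =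
    (delta n * \sum_(k < n.+1) pexp a w (k.+1%:R * delta n))%:E.
  under eq_integral do rewrite /step -sumEFin.
  rewrite ge0_integral_sum//; last 2 first.
  - by move=> k; apply: measurable_funTS; apply/measurable_EFinP; apply: measurable_funM.
  - by move=> k u _; rewrite lee_fin mulr_ge0// pexp_ge0.
  rewrite mulr_sumr -sumEFin; apply: eq_bigr => k _.
  under eq_integral do rewrite EFinM.
  rewrite ge0_integralZl_EFin ?pexp_ge0//; last first.
    by apply: measurable_funTS; apply/measurable_EFinP.
  have kt : (k.+1%:R * delta n <= t)%R.
    by rewrite /delta mulrC -mulrA ler_piMr ?(ltW t0)// ler_pdivrMl// mulr1 ler_nat.
  rewrite integral_indic// setIidl; last first.
    move=> u /=; rewrite !in_itv/= => /andP[ku uk]; rewrite (lt_le_trans uk)// andbT.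
    by rewrite (le_trans _ ku)// mulr_ge0// ltW.
  rewrite [X in _ * X]/= lebesgue_measure_itv/= lte_fin ltr_pM2r// ltr_nat ltnSn -EFinB -mulrBl.
  by rewrite -natr1 [(_ + 1)%R]addrC addrK mul1r -EFinM mulrC.
under eq_fun do rewrite -intstep.
have [M HM] := @pexp_bounded _ a w t.
apply: (@dominated_cvg _ _ _ leb `[0%R, t[%classic _ _ _ (cst M%:E)) => //.
- by move=> n; apply: measurable_funTS; apply/measurable_EFinP; exact: mstep.
- move=> u /=; rewrite in_itv/= => u_itv; have [u0 ut] := andP u_itv.
  apply: cvg_EFin; first by near=> n.
  apply/cvgrPdist_lt => e e0.
  have /cvgrPdist_lt/(_ _ e0)[d /= d0 Hd] := @pexp_right _ a w u u0.
  have : delta n @[n --> \oo] --> 0%R.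
    by rewrite -[X in _ --> X](mulr0 t); apply: cvgM; [exact: cvg_cst|exact: cvg_harmonic].
  move=> /cvgrPdist_lt/(_ _ d0); apply: filterS => n; rewrite sub0r normrN gtr0_norm// => nd.
  have [v /andP[uv vu] [_ /= ->]] := step_in n u_itv; apply: Hd => //=.
  by rewrite ltr0_norm ?subr_lt0// opprB ltrBlDl (le_lt_trans vu)// ltrD2l.
- apply/integrableP; split => //; under eq_integral do rewrite /=.
  rewrite integral_cst//= lebesgue_measure_itv/= lte_fin t0 -EFinB -EFinM; exact: ltry.
- move=> n u /=; rewrite in_itv/= => u_itv; have [v /andP[uv _] [vt ->]] := step_in n u_itv.
  have [u0 ut] := andP u_itv.
  rewrite lee_fin ger0_norm ?pexp_ge0// HM// vt andbT (le_trans u0)// ltW//.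
Unshelve. all: by end_near. Qed.

End riemann_sums.

Section reversal.
Context (R : realType) (Q : probability (lpath R) R).
Hypothesis Qinc : killed_increments Q.
Variable alpha : R.
Implicit Types (w : lpath R).

Let pos (delta : R) (k : nat) (w : lpath R) : R := fine (w (k%:R * delta)%R).

(** Each sum, paired with the current position, is a chain started at (0, 0). [G] appends the term
    e^(-alpha z.1) to the forward sum; [F] multiplies the earlier terms of the reversed sum by
    e^(-alpha x) and adds the new term 1. *)
Lemma reversal_discrete (delta : R) N (h : R -> \bar R) : (0 <= delta)%R ->
  measurable_fun setT h -> (forall y, 0 <= h y) ->
  \int[Q]_(w in alive (N%:R * delta))
    h (\sum_(k < N) expR (- alpha * fine (w (k%:R * delta))))%R =
  \int[Q]_(w in alive (N%:R * delta))
    h (\sum_(k < N) expR (- alpha * (fine (w (N%:R * delta)) - fine (w (k.+1%:R * delta)))))%R.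
Proof.
move=> d0 mh h0.
have kd0 (k : nat) : (0 <= k%:R * delta)%R by rewrite mulr_ge0.
have mpos k : measurable_fun setT (pos delta k) by exact: measurable_fine_coord.
have stop_pos k n (w : lpath R) (t0 : (0 <= n%:R * delta)%R) : (k <= n)%N ->
    pos delta k (lstop t0 w) = pos delta k w.
  by move=> kn; rewrite /pos lstopE// ler_wpM2r// ler_nat.
pose G (z : R * R) (x : R) : R * R := (z.1 + x, z.2 + expR (- alpha * z.1))%R.
pose F (z : R * R) (x : R) : R * R := (z.1 + x, expR (- alpha * x) * z.2 + 1)%R.
pose ZG n w : R * R := (pos delta n w, \sum_(k < n) expR (- alpha * pos delta k w))%R.
pose ZF n w : R * R := (pos delta n w,
  \sum_(k < n) expR (- alpha * (pos delta n w - pos delta k.+1 w)))%R.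
have mexp d (T : measurableType d) (f : T -> R) : measurable_fun setT f ->
    measurable_fun setT (fun x => expR (- alpha * f x))%R.
  by move=> mf; apply: measurableT_comp => //; exact: measurable_funM.
have m11 : measurable_fun setT (fun p : (R * R) * R => p.1.1).
  exact: measurableT_comp measurable_fst measurable_fst.
have m12 : measurable_fun setT (fun p : (R * R) * R => p.1.2).
  exact: measurableT_comp measurable_snd measurable_fst.
have mG : measurable_fun setT (fun p : (R * R) * R => G p.1 p.2).
  apply: measurable_fun_pair; first exact: measurable_funD.
  by apply: measurable_funD => //; exact: mexp.
have mF : measurable_fun setT (fun p : (R * R) * R => F p.1 p.2).
  apply: measurable_fun_pair; first exact: measurable_funD.
  apply: measurable_funD => //; apply: measurable_funM => //; exact: mexp.
have mZG n : measurable_fun setT (ZG n).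
  apply: measurable_fun_pair => //.
  by apply: measurable_sum => k; exact: mexp.
have mZF n : measurable_fun setT (ZF n).
  apply: measurable_fun_pair => //.
  by apply: measurable_sum => k; apply: mexp; exact: measurable_funB.
have FG z x y : F (G z x) y = G (F z y) x.
  rewrite /F /G/=; congr pair; first by rewrite addrAC.
  by rewrite mulrDr addrAC -expRD -mulrDr [(y + z.1)%R]addrC.
have FG0 : F (0, 0)%R = G (0, 0)%R.
  by apply/funext => x; rewrite /F /G/= !mulr0 expR0.
have ZGstop n w (t0 : (0 <= n%:R * delta)%R) : ZG n (lstop t0 w) = ZG n w.
  rewrite /ZG stop_pos//; congr pair; apply: eq_bigr => k _.
  by rewrite stop_pos// ltnW.
have ZFstop n w (t0 : (0 <= n%:R * delta)%R) : ZF n (lstop t0 w) = ZF n w.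
  by rewrite /ZF stop_pos//; congr pair; apply: eq_bigr => k _; rewrite stop_pos.
have mh2 : measurable_fun setT (fun z : R * R => h z.2).
  exact: measurableT_comp mh measurable_snd.
have pos0 w : w 0%R = 0 -> pos delta 0 w = 0%R.
  by rewrite /pos mul0r => ->.
have h20 (z : R * R) : 0 <= h z.2 by exact: h0.
have ZG0 w : w 0%R = 0 -> ZG 0%N w = (0, 0)%R.
  by move=> w0; rewrite /ZG big_ord0 pos0.
have ZF0 w : w 0%R = 0 -> ZF 0%N w = (0, 0)%R.
  by move=> w0; rewrite /ZF big_ord0 pos0.
have ZGS n w : ZG n.+1 w = G (ZG n w)
    (fine (w (n.+1%:R * delta)) - fine (w (n%:R * delta)))%R.
  by rewrite /ZG /G/= big_ord_recr/= subrKC.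
have ZFS n w : ZF n.+1 w = F (ZF n w)
    (fine (w (n.+1%:R * delta)) - fine (w (n%:R * delta)))%R.
  rewrite /ZF /F/= subrKC; congr pair.
  rewrite big_ord_recr/= subrr mulr0 expR0; congr (_ + _)%R.
  rewrite mulr_sumr; apply: eq_bigr => k _; rewrite -expRD; congr expR.
  by rewrite -mulrDr addrA subrK.
have EG := step_op_chain Qinc d0 mZG ZGstop N mG mh2 h20 ZG0 ZGS.
have EF := step_op_chain Qinc d0 mZF ZFstop N mF mh2 h20 ZF0 ZFS.
exact: etrans EG (etrans (esym (step_op_iter Q d0 mF mG FG FG0 N mh2 h20)) (esym EF)).
Qed.

Variable t : R.
Hypothesis t0 : (0 < t)%R.

Let delta n : R := (t / n.+1%:R)%R.

Let delta_ge0 n : (0 <= delta n)%R. Proof. by rewrite divr_ge0// ltW. Qed.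

Let delta_cvg : delta n @[n --> \oo] --> 0%R.
Proof.
by rewrite -[X in _ --> X](mulr0 t); apply: cvgM; [exact: cvg_cst|exact: cvg_harmonic].
Qed.

Let n_delta n : (n.+1%:R * delta n)%R = t.
Proof. by rewrite /delta mulrC divfK. Qed.

Let kdelta n (k : nat) : (k <= n.+1)%N -> (0 <= k%:R * delta n <= t)%R.
Proof.
by move=> kn; rewrite mulr_ge0//= -[leRHS](n_delta n) ler_wpM2r// ler_nat.
Qed.

(** The forward sum is taken at left ends and the Riemann sum at right ends; they differ by boundary
    terms multiplied by the mesh. *)
Let forward_sum n w : alive t w ->
  (delta n * \sum_(k < n.+1) expR (- alpha * fine (w (k%:R * delta n)%R)))%R =
  (delta n * \sum_(k < n.+1) pexp (- alpha) w (k.+1%:R * delta n) +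
   delta n * (pexp (- alpha) w 0 - pexp (- alpha) w t))%R.
Proof.
move=> wt; rewrite -mulrDr; congr (_ * _)%R.
transitivity (\sum_(k < n.+1) pexp (- alpha) w (k%:R * delta n))%R.
  apply: eq_bigr => k _; have kd := kdelta (ltnW (ltn_ord k)).
  have [k0 _] := andP kd; rewrite pexpE// kexpE//.
  exact: lpath_fin_le kd wt.
rewrite big_ord_recl [in RHS]big_ord_recr/= mul0r n_delta.
rewrite (eq_bigr (fun k : 'I_n => pexp (- alpha) w (k.+1%:R * delta n)))//.
ring.
Qed.

Let backward_sum n w : alive t w ->
  (delta n * \sum_(k < n.+1) expR (- alpha * (fine (w (n.+1%:R * delta n)) -
     fine (w (k.+1%:R * delta n)))))%R =
  (pexp (- alpha) w t * (delta n * \sum_(k < n.+1) pexp alpha w (k.+1%:R * delta n)))%R.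
Proof.
move=> wt; rewrite [RHS]mulrCA; congr (_ * _)%R; rewrite mulr_sumr; apply: eq_bigr => k _.
have kd := @kdelta n k.+1 (ltn_ord k); have [k0 _] := andP kd.
have wk := lpath_fin_le kd wt.
rewrite n_delta !pexpE ?(ltW t0)// !kexpE// -expRD; congr expR.
by rewrite mulrBr !mulNr opprK.
Qed.

(** Continuity of [phi] lets the mesh tend to 0 inside it, and its boundedness provides the
    domination. *)
Lemma reversal_continuous (phi : R -> R) (C : R) : continuous phi ->
  (forall y, 0 <= phi y <= C)%R ->
  \int[Q]_(w in alive t) (phi (afun (- alpha) w t))%:E =
  \int[Q]_(w in alive t) (phi (pexp (- alpha) w t * afun alpha w t))%:E.
Proof.
move=> cphi phiC.
have mphi : measurable_fun setT phi by exact: continuous_measurable_fun.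
have dom (Y : nat -> lpath R -> R) (Y0 : lpath R -> R) :
    (forall n, measurable_fun setT (Y n)) ->
    (forall w, alive t w -> Y n w @[n --> \oo] --> Y0 w) ->
    \int[Q]_(w in alive t) (phi (Y n w))%:E @[n --> \oo] -->
    \int[Q]_(w in alive t) (phi (Y0 w))%:E.
  move=> mY YY0.
  apply: (@dominated_cvg _ _ _ Q (alive t) _ _ _ (cst C%:E)) => //.
  - by apply: alive_measurable; exact: ltW.
  - move=> n; apply: measurable_funTS; apply/measurable_EFinP.
    exact: measurableT_comp.
  - move=> w wt; apply: cvg_EFin; first by near=> n.
    exact: cvg_comp (YY0 w wt) (cphi _).
  - apply/integrableP; split => //; rewrite integral_cst//; last first.
      by apply: alive_measurable; exact: ltW.
    have mt : measurable (alive t : set (lpath R)) by apply: alive_measurable; exact: ltW.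
    apply: (@le_lt_trans _ _ (`|C%:E| * 1)); last by rewrite mule1 ltry.
    by rewrite lee_pmul// probability_le1.
  - by move=> n w _; have /andP[h1 h2] := phiC (Y n w); rewrite lee_fin ger0_norm.
have md (k : nat) n : measurable_fun setT (fun w : lpath R => fine (w (k%:R * delta n)%R)).
  by apply: measurable_fine_coord; rewrite mulr_ge0.
have c1 := dom (fun n w => delta n * \sum_(k < n.+1) expR (- alpha * fine (w (k%:R * delta n)%R)))%R
  (fun w => afun (- alpha) w t).
have c2 := dom (fun n w => delta n * \sum_(k < n.+1) expR (- alpha * (fine (w (n.+1%:R * delta n)) -
     fine (w (k.+1%:R * delta n)))))%R
  (fun w => pexp (- alpha) w t * afun alpha w t)%R.
have E n : \int[Q]_(w in alive t) (phi (delta n * \sum_(k < n.+1) expR (- alpha * fine (w (k%:R * delta n)%R))))%:E =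
   \int[Q]_(w in alive t) (phi (delta n * \sum_(k < n.+1) expR (- alpha * (fine (w (n.+1%:R * delta n)) -
     fine (w (k.+1%:R * delta n))))))%:E.
  have := @reversal_discrete (delta n) n.+1 (fun y => (phi (delta n * y))%:E) (delta_ge0 n).
  rewrite n_delta; apply; last by move=> y; rewrite lee_fin; have /andP[] := phiC (delta n * y)%R.
  apply/measurable_EFinP; apply: measurableT_comp => //.
have lim1 : \int[Q]_(w in alive t) (phi (delta n * \sum_(k < n.+1)
      expR (- alpha * fine (w (k%:R * delta n)%R))))%:E @[n --> \oo] -->
    \int[Q]_(w in alive t) (phi (afun (- alpha) w t))%:E.
  apply: c1 => [n|w wt].
    apply: measurable_funM => //; apply: measurable_sum => k.
    by apply: measurableT_comp => //; exact: measurable_funM.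
  have -> : afun (- alpha) w t =
      (afun (- alpha) w t + 0 * (pexp (- alpha) w 0 - pexp (- alpha) w t))%R.
    by rewrite mul0r addr0.
  apply: cvg_trans (cvgD (@riemann_cvg _ (- alpha)%R w t t0) (cvgM delta_cvg (cvg_cst _))).
  by apply: near_eq_cvg; near=> n; rewrite /= forward_sum.
have lim2 : \int[Q]_(w in alive t) (phi (delta n * \sum_(k < n.+1)
      expR (- alpha * (fine (w (n.+1%:R * delta n)) -
        fine (w (k.+1%:R * delta n))))))%:E @[n --> \oo] -->
    \int[Q]_(w in alive t) (phi (pexp (- alpha) w t * afun alpha w t))%:E.
  apply: c2 => [n|w wt].
    apply: measurable_funM => //; apply: measurable_sum => k.
    apply: measurableT_comp => //; apply: measurable_funM => //.
    exact: measurable_funB.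
  apply: cvg_trans (cvgM (cvg_cst _) (@riemann_cvg _ alpha w t t0)).
  by apply: near_eq_cvg; near=> n; rewrite /= backward_sum.
rewrite -(cvg_lim (@ereal_hausdorff R) lim1) -(cvg_lim (@ereal_hausdorff R) lim2).
by congr (limn _); apply/funext => n; rewrite E.
Unshelve. all: by end_near. Qed.

Lemma reversal_gt (a : R) :
  Q (alive t `&` [set w | (a < afun (- alpha) w t)%R]) =
  Q (alive t `&` [set w | (a < pexp (- alpha) w t * afun alpha w t)%R]).
Proof.
(* Continuous ramps increasing to the indicator of ]a, +oo[. *)
pose phi (k : nat) (y : R) : R := (Num.min 1 (k%:R * Num.max (y - a) 0))%R.
have phi01 k y : (0 <= phi k y <= 1)%R.
  by rewrite le_min ler01 ge_min lexx mulr_ge0//= le_max lexx orbT.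
have cphi k : continuous (phi k).
  move=> y; have cmax : {for y, continuous ((fun y => y - a : R^o)%R \max (cst 0%R))}.
    apply: continuous_max; last exact: cst_continuous.
    by apply: cvgB; [exact: cvg_id|exact: cvg_cst].
  have cmul : {for y, continuous (fun y => k%:R * Num.max (y - a) 0 : R^o)%R}.
    by apply: cvgM; [exact: cvg_cst|exact: cmax].
  exact: (@continuous_min _ _ (cst 1%R) _ y (@cst_continuous _ _ _ _) cmul).
have key (Y : lpath R -> R) : measurable_fun setT Y ->
    \int[Q]_(w in alive t) (phi k (Y w))%:E @[k --> \oo] -->
    Q (alive t `&` [set w | (a < Y w)%R]).
  move=> mY; have mt : measurable (alive t : set (lpath R)).
    by apply: alive_measurable; exact: ltW.
  have mYa : measurable [set w | (a < Y w)%R].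
    have := mY measurableT `]a, +oo[%classic (measurable_itv _); rewrite setTI.
    by congr (measurable _); apply/seteqP; split => w /=; rewrite in_itv/= andbT.
  rewrite setIC -integral_indic//.
  apply: (@dominated_cvg _ _ _ Q (alive t) _ _ _ (cst 1)) => //.
  - move=> n; apply: measurable_funTS; apply/measurable_EFinP.
    by apply: measurableT_comp => //; exact: continuous_measurable_fun.
  - move=> w _; apply: cvg_EFin; first by near=> n.
    rewrite indicE; have [aY|Ya] := ltP a (Y w).
      rewrite mem_set//; apply: cvg_near_cst.
      near=> k; rewrite /= /phi max_l ?subr_ge0 ?(ltW aY)//.
      apply/min_idPl; rewrite -ler_pdivrMr ?subr_gt0// mul1r.
      by near: k; exact: nbhs_infty_ger.
    rewrite memNset/=; last by apply/negP; rewrite -leNgt.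
    rewrite (_ : (fun _ => _) = cst 0%R); first exact: cvg_cst.
    by apply/funext => k; rewrite /= /phi max_r ?subr_le0// mulr0 min_r.
  - apply/integrableP; split => //; rewrite integral_cst//.
    apply: (@le_lt_trans _ _ (`|1| * 1)); last by rewrite mule1 /= ltry.
    by rewrite lee_pmul// probability_le1.
  - by move=> n w _; have /andP[h1 h2] := phi01 n (Y w); rewrite lee_fin ger0_norm.
have m1 : measurable_fun setT (fun w : lpath R => afun (- alpha) w t) by exact: measurable_afun1.
have m2 : measurable_fun setT (fun w : lpath R => pexp (- alpha) w t * afun alpha w t)%R.
  by apply: measurable_funM; [exact: measurable_pexp2|exact: measurable_afun1].
rewrite -(cvg_lim (@ereal_hausdorff R) (key _ m1)) -(cvg_lim (@ereal_hausdorff R) (key _ m2)).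
by congr (limn _); apply/funext => k; exact: reversal_continuous.
Unshelve. all: by end_near. Qed.

End reversal.

(** * Potential of a killed Levy process *)

Section boolean_indicators.
Context (R : realType).

Definition ind (b : bool) : \bar R := (if b then 1%R else 0%R)%:E.

Lemma measurable_ind d (T : measurableType d) (b : T -> bool) :
  measurable_fun setT b -> measurable_fun setT (fun x => ind (b x)).
Proof. by move=> mb; apply/measurable_EFinP; exact: measurable_fun_ifT. Qed.

Lemma ind_ge0 b : 0 <= ind b.
Proof. by case: b; rewrite lee_fin. Qed.

Lemma integral_ind d (T : measurableType d) (m : {measure set T -> \bar R}) (b : T -> bool) :
  measurable_fun setT b -> \int[m]_x ind (b x) = m [set x | b x].
Proof.
move=> mb; have mB : measurable [set x | b x].
  have := mb measurableT [set true]; rewrite setTI; apply => //.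
transitivity (\int[m]_x (\1_[set x | b x] x)%:E); last by rewrite integral_indic// setIT.
apply: eq_integral => x _.
rewrite indicE /ind (_ : (x \in _) = b x); first by case: (b x).
by apply/idP/idP => [/set_mem//|bx]; exact: mem_set.
Qed.

End boolean_indicators.

Section lifetime_law.
Context (R : realType) (Q : probability (lpath R) R).
Notation leb := (@lebesgue_measure R).
Hypothesis Qinc : killed_increments Q.
Hypothesis Q1 : Q (alive 1%R) < 1.
Variable alpha : R.
Implicit Types (w : lpath R) (t s a : R).

Let u t : R := fine (Q (alive t)).

Let uE t : (0 <= t)%R -> (u t)%:E = Q (alive t).
Proof. by move=> t0; rewrite /u fineK// fin_num_measure//; exact: alive_measurable. Qed.

Let u01 t : (0 <= t)%R -> (0 <= u t <= 1)%R.
Proof.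
move=> t0; rewrite -!lee_fin uE// measure_ge0 probability_le1//; exact: alive_measurable.
Qed.

Lemma afun_stop (c : R) t (t0 : (0 <= t)%R) w : afun c (lstop t0 w) t = afun c w t.
Proof.
apply: EFin_inj; rewrite !afunE; apply: eq_integral => r; rewrite inE => r_itv.
have /andP[r0 rt] : (0 <= r <= t)%R by move: r_itv; rewrite /= in_itv.
by rewrite !pexpE// lstopE.
Qed.

Lemma pexp_gt0 t w : (0 <= t)%R -> (0 < pexp 1 w t)%R = (w t \is a fin_num).
Proof.
move=> t0; rewrite pexpE//; have [wt|wt] := boolP (w t \is a fin_num).
  by rewrite kexp_gt0.
by rewrite (lpath_dead t0 wt)/= ltxx.
Qed.

Let u_add (A : set (lpath R)) t s : (0 <= t)%R -> (0 <= s)%R ->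
  sigma_of (@lcoord R) `[0%R, t] A ->
  Q (A `&` alive (t + s)) = Q (A `&` alive t) * (u s)%:E.
Proof.
move=> t0 s0 sA; have [_ /(_ t s A setT t0 s0 sA measurableT)] := Qinc.
rewrite uE// => h; apply: etrans (etrans h _).
  by congr (Q _); apply/seteqP; split => w /=; rewrite /alive/=; tauto.
by congr (_ * Q _); apply/seteqP; split => w /=; rewrite /alive/=; tauto.
Qed.

Let Q_alive0 : Q (alive 0%R) = 1.
Proof.
have m0 : measurable (alive 0%R : set (lpath R)) by exact: alive_measurable.
have mE : measurable [set w : lpath R | w 0%R = 0].
  by have /(_ measurableT [set 0]) := @measurable_lcoord R 0%R (lexx _); rewrite setTI; apply.
apply/eqP; rewrite eq_le probability_le1//=; have [<- _] := Qinc.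
by apply: le_measure; rewrite ?inE// => w /= w0; rewrite /alive/= w0.
Qed.

Let u_nat n : u n%:R = (u 1 ^+ n)%R.
Proof.
elim: n => [|n IH].
  by rewrite expr0; apply: EFin_inj; rewrite uE// Q_alive0.
have sT : sigma_of (@lcoord R) `[0%R, n%:R] setT.
  exact: (@measurableT _ (g_sigma_algebraType (cylinders (@lcoord R) `[0%R, n%:R]))).
have := u_add (ler0n _ n) ler01 sT.
rewrite !setTI => h; apply: EFin_inj; rewrite uE// -natr1 h -uE// IH -EFinM.
by rewrite -exprSr.
Qed.

Let z1 : (u 1 < 1)%R. Proof. by rewrite -lte_fin uE. Qed.

Let u_homo t s : (0 <= t)%R -> (t <= s)%R -> (u s <= u t)%R.
Proof.
move=> t0 ts; have s0 := le_trans t0 ts; rewrite -lee_fin !uE//.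
apply: le_measure; rewrite ?inE; try exact: alive_measurable.
by move=> w; apply: lpath_fin_le; rewrite t0.
Qed.

(** Survival is encoded as positivity of [pexp 1], which is jointly measurable; negative times are
    excluded so that time integrals can run over the whole line. *)
Definition big_at a (p : R * lpath R) : bool :=
  [&& (0 <= p.1)%R, (a < afun (- alpha) p.2 p.1)%R & (0 < pexp 1 p.2 p.1)%R].

(* Killing within e of a time where [big_at] holds. Its probability is
   (1 - Q (alive e)) Q (big_at a (t, .)) by the Markov property, while for a path
   with lifetime zeta the set of such t is ]zeta - e, zeta[ intersected with
   {t | a < A_t}: dividing by e -> 0 gives [occupation_exp_functional]. *)
Let big_dead a (e : R) (p : R * lpath R) : bool :=
  big_at a p && (pexp 1 p.2 (p.1 + e) <= 0)%R.

Let measurable_big_at a : measurable_fun setT (big_at a).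
Proof.
apply: measurable_and; first by apply: measurable_fun_ler => //; exact: measurable_fst.
apply: measurable_and; apply: measurable_fun_ltr => //.
  exact: measurable_afun.
exact: measurable_pexp.
Qed.

Let measurable_big_dead a (e : R) : measurable_fun setT (big_dead a e).
Proof.
apply: measurable_and; first exact: measurable_big_at.
apply: measurable_fun_ler => //.
apply: (measurableT_comp (measurable_pexp 1) (g := fun p : R * lpath R => ((p.1 + e)%R, p.2))).
apply: measurable_fun_pair => //.
by apply: measurable_funD => //; exact: measurable_fst.
Qed.

Definition occupation a : \bar R := \int[leb]_t Q [set w | big_at a (t, w)].

Let meas_big a t : (0 <= t)%R -> measurable [set w | (a < afun (- alpha) w t)%R].
Proof.
move=> t0; have := measurable_afun1 (- alpha) t measurableT (measurable_itv `]a, +oo[).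
rewrite setTI; congr (measurable _).
by apply/seteqP; split => w /=; rewrite in_itv/= andbT.
Qed.

Let sigma_big a t : (0 <= t)%R ->
  sigma_of (@lcoord R) `[0%R, t] [set w | (a < afun (- alpha) w t)%R].
Proof.
move=> t0; apply: (@sigma_of_stop _ _ _ t0); first exact: meas_big.
by move=> w /=; rewrite afun_stop.
Qed.

Lemma big_atE a t : (0 <= t)%R -> [set w | big_at a (t, w)] =
  [set w | (a < afun (- alpha) w t)%R] `&` alive t.
Proof.
move=> t0; apply/seteqP; split => w /=; rewrite /big_at/= t0/= pexp_gt0//.
  by move=> /andP[].
by move=> [-> ?].
Qed.

Let big_deadE a (e t : R) : (0 <= e)%R -> (0 <= t)%R -> [set w | big_dead a e (t, w)] =
  ([set w | (a < afun (- alpha) w t)%R] `&` alive t) `\` alive (t + e).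
Proof.
move=> e0 t0; rewrite -big_atE//; apply/seteqP; split => w /=; rewrite /big_dead/= leNgt pexp_gt0 ?addr_ge0//.
  by move=> /andP[-> /negP].
by move=> [-> /negP].
Qed.

Let big_neg a t (w : lpath R) : (t < 0)%R -> big_at a (t, w) = false.
Proof. by move=> t0; rewrite /big_at/= leNgt t0. Qed.

Let Q_big_dead a (e t : R) : (0 <= e)%R ->
  Q [set w | big_dead a e (t, w)] = (1 - u e)%:E * Q [set w | big_at a (t, w)].
Proof.
move=> e0; have [t0|t0] := leP 0%R t; last first.
  rewrite (_ : [set w | big_dead _ _ _] = set0).
    rewrite (_ : [set w | big_at _ _] = set0) ?measure0 ?mule0//.
    by apply/seteqP; split => w //=; rewrite big_neg.
  by apply/seteqP; split => w //=; rewrite /big_dead big_neg.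
rewrite big_deadE// big_atE//.
pose A : set (lpath R) := [set w | (a < afun (- alpha) w t)%R]; rewrite -/A.
have mA : measurable A by exact: (meas_big a t0).
have mAt : measurable (A `&` alive t) by apply: measurableI => //; exact: alive_measurable.
have mte : measurable (alive (t + e) : set (lpath R)) by apply: alive_measurable; exact: addr_ge0.
have setE : (A `&` alive t) `&` alive (t + e) = A `&` alive (t + e).
  apply/seteqP; split => w /= [].
    by move=> [].
  move=> Aw wte; split => //; split => //; apply: lpath_fin_le wte.
  by rewrite t0 lerDl.
have : Q (A `&` alive t) =
    Q ((A `&` alive t) `\` alive (t + e)) + Q (A `&` alive t) * (u e)%:E.
  by rewrite -(u_add t0 e0 (sigma_big a t0)) -setE; exact: measureDI.
have fin (B : set (lpath R)) : measurable B -> Q B \is a fin_num by exact: fin_num_measure.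
rewrite -(fineK (fin _ mAt)) -(fineK (fin _ (measurableD mAt mte))) -EFinM -EFinD -EFinM.
move=> h0; have h := EFin_inj h0; congr (_%:E).
by rewrite mulrBl mul1r {1}h [(u e * _)%R]mulrC addrK.
Qed.

Let measurable_Q_big a : measurable_fun setT (fun t => Q [set w | big_at a (t, w)]).
Proof.
have := measurable_fun_fubini_tonelli_F (m2 := Q) (fun p => ind R (big_at a p))
  (measurable_ind (measurable_big_at a)) (fun=> ind_ge0 R _).
apply: eq_measurable_fun => t _; rewrite /fubini_F integral_ind//.
exact: measurable_fun_pair2 (measurable_big_at a).
Qed.

(** Dropping the condition on the functional leaves the integral of Q(t < zeta), compared on unit
    intervals with the geometric series of ratio Q(1 < zeta) < 1. *)
Lemma occupation_lty a : occupation a < +oo.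
Proof.
(* At the level -1 the condition on the functional is void: [v] is the survival probability at
   nonnegative times and 0 before, in a form whose measurability is known. *)
pose v t : R := fine (Q [set w | big_at (-1) (t, w)]).
have mv : measurable_fun setT v by apply: measurableT_comp => //; exact: fine_measurable.
have mvE : measurable_fun setT (fun t => (v t)%:E) by exact/measurable_EFinP.
have v0 t : (0 <= v t)%R by rewrite fine_ge0.
have afunN1 (w : lpath R) t : (-1 < afun (- alpha) w t)%R.
  by rewrite (lt_le_trans _ (afun_ge0 _ _ _))// ltrN10.
have vu t : (0 <= t)%R -> v t = u t.
  move=> t0; rewrite /v /u big_atE//; congr (fine (Q _)).
  by apply/seteqP; split => w /= [].
have sum_le n : \int[leb]_(t in `[0%R, n%:R]) (v t)%:E <= (\sum_(k < n) u 1 ^+ k)%R%:E.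
  elim: n => [|n IH]; first by rewrite big_ord0 set_itv1 integral_set1.
  rewrite (@itv_bndbnd_setU _ _ (BLeft 0%R) (BRight n%:R) (BRight n.+1%:R)) ?bnd_simp ?ler_nat//.
  rewrite ge0_integral_setU//=; last 3 first.
  - by apply: measurable_funTS; exact/measurable_EFinP.
  - by move=> t _; rewrite lee_fin.
  - apply/disj_setPS => t /= []; rewrite !in_itv/= => /andP[_ tn] /andP[nt _].
    by move: (le_lt_trans tn nt); rewrite ltxx.
  rewrite big_ord_recr/= EFinD; apply: leeD => //.
  apply: (@le_trans _ _ (\int[leb]_(t in `]n%:R, n.+1%:R]) (cst (u 1 ^+ n)%:E t))).
    apply: ge0_le_integral => //.
    - by move=> t _; rewrite lee_fin.
    - by apply: measurable_funTS; exact/measurable_EFinP.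
    - move=> t /=; rewrite in_itv/= => /andP[nt _]; rewrite lee_fin vu; last first.
        by rewrite (le_trans _ (ltW nt)).
      by rewrite -u_nat u_homo// ltW.
  rewrite integral_cst//= lebesgue_measure_itv/= lte_fin ltr_nat ltnSn -EFinB -natr1 addrAC subrr add0r.
  by rewrite -EFinM mulr1.
have geo n : (\sum_(k < n) u 1 ^+ k <= (1 - u 1)^-1)%R.
  have z1' : (0 < 1 - u 1)%R by rewrite subr_gt0.
  rewrite -[leRHS]mul1r ler_pdivlMr// mulrC -[(1 - u 1)%R]opprB mulNr -subrX1 opprB.
  by rewrite gerBl exprn_ge0//; have /andP[] := u01 (@ler01 R).
apply: (@le_lt_trans _ _ ((1 - u 1)^-1)%:E); last exact: ltry.
apply: (@le_trans _ _ (\int[leb]_(t in `[0%R, +oo[) (v t)%:E)).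
  rewrite /occupation [leRHS]integral_mkcond; apply: ge0_le_integral => //.
  - exact: measurable_Q_big.
  - have := (measurable_restrictT (fun x : R => (v x)%:E) (measurable_itv `[0%R, +oo[)).1.
    by apply; apply: measurable_funTS; exact: mvE.
  - move=> t _; rewrite patchE mem_set_itv in_itv/= andbT; have [t0|t0] := leP 0%R t; last first.
      rewrite (_ : [set w | big_at a (t, w)] = set0) ?measure0//; apply/seteqP; split => w //=.
      by rewrite big_neg.
    rewrite vu// uE// big_atE//; apply: le_measure; rewrite ?inE.
    - by apply: measurableI; [exact: meas_big|exact: alive_measurable].
    - exact: alive_measurable.
    - by move=> w [].
have /cvg_lim <- // := @ge0_cvgn_integral _ leb v v0 mv.
apply: lime_le.
  apply: ereal_nondecreasing_is_cvgn; apply/nondecreasing_seqP => n.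
  apply: ge0_subset_integral => //.
  - by apply: measurable_funTS; exact/measurable_EFinP.
  - by move=> t _; rewrite lee_fin.
  - move=> t /=; rewrite !in_itv/= => /andP[-> tn]; rewrite (le_trans tn)// ler_nat//.
by apply: nearW => n; apply: (le_trans (sum_le n)); rewrite lee_fin.
Qed.

Lemma lifetime_real w t : (0 <= t)%R -> w t \isn't a fin_num ->
  exists2 zeta : R, (0 <= zeta <= t)%R & lifetime w = zeta%:E.
Proof.
move=> t0 wt; have lt_ : lifetime w <= t%:E by rewrite leNgt lifetime_gt.
have l0 : 0 <= lifetime w by apply: le_ereal_inf_tmp => _ [r [r0 _] <-]; rewrite lee_fin.
by move: l0 lt_; case: (lifetime w) => // zeta; rewrite !lee_fin => z0 zt; exists zeta; rewrite ?z0.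
Qed.

Lemma lifetime_alive w (zeta t : R) : lifetime w = zeta%:E -> (0 <= t)%R ->
  (w t \is a fin_num) = (t < zeta)%R.
Proof. by move=> lz t0; rewrite -lifetime_gt// lz lte_fin. Qed.

Let big_dead_itv (e a zeta t : R) w : (0 <= e)%R -> lifetime w = zeta%:E ->
  big_dead a e (t, w) =
  [&& (0 <= t)%R, (a < afun (- alpha) w t)%R, (t < zeta)%R & (zeta <= t + e)%R].
Proof.
move=> e0 lz; rewrite /big_dead /big_at/=; have [t0|//] := leP 0%R t.
have te0 : (0 <= t + e)%R by exact: addr_ge0.
rewrite [(pexp 1 w (t + e) <= 0)%R]leNgt !pexp_gt0// !(lifetime_alive lz)// -leNgt.
by rewrite /= -andbA.
Qed.

Let big_dead_set (e a zeta : R) w : (0 <= e)%R -> lifetime w = zeta%:E ->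
  [set t | big_dead a e (t, w)] = [set t : R |
    [&& (0 <= t)%R, (a < afun (- alpha) w t)%R, (t < zeta)%R & (zeta <= t + e)%R]].
Proof. by move=> e0 lz; apply: eq_set => t; rewrite (big_dead_itv _ _ e0 lz). Qed.

Let meas_big_dead (e a : R) w : measurable [set t | big_dead a e (t, w)].
Proof.
have := measurable_fun_pair1 w (measurable_big_dead a e) measurableT.
by move=> /(_ [set true]); rewrite setTI; apply.
Qed.

Let big_dead_le (e a : R) w : (0 < e)%R -> leb [set t | big_dead a e (t, w)] <= e%:E.
Proof.
move=> e0; have [[t bt]|/forallNP nb] := pselect (exists t, big_dead a e (t, w)); last first.
  rewrite (_ : [set t | big_dead a _ (t, w)] = set0) ?measure0 ?lee_fin ?ltW//.
  by apply/seteqP; split => t //=; move/nb.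
have [t0 wte] : (0 <= t)%R /\ w (t + e)%R \isn't a fin_num.
  move: bt; rewrite /big_dead/big_at/= => /andP[/and3P[t0 _ _]].
  by rewrite leNgt pexp_gt0 ?addr_ge0 ?(ltW e0).
have [zeta _ lz] := lifetime_real (addr_ge0 t0 (ltW e0)) wte.
apply: (@le_trans _ _ (leb `[(zeta - e)%R, zeta[%classic)); last first.
  by rewrite lebesgue_measure_itv/= lte_fin ltrBlDr ltrDl e0 -EFinB subKr.
apply: le_measure; rewrite ?inE; [exact: meas_big_dead|exact: measurable_itv|].
rewrite (big_dead_set _ (ltW e0) lz) => r /=; rewrite in_itv/= => /and4P[_ _ -> h].
by rewrite lerBlDr h.
Qed.

(** At the lifetime zeta the additive functional has reached the exponential functional. If this
    value exceeds [a], by continuity the condition holds on all of [zeta - e, zeta[ for small e, an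
    interval of length e; otherwise, by monotonicity, it never holds before zeta. *)
Let big_dead_cvg (a : R) w : w 0%R \is a fin_num -> (exists n : nat, w n%:R \isn't a fin_num) ->
  n.+1%:R%:E * leb [set t | big_dead a (n.+1%:R^-1) (t, w)] @[n --> \oo] -->
  ind R (a < fine (exp_functional alpha (lpath_opp w)))%R.
Proof.
move=> w0 [n wn]; have [zeta /andP[z0 zn] lz] := lifetime_real (ler0n _ n) wn.
have zeta0 : (0 < zeta)%R by rewrite -(lifetime_alive lz).
have wz : w zeta \isn't a fin_num by rewrite (lifetime_alive lz)// ltxx.
rewrite (exp_functional_dead alpha z0 wz)/=.
have [az|za] := ltP a (afun (- alpha) w zeta).
  have /cvgrPdist_lt/(_ (afun (- alpha) w zeta - a)%R) := @afun_continuous _ (- alpha)%R w zeta.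
  rewrite subr_gt0 => /(_ az)[d /= d0 Hd].
  have dz0 : (0 < Num.min d zeta)%R by rewrite lt_min d0.
  have /cvgrPdist_lt/(_ _ dz0) := @cvg_harmonic R.
  move=> hk; apply: cvg_near_cst; move: hk; apply: filterS => k.
  rewrite sub0r normrN /harmonic/= gtr0_norm// lt_min => /andP[kd kz].
  have k0 : (0 < k.+1%:R^-1 :> R)%R by [].
  have -> : [set t | big_dead a k.+1%:R^-1 (t, w)] = `[(zeta - k.+1%:R^-1)%R, zeta[%classic.
    rewrite (big_dead_set _ (ltW k0) lz); apply/seteqP; split => t /=; rewrite in_itv/=.
      by move=> /and4P[_ _ -> h]; rewrite lerBlDr h.
    move=> /andP[h1 h2]; rewrite h2 -lerBlDr h1 !andbT; apply/andP; split.
      by rewrite (le_trans _ h1)// subr_ge0 ltW.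
    have /Hd : (`|zeta - t| < d)%R.
      by rewrite gtr0_norm ?subr_gt0// ltrBlDr (le_lt_trans _ (_ : k.+1%:R^-1 + t < _)%R) ?ltrD2r// -lerBlDl.
    by move=> /= /(le_lt_trans (ler_norm _)); rewrite ltrD2l ltrN2.
  by rewrite lebesgue_measure_itv/= lte_fin ltrBlDr ltrDl k0 -EFinB subKr -EFinM divff.
apply: cvg_near_cst; near=> k.
rewrite (big_dead_set _ _ lz)// (_ : mkset _ = set0) ?measure0 ?mule0//.
apply/seteqP; split => t //= /and4P[_ h tz _].
by move: (lt_le_trans h (le_trans (afun_homo _ _ (ltW tz)) za)); rewrite ltxx.
Unshelve. all: by end_near. Qed.

Lemma ae_alive0 : {ae Q, forall w, w 0%R \is a fin_num}.
Proof.
exists (~` alive 0%R); split.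
- by apply: measurableC; exact: alive_measurable.
- by rewrite probability_setC ?Q_alive0 ?subee//; exact: alive_measurable.
- by [].
Qed.

(** Survival at every integer time has probability at most Q(1 < zeta)^n for all n. *)
Lemma ae_dies : {ae Q, forall w, exists n : nat, w n%:R \isn't a fin_num}.
Proof.
  exists (\bigcap_n alive n%:R); split.
  - by apply: bigcapT_measurable => n; exact: alive_measurable.
  - apply/eqP; rewrite eq_le measure_ge0 andbT; apply/lee_addgt0Pr => e e0; rewrite add0e.
    have : (u 1 ^+ n)%R @[n --> \oo] --> 0%R.
      apply: cvg_expr; rewrite ger0_norm//; by have /andP[] := u01 (@ler01 R).
    move=> /cvgrPdist_lt/(_ _ e0)[n _ /(_ n (leqnn _))]; rewrite sub0r normrN => ne.
    apply: (@le_trans _ _ (Q (alive n%:R))).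
      apply: le_measure; rewrite ?inE.
      - by apply: bigcapT_measurable => k; exact: alive_measurable.
      - exact: alive_measurable.
      - by move=> w; apply.
    by rewrite -uE// lee_fin u_nat (le_trans (ler_norm _))// ltW.
  - move=> w /= /forallNP wn n _; rewrite /alive/=.
    by apply/negPn/negP; exact: wn.
Qed.

(** Since [fine] sends +oo to 0, positivity says two things at once: the functional is finite,
    because the path dies, and nonzero, because it is alive at time 0. *)
Lemma ae_exp_functional_gt0 :
  {ae Q, forall w, (0 < fine (exp_functional alpha (lpath_opp w)))%R}.
Proof.
apply: filterS2 ae_alive0 ae_dies => w w0 [n wn].
rewrite (exp_functional_dead alpha (ler0n _ n) wn)/= -[ltLHS](@afun_le0 _ (- alpha)%R w 0%R)//.
apply: afun_lt => //; rewrite lt_neqAle ler0n andbT; apply: contraNneq wn => <-.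
exact: w0.
Qed.

Lemma occupation_exp_functional : exists2 kappa : R, (0 < kappa)%R &
  forall a, occupation a = kappa%:E *
    Q [set w | (a < fine (exp_functional alpha (lpath_opp w)))%R].
Proof.
pose I w : R := fine (exp_functional alpha (lpath_opp w)).
have mI : measurable_fun setT I.
  by apply: measurableT_comp (measurable_exp_functional_opp alpha); exact: fine_measurable.
have mIa a : measurable_fun setT (fun w => a < I w)%R by exact: measurable_fun_ltr.
have mk a n : measurable_fun setT (fun p => ind R (big_dead a (n.+1%:R^-1) p)).
  exact: measurable_ind.
(* The rate (1 - Q(e < zeta)) / e at e = 1/(n + 1). *)
pose x n : R := (n.+1%:R * (1 - u (n.+1%:R^-1)))%R.
have inv0 (n : nat) : (0 <= (n.+1%:R^-1 : R))%R by [].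
have fubini a n : (x n)%:E * occupation a =
    \int[Q]_w (n.+1%:R%:E * leb [set t | big_dead a (n.+1%:R^-1) (t, w)]).
  rewrite /x EFinM -muleA /occupation -ge0_integralZl//; last 2 first.
  - exact: measurable_Q_big.
  - by rewrite lee_fin subr_ge0; have /andP[] := u01 (inv0 n).
  under eq_integral do rewrite -Q_big_dead//.
  transitivity (n.+1%:R%:E * \int[leb]_t \int[Q]_w ind R (big_dead a (n.+1%:R^-1) (t, w))).
    congr (_ * _); apply: eq_integral => t _; rewrite integral_ind//.
    exact: measurable_fun_pair2 (measurable_big_dead a _).
  transitivity (n.+1%:R%:E * \int[Q]_w \int[leb]_t ind R (big_dead a (n.+1%:R^-1) (t, w))).
    by congr (_ * _); exact: (fubini_tonelli (m1 := leb) (m2 := Q) _ (mk a n) (fun=> ind_ge0 R _)).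
  have mG := measurable_fun_fubini_tonelli_G (m1 := leb) _ (mk a n) (fun=> ind_ge0 R _).
  rewrite -ge0_integralZl//; last first.
    by move=> w _; apply: integral_ge0 => t _; exact: ind_ge0.
  apply: eq_integral => w _; rewrite integral_ind//.
  exact: measurable_fun_pair1 (measurable_big_dead a _).
have lim a : (x n)%:E * occupation a @[n --> \oo] --> Q [set w | (a < I w)%R].
  rewrite -integral_ind//.
  rewrite (_ : (fun n => _) = (fun n => \int[Q]_w (n.+1%:R%:E * leb [set t | big_dead a (n.+1%:R^-1) (t, w)]))); last first.
    by apply/funext => n; exact: fubini.
  have mG n := measurable_fun_fubini_tonelli_G (m1 := leb) _ (mk a n) (fun=> ind_ge0 R _).
  have [] // := @dominated_convergence _ _ _ Q setT measurableT
    (fun n w => n.+1%:R%:E * leb [set t | big_dead a (n.+1%:R^-1) (t, w)])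
    (fun w => ind R (a < I w)%R) (cst 1).
  - move=> n; apply: measurable_funeM; apply: eq_measurable_fun (mG n) => w _.
    rewrite /fubini_G integral_ind//.
    exact: measurable_fun_pair1 (measurable_big_dead a _).
  - exact: measurable_ind.
  - apply: filterS2 ae_alive0 ae_dies => w w0 wn _; exact: big_dead_cvg.
  - apply/integrableP; split => //; rewrite integral_cst//.
    apply: (@le_lt_trans _ _ (`|1| * 1)); last by rewrite mule1 /= ltry.
    by rewrite lee_pmul// probability_le1.
  - apply: aeW => w n _; rewrite gee0_abs ?mule_ge0//.
    apply: (@le_trans _ _ (n.+1%:R%:E * (n.+1%:R^-1)%:E)).
      by apply: lee_wpmul2l; [rewrite lee_fin|exact: big_dead_le].
    by rewrite -EFinM divff.
have F0 a : 0 <= occupation a by exact: integral_ge0.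
have Ffin a : occupation a \is a fin_num by rewrite ge0_fin_numE// occupation_lty.
have QI1 : Q [set w | (-1 < I w)%R] = 1.
  rewrite (_ : [set w | (-1 < I w)%R] = setT) ?probability_setT//.
  apply/seteqP; split => // w _ /=; apply: (@lt_le_trans _ _ 0%R); first exact: ltrN10.
  rewrite /I fine_ge0// exp_functional_opp; apply: integral_ge0 => r _.
  by rewrite lee_fin pexp_ge0.
have rlim a : (x n * fine (occupation a))%R @[n --> \oo] --> fine (Q [set w | (a < I w)%R]).
  have := lim a; rewrite -(fineK (Ffin a)).
  have QIfin : Q [set w | (a < I w)%R] \is a fin_num.
    apply: fin_num_measure; have := mIa a measurableT [set true]; rewrite setTI; exact.
  by rewrite -{1}(fineK QIfin) => /fine_cvgP[].
(* At the level -1 the tail has probability 1, so [x n * kappa] tends to 1. Here [kappa] is the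
   total mass of the potential, that is, the mean lifetime. *)
pose kappa := fine (occupation (-1)).
have xk : (x n * kappa)%R @[n --> \oo] --> (1 : R)%R.
  by have := rlim (-1)%R; rewrite QI1.
have k0 : (0 < kappa)%R.
  rewrite lt_neqAle fine_ge0// andbT; apply/eqP => kz.
  move: xk; rewrite -kz => xk; have : (0 : R)%R = 1%R.
    apply: (cvg_unique _ _ xk) => //; rewrite (_ : (fun n => _) = cst 0%R); first exact: cvg_cst.
    by apply/funext => n; rewrite mulr0.
  by move/eqP; rewrite eq_sym oner_eq0.
exists kappa => // a; rewrite -(fineK (Ffin a)).
have QIfin : Q [set w | (a < I w)%R] \is a fin_num.
  apply: fin_num_measure; have := mIa a measurableT [set true]; rewrite setTI; exact.
rewrite -/(I _) -(fineK QIfin) -EFinM; congr (_%:E).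
(* The limit of this product is computed in two ways, according to which factor is grouped with
   [x n]. *)
have h1 : (x n * fine (occupation a) * kappa)%R @[n --> \oo] --> (fine (Q [set w | (a < I w)%R]) * kappa)%R.
  by apply: cvgM; [exact: rlim|exact: cvg_cst].
have h2 : (x n * fine (occupation a) * kappa)%R @[n --> \oo] --> (1 * fine (occupation a))%R.
  rewrite (_ : (fun n => _) = (fun n => x n * kappa * fine (occupation a))%R).
    by apply: cvgM; [exact: xk|exact: cvg_cst].
  by apply/funext => n; rewrite mulrAC.
by rewrite mulrC -(cvg_unique _ h2 h1) ?mul1r.
Qed.

End lifetime_law.

(** * The exponential functional as a potential *)

Section potential.
Context (R : realType) (alpha gamma : R).
Hypothesis alpha_gt0 : (0 < alpha)%R.
Notation leb := (@lebesgue_measure R).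
Implicit Types (w : lpath R) (t s x u : R).

Definition perpetuity t w : R := (pexp (- alpha) w t * afun alpha w t)%R.

Lemma measurable_perpetuity : measurable_fun setT (fun p : R * lpath R => perpetuity p.1 p.2).
Proof. by apply: measurable_funM; [exact: measurable_pexp|exact: measurable_afun]. Qed.

Lemma perpetuity_stop t (t0 : (0 <= t)%R) w : perpetuity t (lstop t0 w) = perpetuity t w.
Proof. by rewrite /perpetuity afun_stop !pexpE// lstopE. Qed.

(** The tails of the exponential functional under kappa [Q] equal those of [perpetuity] under dt
    times [Q] on survival, by [occupation_exp_functional] and reversal at each fixed time. Undoing
    the tilt at each time then produces the weight e^(gamma xi_t) under [P]. *)
Lemma exp_functional_potential (P Q : probability (lpath R) R) :
  killed_increments P -> exp_tilt P gamma Q -> Q (alive 1%R) < 1 ->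
  exists2 kappa : R, (0 < kappa)%R &
  forall h : R -> \bar R, measurable_fun setT h -> (forall y, 0 <= h y) ->
  kappa%:E * \int[Q]_w h (fine (exp_functional alpha (lpath_opp w))) =
  \int[P]_w \int[leb]_(t in `]0%R, +oo[) ((kexp gamma (w t))%:E * h (perpetuity t w)).
Proof.
move=> Pinc tiltPQ Q1; have Qinc := killed_increments_tilt tiltPQ Pinc.
have [kappa k0 kE] := occupation_exp_functional Qinc Q1 alpha.
exists kappa => // h mh h0.
pose I w : R := fine (exp_functional alpha (lpath_opp w)).
have mI : measurable_fun setT I.
  by apply: measurableT_comp (measurable_exp_functional_opp alpha); exact: fine_measurable.
pose b (p : R * lpath R) : bool := (0 <= p.1)%R && (0 < pexp 1 p.2 p.1)%R.
have mb : measurable_fun setT b.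
  apply: measurable_and; first exact: measurable_fun_ler.
  by apply: measurable_fun_ltr => //; exact: measurable_pexp.
pose g (p : R * lpath R) : R := if b p then 1%R else 0%R.
have mg : measurable_fun setT g by exact: measurable_fun_ifT.
have g0 p : (0 <= g p)%R by rewrite /g; case: ifP.
have gE p (y : \bar R) : (g p)%:E * y = if b p then y else 0.
  by rewrite /g; case: ifP; rewrite ?mul1e ?mul0e.
have mhperpetuity : measurable_fun setT (fun p : R * lpath R => h (perpetuity p.1 p.2)).
  exact: measurableT_comp mh measurable_perpetuity.
have mperpetuity t : measurable_fun setT (perpetuity t) by exact: measurable_fun_pair2 measurable_perpetuity.
have mhI : measurable_fun setT (fun w => h (I w)) by exact: measurableT_comp mh mI.
rewrite -ge0_integralZl//; last by rewrite lee_fin ltW.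
transitivity (\int[Q]_w ((cst kappa w)%:E * h (I w))) => //.
pose big a (p : R * lpath R) := b p && (a < perpetuity p.1 p.2)%R.
have mbig a : measurable_fun setT (big a).
  apply: measurable_and => //; apply: measurable_fun_ltr => //; exact: measurable_perpetuity.
have bigE a t : Q [set w | big a (t, w)] = Q [set w | big_at alpha a (t, w)].
  have [t0|t0] := leP 0%R t; last first.
    congr (Q _); apply/seteqP; split => w /=; rewrite /big /b /big_at/= leNgt t0//.
  rewrite big_atE//; have -> : [set w | big a (t, w)] = alive t `&` [set w | (a < perpetuity t w)%R].
    by apply/seteqP; split => w; rewrite /big /b/= t0 pexp_gt0//= => /andP.
  (* Reversal is available for t > 0; at time 0 both functionals are 0. *)
  rewrite [in RHS]setIC; have [tpos|tle] := ltP 0%R t.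
    by rewrite -(reversal_gt Qinc alpha tpos).
  congr (Q (_ `&` _)); apply/seteqP; split => w /=; rewrite /perpetuity !afun_le0// mulr0//.
have mS (a : R) : measurable [set w | (a < I w)%R].
  have mIa : measurable_fun setT (fun w => a < I w)%R by exact: measurable_fun_ltr.
  by have := mIa measurableT [set true]; rewrite setTI; apply.
have lhs (a : R) : \int[Q]_(w in [set w | (a < I w)%R]) (cst kappa w)%:E =
    occupation Q alpha a.
  by rewrite kE -integral_cst.
have tail (a : R) : \int[Q]_(w in [set w | (a < I w)%R]) (cst kappa w)%:E =
    \int[leb \x Q]_(p in [set p | (a < perpetuity p.1 p.2)%R]) (g p)%:E.
  rewrite lhs; transitivity (\int[leb \x Q]_p ind R (big a p)).
    rewrite (fubini_tonelli1 (m1 := leb) (m2 := Q) _ (measurable_ind (mbig a)) (fun=> ind_ge0 R _)).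
    apply: eq_integral => t _; rewrite /fubini_F integral_ind; first exact: esym (bigE a t).
    exact: measurable_fun_pair2 (mbig a).
  rewrite [RHS]integral_mkcond; apply: eq_integral => p _; rewrite patchE /big /ind /g.
  rewrite (_ : (p \in _) = (a < perpetuity p.1 p.2)%R).
    by case: (_ < _)%R; rewrite ?andbT ?andbF.
  by apply/idP/idP => [/set_mem//|?]; exact: mem_set.
rewrite (integral_gt_unique _ _ _ _ _ _ _ tail)//; last 3 first.
- by move=> x; rewrite /= ltW.
- exact: measurable_perpetuity.
- by move=> a; rewrite lhs occupation_lty.
rewrite fubini_tonelli1//=; last 2 first.
- by apply: emeasurable_funM => //; exact/measurable_EFinP.
- by move=> p; rewrite mule_ge0// lee_fin.
pose F (p : R * lpath R) : \bar R := (pexp gamma p.2 p.1)%:E * h (perpetuity p.1 p.2).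
have mF : measurable_fun setT F.
  by apply: emeasurable_funM => //; apply/measurable_EFinP; exact: measurable_pexp.
have F0 p : 0 <= F p by rewrite mule_ge0// lee_fin pexp_ge0.
transitivity (\int[leb]_(t in `[0%R, +oo[) \int[P]_w F (t, w)).
  rewrite [RHS]integral_mkcond; apply: eq_integral => t _.
  rewrite patchE mem_set_itv in_itv/= andbT /fubini_F; have [t0|t0] := leP 0%R t; last first.
    by rewrite integral0_eq// => w _; rewrite gE /b/= leNgt t0.
  transitivity (\int[Q]_(w in alive t) h (perpetuity t w)).
    rewrite [RHS]integral_mkcond; apply: eq_integral => w _.
    rewrite patchE gE /b/= t0 pexp_gt0//.
    rewrite (_ : (w \in _) = (w t \is a fin_num))//.
    by apply/idP/idP => [/set_mem//|?]; exact: mem_set.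
  rewrite (tilt_integral tiltPQ (t0 := t0))//; last by move=> w; exact: perpetuity_stop.
  by apply: eq_integral => w _; rewrite /F/= pexpE.
rewrite -integral_itv_obnd_cbnd; last first.
  apply: measurable_funTS.
  exact: (measurable_fun_fubini_tonelli_F (m2 := P) F mF F0).
pose F1 (p : R * lpath R) : \bar R := if (0 < p.1)%R then F p else 0.
have mF1 : measurable_fun setT F1.
  by apply: measurable_fun_ifT => //; exact: measurable_fun_ltr.
have F10 p : 0 <= F1 p by rewrite /F1; case: ifP.
transitivity (\int[leb]_t \int[P]_w F1 (t, w)).
  rewrite [LHS]integral_mkcond; apply: eq_integral => t _.
  rewrite patchE mem_set_itv in_itv/= andbT /F1/=; case: ifP => //.
  by rewrite integral0.
transitivity (\int[P]_w \int[leb]_t F1 (t, w)); first exact: (fubini_tonelli (m1 := leb) (m2 := P)).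
apply: eq_integral => w _; rewrite [RHS]integral_mkcond; apply: eq_integral => t _.
rewrite patchE mem_set_itv in_itv/= andbT /F1/=; case: ifP => // t0.
by rewrite /F/= pexpE// ltW.
Qed.

End potential.

(** * The entrance law *)

Lemma measurable_invr (R : realType) : measurable_fun setT (fun x : R => x^-1)%R.
Proof.
apply: (eq_measurable_fun (fun x : R =>
    if 0 <= x then x `^ (-1) else - ((- x) `^ (-1)))%R).
  move=> x _; have [x0|x0] := leP 0%R x; first by rewrite powR_inv1.
  by rewrite powR_inv1 ?invrN ?opprK// oppr_ge0 ltW.
apply: measurable_fun_ifT => //; first exact: measurable_fun_ler.
have mN : measurable_fun setT (fun x : R => (- x)%R) by exact: measurable_funN.
exact: (measurableT_comp mN (measurableT_comp (@measurable_powR R (-1)%R) mN)).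
Qed.

Section entrance.
Context (R : realType) (alpha gamma : R).
Hypotheses (alpha_gt0 : (0 < alpha)%R) (gamma_gt0 : (0 < gamma)%R).
Notation leb := (@lebesgue_measure R).
Implicit Types (t x u : R).

(** If the path is positive at [s], absorption rules out an earlier zero and right continuity keeps
    any later one at a positive distance, which makes the inequality strict. *)
Lemma hitting_zero_gt (w : xpath R) (s : R) : (0 < s)%R ->
  (s%:E < hitting_zero w) = (0 < w s)%R.
Proof.
have [[wr _] w0 wa] := xpathP w.
move=> s0; apply/idP/idP => [sh|ws].
  rewrite lt_neqAle w0 ?(ltW s0)// andbT eq_sym; apply/eqP => ws.
  move: sh; rewrite ltNge => /negP; apply.
  by apply: ereal_inf_lbound; exists s.
have [e /= e0 He] : \forall u \near s^'+, (0 < w u)%R.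
  exact: cvgr_gt (wr s (ltW s0)) _ ws.
apply: (@lt_le_trans _ _ (s + e / 2)%:E); first by rewrite lte_fin ltrDl divr_gt0.
apply: le_ereal_inf_tmp => _ [t [t0 wt] <-]; rewrite lee_fin leNgt; apply/negP => te.
have [ts|st] := leP t s.
  by move: ws; rewrite (wa t s) ?ltxx// (ltW t0).
have : (0 < w t)%R.
  apply: He => //=; rewrite ltr0_norm ?subr_lt0// opprB ltrBlDl (lt_trans te)// ltrD2l.
  by rewrite ltr_pdivrMr// ltr_pMr// ltr1n.
by rewrite wt ltxx.
Qed.

Variable f1 : R -> \bar R.
Hypotheses (mf1 : measurable_fun setT f1) (f1_ge0 : forall y, 0 <= f1 y).
Hypothesis f1_0 : f1 0%R = 0.
Variable s : R.
Hypothesis s_gt0 : (0 < s)%R.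

(** The function [h] of the overview, with [f1] in place of [f]. *)
Definition entrance_fun (y : R) : \bar R :=
  (y `^ (gamma / alpha - 1))%:E * f1 ((s / y) `^ alpha^-1)%R.

Lemma measurable_entrance_fun : measurable_fun setT entrance_fun.
Proof.
apply: emeasurable_funM; first by apply/measurable_EFinP; exact: measurable_powR.
apply: measurableT_comp => //.
apply: (measurableT_comp (@measurable_powR R (alpha^-1)%R)).
apply: measurable_funM => //; exact: measurable_invr.
Qed.

Lemma entrance_fun_ge0 y : 0 <= entrance_fun y.
Proof. by rewrite mule_ge0// lee_fin powR_ge0. Qed.

(** The identity holds path by path. The density e^(alpha xi_t) of dA_t times A_t^(gamma/alpha - 1)
    is e^(gamma xi_t) (e^(-alpha xi_t) A_t)^(gamma/alpha - 1). *)
Lemma path_potential (w : lpath R) :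
  \int[leb]_(x in `]0%R, +oo[) ((x `^ (1 + gamma))^-1%:E * f1 (lamperti alpha x w s)) =
  (alpha^-1 * s `^ (- (gamma / alpha)))%:E *
  \int[leb]_(t in `]0%R, +oo[) ((kexp gamma (w t))%:E * entrance_fun (perpetuity alpha t w)).
Proof.
(* The value of [f1] at the Lamperti transform, written in u = s x^(-alpha): the starting point is x
   = (s / u)^(1/alpha). *)
pose k u : \bar R := let T := time_change alpha w u in
  if T \is a fin_num then f1 ((s / u) `^ alpha^-1 * pexp 1 w (fine T))%R else 0.
have k0 u : 0 <= k u by rewrite /k; case: ifP.
have mk : measurable_fun setT k.
  have mT : measurable_fun setT (fun u => time_change alpha w u).
    exact: measurable_fun_pair1 (measurable_time_change alpha_gt0).
  apply: measurable_fun_ifT => //.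
    apply: (measurable_fun_bool true); rewrite setTI.
    rewrite (_ : _ @^-1` _ = (fun u => time_change alpha w u) @^-1` [set~ +oo]).
      rewrite -[X in measurable X]setTI; apply: mT => //.
      exact: measurableC.
    apply/seteqP; split => u /=; have := time_change_ge0 alpha w u.
      by case: (time_change _ _ _).
    by case: (time_change _ _ _).
  apply: measurableT_comp => //; apply: measurable_funM.
    apply: (measurableT_comp (@measurable_powR R (alpha^-1)%R)).
    apply: measurable_funM => //; exact: measurable_invr.
  apply: measurableT_comp; first exact: measurable_pexp1.
  by apply: measurableT_comp mT; exact: fine_measurable.
transitivity (\int[leb]_(x in `]0%R, +oo[)
    ((x `^ (1 + gamma))^-1%:E * k (s * x `^ (- alpha))%R)).
  apply: eq_integral => x; rewrite inE/= in_itv/= andbT => x0; congr (_ * _).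
  rewrite lampertiE// /k; case: ifP => // _; congr (f1 (_ * _)).
  rewrite invfM mulrA divff ?gt_eqF// mul1r powRN invrK -powRrM divff ?gt_eqF//.
  by rewrite powRr1// ltW.
rewrite power_substitution//; congr (_ * _).
pose k' u : \bar R := (u `^ (gamma / alpha - 1))%:E * k u.
have mk' : measurable_fun setT k'.
  by apply: emeasurable_funM => //; apply/measurable_EFinP; exact: measurable_powR.
have k'0 u : 0 <= k' u by rewrite mule_ge0// lee_fin powR_ge0.
(* Levels that the additive functional never reaches have infinite time change, so [k] vanishes
   there: the transform is already absorbed. *)
transitivity (\int[leb]_(u in \bigcup_n `]0%R, afun alpha w n%:R]%classic) k' u).
  rewrite [LHS]integral_mkcond [RHS]integral_mkcond; apply: eq_integral => u _.
  rewrite !patchE mem_set_itv in_itv/= andbT.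
  have [un|un] := boolP (u \in \bigcup_n `]0%R, afun alpha w n%:R]%classic).
    have [n _] := set_mem un; rewrite /= in_itv/= => /andP[u0 _].
    by rewrite u0.
  case: ifP => // u0; rewrite /k (_ : time_change alpha w u = +oo) ?mule0//.
  apply: (time_change_infty alpha_gt0) => n; rewrite leNgt; apply/negP => un'.
  move/negP: un; apply; apply: mem_set; exists n => //=.
  by rewrite in_itv/= u0 ltW.
rewrite afun_substitution//; apply: eq_integral => t; rewrite inE/= in_itv/= andbT => t0.
rewrite pexpE ?(ltW t0)//; have [wt|wt] := boolP (w t \is a fin_num); last first.
  by rewrite (lpath_dead (ltW t0) wt)/= !mul0e.
have w0 : w 0%R \is a fin_num by apply: lpath_fin_le wt; rewrite lexx ltW.
have A0 : (0 < afun alpha w t)%R.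
  by rewrite -[ltLHS](@afun_le0 _ alpha w 0%R)// afun_lt.
rewrite /k' /k time_change_afun ?(ltW t0)//= /entrance_fun /perpetuity.
rewrite !pexpE ?(ltW t0)// !kexpE// mul1r.
set A := afun alpha w t; set xi := fine (w t).
have e0 : (0 <= expR (- alpha * xi))%R by exact: expR_ge0.
rewrite !muleA -!EFinM; congr (_%:E * f1 _).
  rewrite powRM ?(ltW A0)// -expRM mulrA -expRD; congr (expR _ * _)%R.
  by field; rewrite gt_eqF.
rewrite invfM mulrCA -expRN [in RHS]powRM ?expR_ge0 ?divr_ge0 ?(ltW s_gt0) ?(ltW A0)//.
rewrite -expRM [RHS]mulrC; congr (_ * expR _)%R.
by field; rewrite gt_eqF.
Qed.

End entrance.

(** * Integration over starting points and passage to the dual law *)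

Section conclusion.
Context (R : realType) (alpha gamma : R).
Hypotheses (alpha_gt0 : (0 < alpha)%R) (gamma_gt0 : (0 < gamma)%R).
Notation leb := (@lebesgue_measure R).

Lemma measurable_xcoord (t : R) : (0 <= t)%R -> measurable_fun setT (@xcoord R t).
Proof.
move=> t0 _ B mB; rewrite setTI; apply: sub_sigma_algebra.
by exists t, B; split => //=; rewrite in_itv/= andbT.
Qed.

Section test_function.
Variable f1 : R -> \bar R.
Hypotheses (mf1 : measurable_fun setT f1) (f1_ge0 : forall y, 0 <= f1 y).
Hypothesis f1_0 : f1 0%R = 0.
Variable s : R.
Hypothesis s_gt0 : (0 < s)%R.

(** As [f1] vanishes at 0, restricting to s < T_0 does not change the integral of [f1 (w s)]; the
    rest is transfer along [Xi]. *)
Lemma integral_lamperti (Px : probability (xpath R) R) (P : probability (lpath R) R)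
    (Xi : {mfun xpath R >-> lpath R}) (x : R) :
  (forall A, measurable A -> P A = distribution Px Xi A) ->
  {ae Px, forall w : xpath R, forall t : R, (0 <= t)%R ->
    w t = lamperti alpha x (Xi w) t} ->
  \int[Px]_(w in [set w | s%:E < hitting_zero w]) f1 (w s) =
  \int[P]_w f1 (lamperti alpha x w s).
Proof.
move=> PE XiE.
have mX : measurable_fun setT (fun w : xpath R => f1 (w s)).
  by apply: measurableT_comp mf1 _; exact: measurable_xcoord (ltW s_gt0).
have mL : measurable_fun setT (fun w => f1 (lamperti alpha x w s)).
  apply: measurableT_comp mf1 _.
  exact: measurable_fun_pair2 (measurable_lamperti alpha_gt0 s).
transitivity (\int[Px]_w f1 (w s)).
  rewrite integral_mkcond; apply: eq_integral => w _.
  rewrite patchE; case: ifPn => // /negP ws.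
  have [_ wge0 _] := xpathP w.
  have /eqP <- : 0%R == w s; last by rewrite f1_0.
  rewrite eq_le wge0 ?(ltW s_gt0)// leNgt; apply/negP => w0; apply: ws.
  by apply: mem_set; rewrite /= hitting_zero_gt.
transitivity (\int[Px]_w f1 (lamperti alpha x (Xi w) s)).
  apply: ge0_ae_eq_integral => //.
    exact: measurableT_comp mL _.
  by apply: filterS XiE => w /(_ _ (ltW s_gt0)) ->.
rewrite (@eq_measure_integral _ _ _ _ (pushforward Px Xi)); last by move=> A mA _; exact: PE.
by rewrite ge0_integral_pushforward.
Qed.

(** Tonelli puts the integral over starting points inside the expectation, where [path_potential]
    applies to each path. *)
Lemma integral_lamperti_potential (P : probability (lpath R) R) :
  \int[leb]_(x in `]0%R, +oo[)
    ((x `^ (1 + gamma))^-1%:E * \int[P]_w f1 (lamperti alpha x w s)) =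
  (alpha^-1 * s `^ (- (gamma / alpha)))%:E *
  \int[P]_w \int[leb]_(t in `]0%R, +oo[)
    ((kexp gamma (w t))%:E * entrance_fun alpha gamma f1 s (perpetuity alpha t w)).
Proof.
pose F (p : R * lpath R) : \bar R := if (0 < p.1)%R
  then ((p.1 `^ (1 + gamma))^-1)%:E * f1 (lamperti alpha p.1 p.2 s) else 0.
have mF : measurable_fun setT F.
  apply: measurable_fun_ifT => //; first exact: measurable_fun_ltr.
  apply: emeasurable_funM.
    apply/measurable_EFinP; apply: (measurableT_comp (@measurable_invr R)).
    exact: (measurableT_comp (@measurable_powR R (1 + gamma)%R) measurable_fst).
  exact: measurableT_comp mf1 (measurable_lamperti alpha_gt0 s).
have c0 (x : R) : (0 <= (x `^ (1 + gamma))^-1)%R by rewrite invr_ge0 powR_ge0.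
have F0 p : 0 <= F p by rewrite /F; case: ifP => // _; rewrite mule_ge0// lee_fin.
transitivity (\int[leb]_x \int[P]_w F (x, w)).
  rewrite integral_mkcond; apply: eq_integral => x _.
  rewrite patchE mem_set_itv in_itv/= andbT /F/=; case: ifP => [x0|_]; last first.
    by rewrite integral0.
  rewrite ge0_integralZl//; last by rewrite lee_fin.
  apply: measurableT_comp mf1 _.
  exact: measurable_fun_pair2 (measurable_lamperti alpha_gt0 s).
transitivity (\int[P]_w \int[leb]_x F (x, w)); first exact: (fubini_tonelli (m1 := leb) (m2 := P)).
pose C := (alpha^-1 * s `^ (- (gamma / alpha)))%R.
pose G (w : lpath R) := \int[leb]_(t in `]0%R, +oo[)
    ((kexp gamma (w t))%:E * entrance_fun alpha gamma f1 s (perpetuity alpha t w)).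
have GE w : \int[leb]_x F (x, w) = C%:E * G w.
  rewrite /C /G -path_potential// [RHS]integral_mkcond; apply: eq_integral => x _.
  by rewrite patchE mem_set_itv in_itv/= andbT.
have C0 : (0 < C)%R by rewrite mulr_gt0 ?invr_gt0 ?powR_gt0.
rewrite (eq_integral (fun w => C%:E * G w))//.
have G0 w : 0 <= G w.
  by apply: integral_ge0 => t _; rewrite mule_ge0// ?lee_fin ?kexp_ge0// entrance_fun_ge0.
have mCG : measurable_fun setT (fun w => C%:E * G w).
  have := measurable_fun_fubini_tonelli_G (m1 := leb) F mF F0.
  by apply: eq_measurable_fun => w _; rewrite -GE.
rewrite ge0_integralZl ?lee_fin ?(ltW C0)//.
(* Measurability of [G] is recovered from that of its multiple by the positive constant [C]. *)
apply: eq_measurable_fun (measurable_funeM (C^-1)%:E mCG) => w _.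
by rewrite /= muleA -EFinM mulVf ?mul1e// gt_eqF.
Qed.

End test_function.

(** The double dual agrees with [w] at nonnegative times only, since at negative times a path may
    take the value +oo; the functional reads nonnegative times only. *)
Lemma exp_functional_oppK (a : R) (w : lpath R) :
  exp_functional a (lpath_opp (lpath_opp w)) = exp_functional a w.
Proof.
rewrite /exp_functional.
have E (t : R) : (0 <= t)%R -> lpath_opp (lpath_opp w) t = w t.
  move=> t0; have [wf _ _ _] := lpathP w; have := wf t t0.
  by rewrite /=; case: (w t) => //= r _; rewrite opprK.
have lE : [set t | (0 <= t)%R /\ lpath_opp (lpath_opp w) t = -oo] =
    [set t | (0 <= t)%R /\ w t = -oo].
  by apply/seteqP; split => t [t0 wt]; split => //; [rewrite -(E t t0)|rewrite (E t t0)].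
rewrite /lifetime lE.
by apply: eq_integral => t /set_mem[t0 _]; rewrite E.
Qed.

Lemma measurable_exp_functional (a : R) :
  measurable_fun setT (@exp_functional R a).
Proof.
apply: eq_measurable_fun (measurableT_comp (measurable_exp_functional_opp a)
  (@measurable_lpath_opp R)) => w _.
by rewrite /= exp_functional_oppK.
Qed.

(** The integrands may differ where the real value of the functional is 0, the value of [f] at 0
    being arbitrary; [ae_exp_functional_gt0] makes this a null event. *)
Lemma integral_dual_law (Q : probability (lpath R) R) (f : R -> R) (s : R) :
  killed_increments Q -> Q (alive 1%R) < 1 -> (0 < s)%R ->
  measurable_fun (`]0%R, +oo[ : set R) f -> (forall x : R, (0 < x)%R -> (0 <= f x)%R) ->
  \int[dual_law Q]_w
    (f ((s / fine (exp_functional alpha w)) `^ alpha^-1) *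
     fine (exp_functional alpha w) `^ (gamma / alpha - 1))%:E =
  \int[Q]_w entrance_fun alpha gamma (EFin \o (f \_ `]0%R, +oo[)) s
    (fine (exp_functional alpha (lpath_opp w))).
Proof.
move=> Qinc Q1 s0 mf f0; set f1 : R -> \bar R := EFin \o _.
have f1E (y : R) : (0 < y)%R -> f1 y = (f y)%:E.
  by move=> y0; rewrite /f1/= patchE mem_set_itv in_itv/= y0.
have mf1 : measurable_fun setT f1.
  by apply/measurable_EFinP; apply/(measurable_restrictT f).
have f1_ge0 y : 0 <= f1 y.
  rewrite /f1/= patchE mem_set_itv in_itv/= andbT lee_fin.
  by case: ifP => // y0; exact: f0.
have mh := measurable_entrance_fun alpha gamma mf1 s.
have h0 y : 0 <= entrance_fun alpha gamma f1 s y by exact: entrance_fun_ge0.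
pose I (w : lpath R) : R := fine (exp_functional alpha w).
have mI : measurable_fun setT I.
  by apply: measurableT_comp (measurable_exp_functional alpha); exact: fine_measurable.
have I0 w : (0 <= I w)%R.
  by rewrite fine_ge0// integral_ge0// => t _; exact: expeR_ge0.
have hE w : (0 < I w)%R -> (f ((s / I w) `^ alpha^-1) * I w `^ (gamma / alpha - 1))%:E =
    entrance_fun alpha gamma f1 s (I w).
  move=> Iw; rewrite /entrance_fun f1E ?powR_gt0 ?divr_gt0//.
  by rewrite -EFinM mulrC.
transitivity (\int[dual_law Q]_w entrance_fun alpha gamma f1 s (I w)).
  apply: ae_eq_integral => //.
  (* The left integrand where the functional is 0, with s / 0 = 0; it is needed for measurability on
     that event. *)
  - pose c := (f (0 `^ alpha^-1) * 0 `^ (gamma / alpha - 1))%R.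
    apply: (eq_measurable_fun (fun w => if (0 < I w)%R then
        entrance_fun alpha gamma f1 s (I w) else c%:E)).
      move=> w _; case: ifPn => [/hE//|]; rewrite -leNgt => Iw.
      have Iw0 : I w = 0%R by apply/eqP; rewrite eq_le Iw I0.
      rewrite -[fine _]/(I w) Iw0 /c.
      by rewrite invr0 mulr0.
    apply: measurable_fun_ifT => //; first exact: measurable_fun_ltr.
    exact: measurableT_comp mh mI.
  - exact: measurableT_comp mh mI.
  - have [N [mN N0 subN]] := ae_exp_functional_gt0 Qinc Q1 alpha.
    have mI0 : measurable [set w | ~~ (0 < I w)%R].
      have mb : measurable_fun setT (fun w => 0 < I w)%R by exact: measurable_fun_ltr.
      rewrite (_ : [set w | _] = (fun w => 0 < I w)%R @^-1` [set false]).
        by rewrite -[X in measurable X]setTI; exact: mb.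
      by apply/seteqP; split => w /=; case: (_ < _)%R.
    exists [set w | ~~ (0 < I w)%R]; split => //.
      apply/eqP; rewrite eq_le measure_ge0 andbT -[leRHS]N0.
      apply: (@le_measure _ _ _ Q (@lpath_opp R @^-1` [set w | ~~ (0 < I w)%R]) N); rewrite ?inE//.
        by rewrite -[X in measurable X]setTI; exact: measurable_lpath_opp.
      by move=> w /negP Iw; exact: subN.
    by move=> w /= nhE; apply/negP => Iw; apply: nhE => _; exact: hE.
have mhI : measurable_fun setT (fun w => entrance_fun alpha gamma f1 s (I w)).
  exact: measurableT_comp mh mI.
have := @ge0_integral_pushforward _ _ _ _ R (@lpath_opp R) (@measurable_lpath_opp R) Q setT
  (fun w => entrance_fun alpha gamma f1 s (I w)) measurableT mhI (fun w _ => h0 _).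
by rewrite preimage_setT.
Qed.

End conclusion.

Theorem corollary1 (R : realType) (alpha : R)
  (PX : R -> probability (xpath R) R) (P : probability (lpath R) R)
  (alpha_gt0 : (0 < alpha)%R)
  (HX : pssMp alpha PX)
  (HP : lamperti_associated alpha PX P)
  (Hhit : forall x : R, (0 < x)%R -> {ae PX x, forall w, hitting_zero w < +oo})
  (gamma : R) (Pgamma : probability (lpath R) R)
  (gamma_gt0 : (0 < gamma)%R)
  (Hgamma : exp_moment P gamma 1%R setT < 1)
  (HPgamma : exp_tilt P gamma Pgamma) :
  exists2 c : R, (0 < c)%R &
  forall f : R -> R,
    measurable_fun (`]0%R, +oo[ : set R) f ->
    (forall x : R, (0 < x)%R -> (0 <= f x)%R) ->
  forall s : R, (0 < s)%R ->
    c%:E * \int[lebesgue_measure]_(x in `]0%R, +oo[)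
             ((x `^ (1 + gamma))^-1%:E *
              \int[PX x]_(w in [set w | s%:E < hitting_zero w]) (f (w s))%:E)
    = (s `^ (- (gamma / alpha)))%:E *
      \int[dual_law Pgamma]_w
        (f ((s / fine (exp_functional alpha w)) `^ alpha^-1) *
         fine (exp_functional alpha w) `^ (gamma / alpha - 1))%:E.
Proof.
have [lP Lam] := HP.
case: lP => d [W [m [Y [q [e [Xi [levy [q0 exp_e] indep_e XiE PE]]]]]]].
have Pinc := killed_increments_levy levy exp_e indep_e XiE PE.
(* The tilted survival probability at time 1 is the exponential moment, so the assumption on gamma
   makes the tilted process die. *)
have Q1 : Pgamma (alive 1%R) < 1.
  have sT : sigma_of (@lcoord R) `[0%R, 1%R] setT.
    exact: (@measurableT _ (g_sigma_algebraType (cylinders (@lcoord R) `[0%R, 1%R]))).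
  rewrite -(setTI (alive 1%R)); apply: le_lt_trans Hgamma.
  rewrite -(HPgamma 1%R setT ler01 sT) le_eqVlt; apply/orP; left; apply/eqP.
  by congr (_ (_ `&` _)); apply/seteqP; split => w /=; rewrite /alive/= lifetime_gt.
have Qinc := killed_increments_tilt HPgamma Pinc.
have [kappa kappa0 kappaE] := exp_functional_potential alpha Pinc HPgamma Q1.
(* [kappa] is the mean lifetime under [Pgamma], and [alpha] cancels the factor 1/alpha of the
   substitution u = s x^(-alpha). *)
exists (alpha / kappa)%R; first exact: divr_gt0.
move=> f mf f0 s s0; rewrite integral_dual_law//.
set f1 : R -> \bar R := EFin \o _.
have f1E (y : R) : (0 < y)%R -> f1 y = (f y)%:E.
  by move=> y0; rewrite /f1/= patchE mem_set_itv in_itv/= y0.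
have mf1 : measurable_fun setT f1.
  by apply/measurable_EFinP; apply/(measurable_restrictT f).
have f1_0 : f1 0%R = 0 by rewrite /f1/= patchE mem_set_itv in_itv/= ltxx.
have f1_ge0 y : 0 <= f1 y.
  rewrite /f1/= patchE mem_set_itv in_itv/= andbT lee_fin.
  by case: ifP => // y0; exact: f0.
have mh := measurable_entrance_fun alpha gamma mf1 s.
have h0 y : 0 <= entrance_fun alpha gamma f1 s y by exact: entrance_fun_ge0.
have -> : \int[lebesgue_measure]_(x in `]0%R, +oo[)
             ((x `^ (1 + gamma))^-1%:E *
              \int[PX x]_(w in [set w | s%:E < hitting_zero w]) (f (w s))%:E) =
    \int[lebesgue_measure]_(x in `]0%R, +oo[)
      ((x `^ (1 + gamma))^-1%:E * \int[P]_w f1 (lamperti alpha x w s)).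
  apply: eq_integral => x; rewrite inE/= in_itv/= andbT => x0; congr (_ * _).
  have [Xi' [PE' XiE']] := Lam x x0.
  rewrite -(integral_lamperti alpha_gt0 mf1 f1_ge0 f1_0 s0 PE' XiE').
  by apply: eq_integral => w /set_mem/=; rewrite hitting_zero_gt// => /f1E.
rewrite (integral_lamperti_potential alpha_gt0 gamma_gt0)// -kappaE// !muleA -!EFinM.
congr (_%:E * _).
by field; rewrite !gt_eqF.
Qed.
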